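(* Let $G$ and $H$ be locally compact, second countable, Hausdorff groups where $G$ is additionally unimodular, and let $\mathrm{Del}_*$ be the space of Delone sets in $G\times H$ with fixed parameters. Assume that $\Omega\in\mathcal{I}_{G\times H}(\mathrm{Del}_* )$ is uniquely ergodic with measure $\mu$ and that $\mathfrak{v}\in C_c(H)$ is a continuous window function. Suppose $(\Omega_l,\mu_l,G)$, $l\in\mathbb{N}$, are Delone dynamical systems with $\Omega_l\in\mathcal{I}_{G\times H}(\mathrm{Del}_* )$ such that $\Omega_l\to\Omega$ in the Chabauty-Fell topology. Then, for every self-adjoint random bounded operator $A$ over $(\ell^2(D,\mathfrak{v}))_{D\in\mathrm{Del}_*}$, $$\lim_{l\to\infty}\eta^A_{\Omega_l,\mathfrak{v},\mu_l}=\eta^A_{\Omega,\mathfrak{v}}$$ in the weak-$*$ topology of Radon measures on $\mathbb{R}$.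
   Context: Chabauty-Fell topology: for a locally compact, second countable, Hausdorff space $Z$, the set $\mathcal{C}(Z)$ of closed subsets of $Z$ carries the topology with basis $\{Y\in\mathcal{C}(Z): C\cap Y=\emptyset,\ O\cap Y\ne\emptyset\ \forall O\in\mathcal{O}\}$, $C\subseteq Z$ compact, $\mathcal{O}$ a finite family of open sets. Delone sets: fix an open neighborhood $U$ of the identity in $G\times H$ and a compact $K\subseteq G\times H$. $\mathrm{Del}_*$ is the set of non-empty $D\subseteq G\times H$ with $\#(xU\cap D)\le1$ for all $x\in G\times H$ and $D\cdot K=G\times H$; it is a compact subspace of $\mathcal{C}(G\times H)$. $G\times H$ acts by left translation, and $G$ acts on $G\times H$ and $\mathrm{Del}_*$ via $gx:=(g,e_H)x$. $\mathcal{I}_{G\times H}(\mathrm{Del}_* )$ is the set of non-empty, closed, $G\times H$-invariant subsets of $\mathrm{Del}_*$, with the topology induced from $\mathcal{C}(\mathrm{Del}_* )$. A Delone dynamical system $(\Omega,\mu,G)$ is such an $\Omega$ with a $G$-invariant Borel probability measure $\mu$; $\Omega$ is uniquely ergodic with measure $\mu$ if $\mu$ is the only $G$-invariant Borel probability measure on $\Omega$. A continuous window function is a continuous compactly supported $\mathfrak{v}:H\to[0,\infty)$. $\pi_G,\pi_H$ are the coordinate projections. $\ell^2(D,\mathfrak{v})$ is the Hilbert space of functions on $\{x\in D:\mathfrak{v}(\pi_H(x))\ne0\}$ with inner product $\langle u,v\rangle_{D,\mathfrak{v}}=\sum_{x\in D}\overline{u(x)}v(x)\mathfrak{v}(\pi_H(x))$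 (terms with weight $0$ vanish); $\delta_x$ is the indicator function of $\{x\}$ (so $\langle\delta_x,\delta_x\rangle_{D,\mathfrak{v}}=\mathfrak{v}(\pi_H(x))$). Kernels: let $X=\{(x,D,y): D\in\mathrm{Del}_*,\ x,y\in D\cap(G\times\operatorname{supp}\mathfrak{v})\}$, a closed subset of $(G\times H)\times\mathrm{Del}_*\times(G\times H)$. A kernel of finite type is a bounded continuous $a:X\to\mathbb{C}$ such that (finite range) there is a compact $K_a=K_a^{-1}\subseteq G$ with $a(x,D,y)=0$ whenever $\pi_G(x^{-1}y)\notin K_a$, and ($G$-invariance) $a(gx,gD,gy)=a(x,D,y)$ for all $g\in G$. These kernels form a $*$-algebra $\mathcal{K}^{fin}(G\times H,\mathfrak{v})$ with $a^*(x,D,y)=\overline{a(y,D,x)}$ and $(a\star b)(x,D,y)=\sum_{z\in D}a(x,D,z)b(z,D,y)\mathfrak{v}(\pi_H(z))$. For $D\in\mathrm{Del}_*$ there is a $*$-representation on $\ell^2(D,\mathfrak{v})$: $(\lambda^D(a)u)(x)=\sum_{y\in D}a(x,D,y)u(y)\mathfrak{v}(\pi_H(y))$. $\mathfrak{C}(G\times H,\mathfrak{v})$ is the $C^*$-algebra obtained as completion with respect to $\|a\|=\sup_{D\in\mathrm{Del}_*}\|\lambda^D(a)\|$, and $\lambda^D$ extends to it. A random bounded operator is a family $A=(A_D)_{D\in\mathrm{Del}_*}$ with $A_D=\lambda^D(a)$ for some $a\in\mathfrak{C}(G\times H,\mathfrak{v})$; it is self-adjoint if $a=a^*$. Density of states: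 fix a non-negative $\rho\in C_c(G)$ with $\int_G\rho\,dm_G=1$ ($m_G$ Haar measure). For self-adjoint $A$, $\eta^A_{\Omega,\mathfrak{v},\mu}$ is the measure on $\mathbb{R}$ given by $\eta^A_{\Omega,\mathfrak{v},\mu}(\phi)=\int_\Omega\sum_{x\in D}\rho(\pi_G(x))\langle\delta_x,\phi(A_D)\delta_x\rangle_{D,\mathfrak{v}}\,d\mu(D)$ for $\phi\in C_c(\mathbb{R})$; it does not depend on the choice of $\rho$. If $\Omega$ is uniquely ergodic with measure $\mu$, $\eta^A_{\Omega,\mathfrak{v}}:=\eta^A_{\Omega,\mathfrak{v},\mu}$. Weak-$*$ convergence on $\mathbb{R}$ is tested against $\phi\in C_c(\mathbb{R})$. *)

(* Defs.v *)
From HB Require Import structures.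
From mathcomp Require Import all_boot all_order all_algebra.
From mathcomp Require Import all_classical all_reals all_analysis.
From mathcomp Require Import finmap complex.
Set Implicit Arguments.
Unset Strict Implicit.
Unset Printing Implicit Defensive.
Import Order.TTheory GRing.Theory Num.Theory.
Import numFieldNormedType.Exports.
Local Open Scope classical_set_scope.
Local Open Scope ring_scope.
Local Open Scope complex_scope.

(* Topological groups, written multiplicatively. The [Pointed] component only *)
(* feeds the library's measurable types; its base point is never used.        *)
HB.mixin Record isTopologicalGroup G & Group G & PointedTopological G := {
  mulg_continuous : continuous (fun p : G * G => (p.1 * p.2)%g) ;
  invg_continuous : continuous (fun g : G => (g^-1)%g)
}.

#[short(type="topGroupType")]
HB.structure Definition TopologicalGroup :=
  {G of Group G & PointedTopological G & isTopologicalGroup G}.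

Definition lcsc_hausdorff (Z : topologicalType) : Prop :=
  [/\ locally_compact [set: Z], @second_countable Z & hausdorff_space Z].

Notation borel T := (g_sigma_algebraType (@open T)).

Definition tsupport (T : topologicalType) (V : zmodType) (f : T -> V) : set T :=
  closure [set x | f x != 0].

Definition Cc (R : realType) (T : topologicalType) : set (T -> R) :=
  [set f | continuous f /\ compact (tsupport f)].

(* On an LCSC Hausdorff group every Borel measure that is finite on compact   *)
(* sets is Radon, so regularity is not listed.                                *)
Definition left_haar (R : realType) (G : topGroupType)
    (m : {measure set (borel G) -> \bar R}) : Prop :=
  [/\ (m [set: G] != 0)%E,
      forall C : set G, compact C -> (m C < +oo)%E &
      forall (g : G) (A : set (borel G)), measurable A ->
        m [set (g * x)%g | x in A] = m A].

Definition unimodular (R : realType) (G : topGroupType) : Prop :=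
  forall m : {measure set (borel G) -> \bar R}, left_haar m ->
    forall (g : G) (A : set (borel G)), measurable A ->
      m [set (x * g)%g | x in A] = m A.

Record closedset (Z : topologicalType) := ClosedSet {
  pts :> set Z ;
  closed_pts : closed pts
}.

HB.instance Definition _ (Z : topologicalType) := gen_eqMixin (closedset Z).
HB.instance Definition _ (Z : topologicalType) := gen_choiceMixin (closedset Z).

Section chabauty_fell.
Variable Z : topologicalType.

Local Notation fell_index := (set Z * {fset (set Z)})%type.

Definition fell_dom : set fell_index :=
  [set p : fell_index | compact p.1 /\ forall O, O \in p.2 -> open O].

Definition fell_basic (p : fell_index) : set (closedset Z) :=
  [set Y | p.1 `&` pts Y = set0 /\ forall O, O \in p.2 -> O `&` pts Y !=set0].

Lemma fell_cover : \bigcup_(p in fell_dom) fell_basic p = setT.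
Proof.
rewrite -subTset => Y _; exists (set0, fset0).
  by split=> /=; [exact: compact0|].
by split=> //=; rewrite set0I.
Qed.

Lemma fell_join (p q : fell_index) (Y : closedset Z) :
  fell_dom p -> fell_dom q -> fell_basic p Y -> fell_basic q Y ->
  exists r, [/\ fell_dom r, fell_basic r Y &
                fell_basic r `<=` fell_basic p `&` fell_basic q].
Proof.
move=> [cp op] [cq oq] [pY0 pY] [qY0 qY].
exists (p.1 `|` q.1, (p.2 `|` q.2)%fset); split.
- split=> /=; first exact: compactU.
  by move=> O; rewrite in_fsetU => /orP[/op|/oq].
- split=> /=; first by rewrite setIUl pY0 qY0 setU0.
  by move=> O; rewrite in_fsetU => /orP[/pY|/qY].
- move=> X [] /=; rewrite setIUl setU_eq0 => -[X1 X2] XO.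
  by split; split=> // O Oin; apply: XO; rewrite in_fsetU Oin ?orbT.
Qed.

HB.instance Definition _ :=
  isBaseTopological.Build (closedset Z) fell_cover fell_join.

End chabauty_fell.

Section delone.
Variables G H : topGroupType.
Implicit Types (p x : G * H).

Definition lshift p (D : set (G * H)) : set (G * H) :=
  [set (p * x)%g | x in D].

Definition delone (U K D : set (G * H)) : Prop :=
  [/\ D !=set0,
      forall x, is_subset1 (lshift x U `&` D) &
      [set (d * k)%g | d in D & k in K] = [set: G * H]].

Lemma lshiftE p (D : set (G * H)) :
  lshift p D = [set x | D (p^-1 * x)%g].
Proof.
apply/seteqP; split=> x /=; first by move=> [y Dy <-]; rewrite mulKg.
by move=> Dx; exists (p^-1 * x)%g => //; rewrite mulVKg.
Qed.

Lemma lshiftM p q (D : set (G * H)) : lshift p (lshift q D) = lshift (p * q)%g D.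
Proof. by rewrite !lshiftE; apply/seteqP; split=> x /=; rewrite invgM mulgA. Qed.

Lemma lmul_continuous p : continuous (fun x : G * H => (p * x)%g).
Proof.
move=> x.
apply: (@cvg_pair _ _ _ (nbhs x) (nbhs (p.1 * x.1)%g) (nbhs (p.2 * x.2)%g)
  _ _ _ (fun y : G * H => p.1 * y.1)%g (fun y : G * H => p.2 * y.2)%g).
- apply: (cvg_comp (fun y : G * H => (p.1, y.1)) _ _
    (@mulg_continuous G (p.1, x.1))).
  by apply: cvg_pair; [exact: cvg_cst|exact: cvg_fst].
- apply: (cvg_comp (fun y : G * H => (p.2, y.2)) _ _
    (@mulg_continuous H (p.2, x.2))).
  by apply: cvg_pair; [exact: cvg_cst|exact: cvg_snd].
Qed.

Lemma closed_lshift p (D : closedset (G * H)%type) : closed (lshift p (pts D)).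
Proof.
rewrite lshiftE; apply: (@closed_comp _ _ (fun x => (p^-1 * x)%g)) => //.
  by move=> x _; exact: lmul_continuous.
exact: closed_pts.
Qed.

Lemma delone_lshift U K p D : delone U K D -> delone U K (lshift p D).
Proof.
move=> [[d Dd] DU DK]; split.
- by exists (p * d)%g, d.
- move=> x y z [Uy +] [Uz +]; rewrite lshiftE /= => Dy Dz.
  apply: (can_inj (mulKg (p^-1)%g)); apply: (DU (p^-1 * x)%g).
  + by split=> //; rewrite -lshiftM; exists y.
  + by split=> //; rewrite -lshiftM; exists z.
- rewrite -subTset => x _.
  have : [set: G * H] (p^-1 * x)%g by [].
  rewrite -DK => -[e De [k Kk ek]]; exists (p * e)%g; first by exists e.
  by exists k => //; rewrite -mulgA ek mulVKg.
Qed.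

Section parameters.
Variables U K : set (G * H).

(* A set satisfying [delone] is closed as soon as U is an open neighbourhood  *)
(* of the identity, so that ranging over closed sets loses nothing.           *)
Definition Del : set (closedset (G * H)%type) := [set D | delone U K (pts D)].

Lemma Del_act_subproof p (D : Del) :
  ClosedSet (@closed_lshift p (\val D)) \in Del.
Proof. by apply/mem_set; apply: delone_lshift; exact: (set_valP D). Qed.

Definition Del_act p (D : Del) : Del :=
  exist (fun D => D \in Del) _ (Del_act_subproof p D).

Definition invariant_closed : set (closedset Del) :=
  [set Om | pts Om !=set0 /\ forall p D, pts Om D -> pts Om (Del_act p D)].

Definition hull (Om : invariant_closed) : Type := set_type (pts (\val Om)).

HB.instance Definition _ (Om : invariant_closed) := Topological.on (hull Om).

Lemma hull_inhabited (Om : invariant_closed) : {D : Del | D \in pts (\val Om)}.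
Proof.
have [ne _] := set_valP Om; have [D OmD] := cid ne.
by exists D; exact/mem_set.
Qed.

HB.instance Definition _ (Om : invariant_closed) :=
  isPointed.Build (hull Om) (hull_inhabited Om).

Lemma hull_act_subproof (Om : invariant_closed) (g : G) (D : hull Om) :
  Del_act (g, 1%g) (\val D) \in pts (\val Om).
Proof.
by apply/mem_set; have [_ inv] := set_valP Om; apply/inv; exact: (set_valP D).
Qed.

Definition hull_act (Om : invariant_closed) (g : G) (D : hull Om) : hull Om :=
  exist (fun D => D \in pts (\val Om)) _ (hull_act_subproof g D).

Definition invariant_measure (R : realType) (Om : invariant_closed)
    (mu : probability (borel (hull Om)) R) : Prop :=
  forall (g : G) (A : set (borel (hull Om))), measurable A ->
    mu [set hull_act g D | D in A] = mu A.

Definition uniquely_ergodic (R : realType) (Om : invariant_closed)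
    (mu : probability (borel (hull Om)) R) : Prop :=
  invariant_measure mu /\
  forall nu : probability (borel (hull Om)) R, invariant_measure nu ->
    forall A : set (borel (hull Om)), measurable A -> nu A = mu A.

End parameters.
End delone.
Arguments invariant_closed {G H} U K.

(* Unconditional sum of a complex family; the four series are finite whenever *)
(* the family is absolutely summable.                                         *)
Definition rsum (R : realType) (T : choiceType) (f : T -> R) : R :=
  fine (\esum_(x in [set: T]) (f^\+ x)%:E) -
  fine (\esum_(x in [set: T]) (f^\- x)%:E).

Definition csum (R : realType) (T : choiceType) (f : T -> R[i]) : R[i] :=
  rsum (fun x => complex.Re (f x)) +i* rsum (fun x => complex.Im (f x)).

Section weighted_l2.
Variables (R : realType) (T : choiceType) (w : T -> R).

Definition inner (u v : T -> R[i]) : R[i] :=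
  csum (fun x => (u x)^* * v x * (w x)%:C).

Definition l2norm (u : T -> R[i]) : \bar R :=
  sqrte (\esum_(x in [set: T]) ((complex.Re `|u x|) ^+ 2 * w x)%:E).

Definition l2 : set (T -> R[i]) := [set u | (l2norm u < +oo)%E].

(* An operator on l2 is a map on all functions of which only the restriction  *)
(* to l2 matters.                                                             *)
Definition oper : Type := (T -> R[i]) -> (T -> R[i]).
Implicit Types A B F : oper.

Definition opnorm A : \bar R :=
  ereal_sup [set l2norm (A u) | u in [set u | (l2norm u <= 1)%E]].

Definition bounded_oper A : Prop :=
  [/\ forall u, l2 u -> l2 (A u),
      forall (c : R[i]) u v, l2 u -> l2 v -> A (c *: u + v) = c *: A u + A v &
      (opnorm A < +oo)%E].

Definition norm_cvg (An : nat -> oper) A : Prop :=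
  (fun n => opnorm (fun u => An n u - A u)) @ \oo --> 0%E.

Definition spectrum A : set R[i] :=
  [set z | ~ exists B, bounded_oper B /\
     forall u, l2 u -> B (A u - z *: u) = u /\ A (B u) - z *: B u = u].

Definition poly_oper (p : {poly R}) A : oper :=
  fun u => \sum_(i < size p) (p`_i)%:C *: iter i A u.

(* Continuous functional calculus of a self-adjoint A: phi(A) is the norm     *)
(* limit of p_n(A) for polynomials p_n tending to phi uniformly on the (real) *)
(* spectrum of A.                                                             *)
Definition is_funcalc (phi : R -> R) A F : Prop :=
  bounded_oper F /\
  exists p : nat -> {poly R},
    (forall e : R, 0 < e -> \forall n \near \oo, forall t : R,
       spectrum A t%:C -> `|(p n).[t] - phi t| <= e) /\
    norm_cvg (fun n => poly_oper (p n) A) F.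

Definition funcalc (phi : R -> R) A : oper :=
  xget (fun _ _ => 0) [set F : oper | is_funcalc phi A F].

End weighted_l2.

Section kernels.
Variables (R : realType) (G H : topGroupType) (U K : set (G * H)) (v : H -> R).

Definition window : Prop := Cc v /\ forall h, 0 <= v h.

(* l^2(D,v) consists of functions on [wpts D].                                *)
Definition wpts (D : set (G * H)) : set (G * H) := [set x | D x /\ v x.2 != 0].

Definition weight (D : set (G * H)) (x : wpts D) : R := v (\val x).2.
Local Notation wt D := (@weight (pts (\val D))).

Definition kernel : Type := G * H -> Del U K -> G * H -> R[i].

(* Kernels are total functions of which only the values on kdom matter.       *)
Definition kdom : set ((G * H) * Del U K * (G * H)) :=
  [set q | let: (x, D, y) := q in
     [/\ pts (\val D) x, pts (\val D) y, tsupport v x.2 & tsupport v y.2]].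

Definition finite_range (a : kernel) : Prop :=
  exists Ka : set G, [/\ compact Ka, [set (g^-1)%g | g in Ka] = Ka &
    forall x D y, kdom (x, D, y) -> ~ Ka (x^-1 * y)%g.1 -> a x D y = 0].

Definition kinvariant (a : kernel) : Prop :=
  forall (g : G) x D y, kdom (x, D, y) ->
    a ((g, 1) * x)%g (Del_act (g, 1%g) D) ((g, 1) * y)%g = a x D y.

Definition finite_type (a : kernel) : Prop :=
  [/\ {within kdom, continuous
         (fun q => a q.1.1 q.1.2 q.2 : (R[i] : numFieldType))},
      exists M : R, forall x D y, kdom (x, D, y) -> `|a x D y| <= M%:C,
      finite_range a &
      kinvariant a].

Definition ksub (a b : kernel) : kernel := fun x D y => a x D y - b x D y.

Definition kstar (a : kernel) : kernel := fun x D y => (a y D x)^*.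

(* For a of finite type the sum has finitely many nonzero terms.              *)
Definition lam (a : kernel) (D : Del U K) : oper R (wpts (pts (\val D))) :=
  fun u x => \sum_(y \in [set: wpts (pts (\val D))])
    a (\val x) D (\val y) * u y * (weight y)%:C.

Definition knorm (a : kernel) : \bar R :=
  ereal_sup [set opnorm (wt D) (@lam a D) | D in [set: Del U K]].

(* An element of the completion, presented by a Cauchy sequence of kernels of *)
(* finite type; two sequences present the same element iff the norm of their  *)
(* difference tends to 0.                                                     *)
Record completion := Completion {
  kseq :> nat -> kernel ;
  kseq_finite_type : forall n, finite_type (kseq n) ;
  kseq_cauchy : forall e : R, 0 < e -> exists N, forall m n,
    (N <= m)%N -> (N <= n)%N -> (knorm (ksub (kseq m) (kseq n)) <= e%:E)%E
}.

Definition completion_selfadj (a : completion) : Prop :=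
  (fun n => knorm (ksub (a n) (kstar (a n)))) @ \oo --> 0%E.

Definition is_lam (a : completion) (D : Del U K)
    (B : oper R (wpts (pts (\val D)))) : Prop :=
  bounded_oper (wt D) B /\
  norm_cvg (wt D) (fun n => @lam (a n) D) B.

Definition oper_family : Type := forall D : Del U K, oper R (wpts (pts (\val D))).

Definition selfadj_random_operator (A : oper_family) : Prop :=
  exists a : completion, completion_selfadj a /\ forall D, is_lam a (A D).

Definition delta (D : set (G * H)) (x : G * H) : wpts D -> R[i] :=
  fun y => (\val y == x)%:R.

(* eta^A(phi); the integrand is real since A D is self-adjoint, and its sum   *)
(* is finite because rho and v are compactly supported.                       *)
Definition dos_functional (rho : G -> R) (A : oper_family)
    (Om : invariant_closed U K) (mu : probability (borel (hull Om)) R)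
    (phi : R -> R) : \bar R :=
  (\int[mu]_(D in [set: hull Om])
    (complex.Re (\sum_(x \in pts (\val (\val D))) (rho x.1)%:C *
       inner (wt (\val D)) (delta x)
         (funcalc (wt (\val D)) phi (A (\val D)) (delta x)))%R)%:E)%E.

(* The density of states: the unique Radon (i.e. locally finite Borel)        *)
(* measure on the line with these integrals, which exists by Riesz-Markov.    *)
Definition is_dos (rho : G -> R) (A : oper_family)
    (Om : invariant_closed U K) (mu : probability (borel (hull Om)) R)
    (eta : {measure set (measurableTypeR R) -> \bar R}) : Prop :=
  (forall C : set R, compact C -> (eta C < +oo)%E) /\
  forall phi : R -> R, Cc phi ->
    (\int[eta]_t (phi t)%:E)%E = dos_functional rho A mu phi.

Definition dos (rho : G -> R) (A : oper_family)
    (Om : invariant_closed U K) (mu : probability (borel (hull Om)) R) :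
    {measure set (measurableTypeR R) -> \bar R} :=
  xget (mzero : {classic {measure set (measurableTypeR R) -> \bar R}})
    [set eta | is_dos rho A mu eta].

End kernels.

Definition weak_star_cvg (R : realType)
    (nu : nat -> {measure set (measurableTypeR R) -> \bar R})
    (nu0 : {measure set (measurableTypeR R) -> \bar R}) : Prop :=
  forall phi : R -> R, Cc phi ->
    (fun l => \int[nu l]_t (phi t)%:E)%E @ \oo --> (\int[nu0]_t (phi t)%:E)%E.

(* Main.v *)
Require Import Defs.
From HB Require Import structures.
From mathcomp Require Import all_boot all_order all_algebra.
From mathcomp Require Import all_classical all_reals all_analysis.
From mathcomp Require Import measurable_realfun.
From mathcomp Require Import finmap complex ring lra.
Set Implicit Arguments.
Unset Strict Implicit.
Unset Printing Implicit Defensive.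
Import Order.TTheory GRing.Theory Num.Theory.
Import numFieldNormedType.Exports.
Local Open Scope classical_set_scope.
Local Open Scope ring_scope.
Import ComplexField.Normc.

(** Fix [phi] in C_c(R). For each system the integral of [phi] against the
    density of states is the mean over the hull of one and the same function on
    the compact space of Delone sets,
      [local_dos rho A phi D =
         sum over x in D of rho(x_G) <delta_x, phi(A_D) delta_x>].
    The theorem holds because this function is continuous and because the means
    of any continuous function converge.

    Continuity ([local_dos_continuous]). The operators [A_D] are norm limits,
    uniformly in [D], of operators given by kernels of finite type
    ([lam_uniform_cvg]), and [phi(A_D)] is approximated by polynomials in [A_D],
    uniformly in [D] because the norms are bounded in [D] ([qform_approx]). As
    uniform limits of continuous functions are continuous, it remains to treat a
    polynomial in a kernel of finite type. Its diagonal entries, and the sum over [x], are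
    iterated sums over the points of [D] in compact sets. Such sums are
    continuous in [D] ([cvg_local_sum]): inside a compact set, the points of a
    Delone set close to [D] correspond one to one to nearby points of [D], by the
    definition of the Chabauty-Fell topology and uniform discreteness.

    Convergence of means ([hull_mean_cvg]). It suffices to converge along every
    ultrafilter on the indices. There the means of all continuous functions have
    limits, which define a normalised linear functional, invariant under [G]. A
    continuous function that is nonnegative on the limit hull is at least [- e]
    on all hulls close to it, since the compact set where it is at most [- e]
    misses the limit hull; so the functional is positive on functions on the
    limit hull. The Riesz-Markov theorem ([riesz_integral]) turns it into an
    invariant probability measure there, which is [mu] by unique ergodicity
    ([uniquely_ergodic_mean]).

    Two prerequisites occupy the first half. The functional calculus is
    specified by polynomial approximation on the spectrum, and its existence and
    independence of the approximating polynomials rest on the bound of the norm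
    of [p(A)] by the supremum of [|p|] over the set of real [t] where [A - t]
    is not bounded below ([spectral_bound]). That the density of states exists as
    a measure follows from Riesz-Markov on the line, because [local_dos] is
    linear in [phi] and nonnegative if [phi] is ([dos_integral]). *)

(** * The Riesz-Markov measure of a positive functional *)

Section borel_measurable.
Context {R : realType} {X : ptopologicalType}.

Lemma borel_open (O : set X) : open O -> measurable (O : set (borel X)).
Proof. by move=> oO; exact: sub_sigma_algebra. Qed.

Lemma continuous_borel_measurable (f : X -> R) : continuous f ->
  measurable_fun [set: borel X] (f : borel X -> measurableTypeR R).
Proof.
move=> /continuousP cf.
apply: (measurability _ (RGenOpens.measurableE R)).
move=> _ [_ [a [b ->]] <-]; rewrite setTI; apply: borel_open.
by apply: cf; exact: interval_open.
Qed.
End borel_measurable.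

Section continuous_lattice.
Context {R : realType} {Y : topologicalType}.
Implicit Types f g : Y -> R.

Lemma continuous_add f g : continuous f -> continuous g ->
  continuous (fun y => f y + g y).
Proof. by move=> cf cg y; apply: cvgD; [exact: cf|exact: cg]. Qed.

Lemma continuous_scale (c : R) f : continuous f -> continuous (fun y => c * f y).
Proof. by move=> cf y; apply: cvgMr; exact: cf. Qed.

Lemma continuous_sum (I : Type) (r : seq I) (P : pred I) (F : I -> Y -> R) :
  (forall i, continuous (F i)) -> continuous (fun y => \sum_(i <- r | P i) F i y).
Proof.
move=> cF; elim: r => [|i r IH].
  by under eq_fun do rewrite big_nil; exact: cst_continuous.
under eq_fun do rewrite big_cons; case: (P i) => //.
exact: continuous_add (cF i) IH.
Qed.

Lemma continuous_min f g : continuous f -> continuous g ->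
  continuous (fun y => Num.min (f y) (g y)).
Proof. exact: min_fun_continuous. Qed.

Lemma continuous_max f g : continuous f -> continuous g ->
  continuous (fun y => Num.max (f y) (g y)).
Proof. exact: max_fun_continuous. Qed.

End continuous_lattice.

(** The functional is defined on the continuous functions of an ambient space
    [Y] and positive on those that are nonnegative on [j @` K]. This covers both
    uses below: [X] a compact subspace of [Y] with [K = setT], and [X = Y] the
    real line with [K] a segment. *)
Section riesz.
Context {R : realType} {X : ptopologicalType} {Y : topologicalType}.
Variables (j : X -> Y) (K : set X) (Lam : (Y -> R) -> R).
Hypothesis jcont : continuous j.
Hypothesis Kcpt : compact K.
Hypothesis separation : forall (O : set X) x, open O -> O x ->
  exists f : Y -> R, [/\ continuous f, forall y, 0 <= f y <= 1, f (j x) = 1 &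
    forall z, ~ O z -> f (j z) = 0].
Hypothesis LamD : forall f g : Y -> R, continuous f -> continuous g ->
  Lam (fun y => f y + g y) = Lam f + Lam g.
Hypothesis LamZ : forall (c : R) (f : Y -> R), continuous f -> Lam (fun y => c * f y) = c * Lam f.
Hypothesis Lam_ge0 : forall f : Y -> R, continuous f -> (forall x, K x -> 0 <= f (j x)) ->
  0 <= Lam f.

Let one : Y -> R := fun=> 1.

Let cone : continuous one. Proof. exact: cst_continuous. Qed.

Let Lam_le (f g : Y -> R) : continuous f -> continuous g ->
  (forall x, K x -> f (j x) <= g (j x)) -> Lam f <= Lam g.
Proof.
move=> cf cg fg; rewrite -subr_ge0 -mulN1r -LamZ// -LamD//; last first.
  exact: continuous_scale.
apply: Lam_ge0; first by apply: continuous_add => //; exact: continuous_scale.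
by move=> x Kx; rewrite mulN1r subr_ge0; exact: fg.
Qed.

Let Lam_sum (I : Type) (r : seq I) (F : I -> Y -> R) :
  (forall i, continuous (F i)) ->
  Lam (fun y => \sum_(i <- r) F i y) = \sum_(i <- r) Lam (F i).
Proof.
move=> cF; elim: r => [|i r IH].
  rewrite big_nil -[RHS](mul0r (Lam one)) -LamZ//.
  by congr Lam; apply/funext => y; rewrite big_nil mul0r.
rewrite big_cons -IH -LamD//; last exact: continuous_sum.
by congr Lam; apply/funext => y; rewrite big_cons.
Qed.

Definition below (O : set X) (f : Y -> R) : Prop :=
  [/\ continuous f, forall x, 0 <= f (j x) <= 1 &
      forall x, ~ O x -> f (j x) = 0].

Definition riesz_inner (O : set X) : \bar R :=
  ereal_sup [set (Lam f)%:E | f in below O].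

Definition riesz_outer (A : set X) : \bar R :=
  ereal_inf [set riesz_inner O | O in [set O | open O /\ A `<=` O]].

Let below_le1 O f : below O f -> Lam f <= Lam one.
Proof. by move=> [cf f01 _]; apply: Lam_le => // x _; case/andP: (f01 x). Qed.

Let below_ge0 O f : below O f -> 0 <= Lam f.
Proof. by move=> [cf f01 _]; apply: Lam_ge0 => // x _; case/andP: (f01 x). Qed.

Let below0 O : below O (fun=> 0).
Proof. by split => // x; [exact: cst_continuous|rewrite lexx ler01]. Qed.

Let inner_ge O f : below O f -> ((Lam f)%:E <= riesz_inner O)%E.
Proof. by move=> fO; apply: ereal_sup_ubound; exists f. Qed.

Let inner_le O e : (forall f, below O f -> ((Lam f)%:E <= e)%E) ->
  (riesz_inner O <= e)%E.
Proof. by move=> H; apply: ge_ereal_sup => _ [f fO <-]; exact: H. Qed.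

Let inner_ge0 O : (0 <= riesz_inner O)%E.
Proof. by apply: le_trans (inner_ge (below0 O)); rewrite lee_fin (below_ge0 (below0 O)). Qed.

Let inner_mono O O' : O `<=` O' -> (riesz_inner O <= riesz_inner O')%E.
Proof.
move=> OO'; apply: inner_le => f [cf f01 fO]; apply: inner_ge.
by split => // x O'x; apply: fO => /OO'.
Qed.

Let inner_fin O : riesz_inner O \is a fin_num.
Proof.
rewrite ge0_fin_numE//; apply: (@le_lt_trans _ _ (Lam one)%:E); last exact: ltry.
by apply: inner_le => f /below_le1; rewrite lee_fin.
Qed.

Let outer_ge0 A : (0 <= riesz_outer A)%E.
Proof. by apply: le_ereal_inf_tmp => _ [ O _ <-]. Qed.

Lemma riesz_outer_open O : open O -> riesz_outer O = riesz_inner O.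
Proof.
move=> oO; apply/eqP; rewrite eq_le; apply/andP; split.
  by apply: ereal_inf_lbound; exists O => //; split.
by apply: le_ereal_inf_tmp => _ [ O' [_ OO'] <-]; exact: inner_mono.
Qed.

Let outer_fin A : riesz_outer A \is a fin_num.
Proof.
rewrite ge0_fin_numE//; apply: (@le_lt_trans _ _ (riesz_inner setT)).
  by apply: ereal_inf_lbound; exists setT => //; split => //; exact: openT.
by rewrite -ge0_fin_numE.
Qed.

(** A test function below a countable union is, up to [d], below a finite sum
    of test functions: the part of [K] where it is at least [d] is compact. *)
Let inner_bigcup (O : nat -> set X) : (forall n, open (O n)) ->
  (riesz_inner (\bigcup_n O n) <= \sum_(n <oo) riesz_inner (O n))%E.
Proof.
move=> oO; apply: inner_le => f fO; have [cf f01 f0] := fO.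
apply/lee_addgt0Pr => e e0.
(* Lowering the test function by [d] costs at most [d * Lam one <= e]. *)
pose d := e / (Lam one + 1).
have L0 : 0 <= Lam one by apply: Lam_ge0.
have d0 : 0 < d by rewrite divr_gt0// ltr_wpDl.
pose Q := K `&` [set x | d <= f (j x)].
have cQ : compact Q.
  apply: compact_closedI => //; apply: (@preimage_closed _ _ (f \o j) [set y | d <= y]).
    by move=> x _; apply: continuous_comp; [exact: jcont|exact: cf].
  exact: closed_ge.
have H x : exists p : nat * (Y -> R), Q x ->
    [/\ O p.1 x, below (O p.1) p.2 & p.2 (j x) = 1].
  have [Qx|nQx] := pselect (Q x); last by exists (0%N, one).
  have [n _ Onx] : (\bigcup_n O n) x.
    by apply: contrapT => /f0 f0x; move: Qx => -[_] /=; rewrite f0x leNgt d0.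
  have [u [cu u01 u1 u0]] := separation (oO n) Onx.
  by exists (n, u) => _; split => //; split.
have [s sP] := choice H.
have := cQ; rewrite compact_cover => /(_ X Q (fun x => [set z | 1/2 < (s x).2 (j z)])).
case.
- move=> x Qx; have [_ [cu _ _] _] := sP _ Qx.
  apply: (@open_comp _ _ ((s x).2 \o j) [set y | 1/2 < y]).
    by move=> z _; apply: continuous_comp; [exact: jcont|exact: cu].
  exact: open_gt.
- by move=> x Qx; exists x => //=; have [_ _ ->] := sP _ Qx; lra.
move=> D DQ QD.
pose N := \max_(x <- D) (s x).1.+1.
pose g n y := Num.min 1 (\sum_(x <- D | (s x).1 == n) 2 * (s x).2 y).
have DP x : x \in D -> [/\ O (s x).1 x, below (O (s x).1) (s x).2 & (s x).2 (j x) = 1].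
  by move=> /DQ /set_mem; exact: sP.
have gE n y : g n y = Num.min 1 (\sum_(x <- D) (if (x \in D) && ((s x).1 == n) then 2 * (s x).2 y else 0)).
  by rewrite /g big_seq_cond big_mkcond.
have gb n : below (O n) (g n).
  split.
  - rewrite (_ : g n = (fun=> 1) \min (fun y => \sum_(x <- D) (if (x \in D) && ((s x).1 == n) then 2 * (s x).2 y else 0))); last first.
      by apply/funext => y; rewrite gE.
    apply: min_fun_continuous; first exact: cst_continuous.
    apply: continuous_sum => x.
    case: (boolP ((x \in D) && _)) => [|_]; last exact: cst_continuous.
    by move=> /andP[/DP[_ [cu _ _] _] _]; exact: continuous_scale.
  - move=> x; rewrite gE ge_min lexx/= andbT le_min ler01/=.
    apply: sumr_ge0 => z _; case: ifP => // /andP[/DP[_ [_ u01 _] _] _].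
    by rewrite mulr_ge0//; case/andP: (u01 x).
  - move=> x nOx; rewrite gE big1 ?minEle ?ler10// => z _; case: ifP => // /andP[/DP[_ [_ _ u0] _] /eqP zn].
    by rewrite u0 ?mulr0 ?zn.
have fg x : K x -> f (j x) <= \sum_(n < N) g n (j x) + d * 1.
  move=> Kx; have g0 n : 0 <= g n (j x) by have [_ /(_ x)/andP[]] := gb n.
  have [fd|df] := ltP (f (j x)) d.
    by rewrite mulr1 (le_trans (ltW fd))// lerDr sumr_ge0.
  have [z zD /= zx] : cover [set` D] (fun x => [set z | 1/2 < (s x).2 (j z)]) x by exact: QD.
  have zN : ((s z).1 < N)%N.
    by rewrite /N (big_rem z)//= leq_max leqnn.
  rewrite mulr1 (le_trans (y := 1)) //; first by case/andP: (f01 x).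
  rewrite (bigD1 (Ordinal zN))//= (le_trans (y := 1 + 0 + 0)) ?addr0//.
  rewrite -[leLHS]addr0 -[1]addr0 lerD//; last exact: ltW.
  rewrite lerD//; last by apply: sumr_ge0.
  rewrite /g le_min lexx/= (big_rem z)//= eqxx (le_trans (y := 2 * (s z).2 (j x) + 0))//.
    by move: zx; rewrite addr0; set t := _ (j x); lra.
  rewrite lerD2l big_seq_cond sumr_ge0// => w /andP[/mem_rem/DP[_ [_ u01 _] _] _].
  by rewrite mulr_ge0//; case/andP: (u01 x).
have cg : continuous (fun y => \sum_(n < N) g n y).
  by apply: continuous_sum => n; case: (gb n).
have : Lam f <= \sum_(n < N) Lam (g n) + d * Lam one.
  rewrite -(Lam_sum _ (F := fun n : 'I_N => g n)); last by move=> n; case: (gb n).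
  rewrite -LamZ// -LamD//; last exact: continuous_scale.
  by apply: Lam_le => //; apply: continuous_add => //; exact: continuous_scale.
rewrite -lee_fin => /le_trans; apply; rewrite EFinD leeD//.
- rewrite -sumEFin (le_trans (y := (\sum_(n < N) riesz_inner (O n))%E))//.
    by apply: lee_sum => n _; exact: inner_ge.
  by rewrite -(big_mkord xpredT (fun n => riesz_inner (O n))); exact: nneseries_lim_ge.
- rewrite lee_fin /d mulrAC ler_pdivrMr ?ltr_wpDl// ler_wpM2l ?(ltW e0)//.
  by rewrite lerDl.
Qed.

Let outer0 : riesz_outer set0 = 0%E.
Proof.
rewrite riesz_outer_open; last exact: open0.
apply/eqP; rewrite eq_le inner_ge0 andbT; apply: inner_le => f [cf _ f0].
rewrite lee_fin -[leRHS](mul0r (Lam one)) -LamZ//; apply: Lam_le => //.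
  exact: continuous_scale.
by move=> x _; rewrite mul0r f0.
Qed.

Let outer_subadditive A (F : nat -> set X) :
  subset_sigma_subadditive riesz_outer A F.
Proof.
move=> AF; apply/lee_addgt0Pr => e e0.
have H n : exists O, [/\ open O, F n `<=` O &
    (riesz_inner O <= riesz_outer (F n) + (e / (2 ^ n.+1)%:R)%:E)%E].
  have en : 0 < e / (2 ^ n.+1)%:R by rewrite divr_gt0// ltr0n expn_gt0.
  have [_ [ O [oO FO] <-] /ltW le] := lb_ereal_inf_adherent en (outer_fin (F n)).
  by exists O.
have [ O OP] := choice H.
apply: (@le_trans _ _ (riesz_inner (\bigcup_n O n))).
  apply: ereal_inf_lbound; exists (\bigcup_n O n) => //; split.
    by apply: bigcup_open => n _; case: (OP n).
  by apply: (subset_trans AF); apply: subset_bigcup => n _; case: (OP n).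
apply: (le_trans (inner_bigcup _)); first by move=> n; case: (OP n).
apply: le_trans (epsilon_trick xpredT _ (ltW e0)); last by move=> n; exact: outer_ge0.
by apply: lee_nneseries => // n _; have [_ _ h] := OP n; exact: h.
Qed.

HB.instance Definition _ := isSubsetOuterMeasure.Build R X riesz_outer
  outer0 outer_ge0 outer_subadditive.

(** For [f] below [V `&` O], the open set [W] where [f] is small contains the
    part of [V] outside [O], and [f], lowered by [d], can be added to any test
    function below [W] without exceeding [1]. *)
Let caratheodory_open O : open O -> riesz_outer.-caratheodory O.
Proof.
move=> oO; apply: le_caratheodory_measurable => A.
apply: le_ereal_inf_tmp => _ [V [oV AV] <-].
have oVO : open (V `&` O) by exact: openI.
apply: (@le_trans _ _ (riesz_inner (V `&` O) + riesz_outer (A `&` ~` O))%E).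
  rewrite leeD2r// -riesz_outer_open//; apply: le_outer_measure.
  by apply: setSI.
rewrite -leeBrDr//; apply: inner_le => f [cf f01 f0]; rewrite leeBrDr//.
apply/lee_addgt0Pr => e e0.
have L0 : 0 <= Lam one by apply: Lam_ge0.
pose d := e / (Lam one + 1).
have d0 : 0 < d by rewrite divr_gt0// ltr_wpDl.
pose W := V `&` [set x | f (j x) < d].
have oW : open W.
  apply: openI => //; apply: (@open_comp _ _ (f \o j) [set y | y < d]).
    by move=> z _; apply: continuous_comp; [exact: jcont|exact: cf].
  exact: open_lt.
rewrite addeC -leeBrDr//; apply: (@le_trans _ _ (riesz_inner W)).
  apply: ereal_inf_lbound; exists W => //; split => // x [Ax nOx].
  by split; [exact: AV|rewrite /= f0// => -[]].
apply: inner_le => g [cg g01 g0]; rewrite leeBrDr//.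
pose h := (fun=> 0) \max (fun y => f y + - d * one y).
have ch : continuous h.
  apply: max_fun_continuous; first exact: cst_continuous.
  by apply: continuous_add => //; exact: continuous_scale.
have hg : below V (fun y => h y + g y).
  split; first exact: continuous_add.
    move=> x; have := f01 x; have := g01 x; rewrite /h /one /= mulr1.
    have [Wx|/g0 ->] := pselect (W x).
      by move: Wx => [_ /= fd]; rewrite max_l; lra.
    by rewrite maxEle; case: ifP; lra.
  move=> x nVx; rewrite g0; last by case.
  by rewrite /h /= f0; [rewrite max_l ?addr0// /one; lra|case].
have : Lam g + Lam f <= Lam (fun y => h y + g y) + e.
  rewrite LamD//.
  have : Lam f + - d * Lam one <= Lam h.
    rewrite -LamZ// -LamD//; last exact: continuous_scale.
    apply: Lam_le => //.
      by apply: continuous_add => //; exact: continuous_scale.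
    by move=> x _; rewrite le_max lexx orbT.
  have : d * Lam one <= e.
    rewrite /d mulrAC ler_pdivrMr ?ltr_wpDl// ler_wpM2l ?(ltW e0)//.
    by rewrite lerDl.
  by rewrite mulNr; lra.
rewrite -lee_fin !EFinD => /le_trans; apply.
by rewrite leeD2r// inner_ge.
Qed.

Let borel_caratheodory (A : set (borel X)) : measurable A ->
  riesz_outer.-caratheodory A.
Proof.
move: A; apply: smallest_sub => [|O]; last exact: caratheodory_open.
split.
- exact: (caratheodory_measurable_set0 riesz_outer).
- by move=> A /(caratheodory_measurable_setC (mu := riesz_outer)); rewrite setTD.
- by move=> F; exact: (caratheodory_measurable_bigcup (mu := riesz_outer)).
Qed.

Definition riesz_set (A : set (borel X)) : \bar R := riesz_outer A.

Let riesz_sigma_additive : semi_sigma_additive riesz_set.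
Proof.
move=> F mF tF mUF.
apply: (caratheodory_measure_sigma_additive (mu := riesz_outer) _ tF).
  by move=> n; exact: borel_caratheodory.
exact: borel_caratheodory.
Qed.

HB.instance Definition _ := isMeasure.Build _ _ _ riesz_set
  outer0 (outer_ge0 : forall A, (0 <= riesz_set A)%E) riesz_sigma_additive.

Definition riesz_measure : {measure set (borel X) -> \bar R} := riesz_set.

Lemma riesz_measureE A : riesz_measure A = riesz_outer A.
Proof. by []. Qed.

Lemma riesz_measureT : riesz_measure setT = (Lam one)%:E.
Proof.
rewrite riesz_measureE riesz_outer_open; last exact: openT.
apply/eqP; rewrite eq_le; apply/andP; split.
  by apply: inner_le => f /below_le1; rewrite lee_fin.
by apply: inner_ge; split => // x; rewrite ?lexx ?ler01//; case.
Qed.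

Let clamp (t : R) := Num.min 1 (Num.max 0 t).

Let sum_clamp (t : R) m : 0 <= t ->
  \sum_(k < m) clamp (t - k%:R) = Num.min t m%:R.
Proof.
move=> t0; elim: m => [|m IH]; first by rewrite big_ord0 min_r.
rewrite big_ord_recr/= IH /clamp -natr1.
by rewrite !minEle !maxEle; do ![case: ifP => /=]; lra.
Qed.

Let sum_above (t : R) m : 0 <= t ->
  \sum_(k < m) ((k%:R < t)%R)%:R <= Num.min (t + 1) m%:R.
Proof.
move=> t0; elim: m => [|m IH]; first by rewrite big_ord0 min_r// addr_ge0.
rewrite big_ord_recr/= -natr1; move: IH; rewrite !minEle.
by case: (ltP m%:R t) => /=; do ![case: ifP => /=]; lra.
Qed.

(** The function [n * f] is sliced into [n] layers of height [1], each of which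
    is a test function below the open set where [n * f] exceeds its level; the
    indicators of these sets add up to at most [n * f + 1]. *)
Let Lam_le_integral (f : Y -> R) : continuous f ->
  (forall x, 0 <= f (j x) <= 1) ->
  ((Lam f)%:E <= \int[riesz_measure]_x (f (j x))%:E)%E.
Proof.
move=> cf f01; apply/lee_addgt0Pr => e e0.
have L0 : 0 <= Lam one by apply: Lam_ge0.
pose n := (Num.truncn (Lam one / e)).+1.
have n0 : 0 < n%:R :> R by rewrite ltr0n.
pose u (k : nat) y := clamp (n%:R * f y + - k%:R * one y).
have cu k : continuous (u k).
  rewrite /u /clamp.
  apply: continuous_min; first exact: cst_continuous.
  apply: continuous_max; first exact: cst_continuous.
  by apply: continuous_add; exact: continuous_scale.
pose O k := [set x | k%:R < n%:R * f (j x)].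
have cfj : continuous (f \o j).
  by move=> x; apply: continuous_comp; [exact: jcont|exact: cf].
have oO k : open (O k).
  apply: (@open_comp _ _ (fun x => n%:R * (f \o j) x) [set y | k%:R < y]).
    by move=> z _; exact: continuous_scale.
  exact: open_gt.
have bu k : below (O k) (u k).
  split => // x; rewrite /u /clamp /one mulr1.
    by rewrite minEle maxEle; do ![case: ifP => /=]; lra.
  by rewrite /O /= => /negP; rewrite -leNgt => h; rewrite max_l ?min_r; lra.
have Lu k : ((Lam (u k))%:E <= riesz_measure (O k))%E.
  by rewrite riesz_measureE riesz_outer_open//; exact: inner_ge.
have LE : n%:R * Lam f <= \sum_(k < n) Lam (u k).
  rewrite -LamZ// -(Lam_sum _ (F := fun k : 'I_n => u k))//; apply: Lam_le.
  - exact: continuous_scale.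
  - exact: continuous_sum.
  move=> x _; have /andP[f0 f1] := f01 x.
  under eq_bigr do rewrite /u /one mulr1.
  by rewrite sum_clamp ?mulr_ge0// min_l// ger_pMr.
have mO k : measurable (O k : set (borel X)) by exact: borel_open.
have mf : measurable_fun [set: borel X] (f \o j : borel X -> measurableTypeR R).
  exact: continuous_borel_measurable.
have muT : riesz_measure setT = (Lam one)%:E by exact: riesz_measureT.
have intO : (\sum_(k < n) riesz_measure (O k) <=
    n%:R%:E * \int[riesz_measure]_x (f (j x))%:E + (Lam one)%:E)%E.
  have mI k : measurable_fun [set: borel X] (fun x => (\1_(O k) x)%:E : \bar R).
    by apply/measurable_EFinP; exact: measurable_indic.
  under eq_bigr do rewrite -[(O _)]setIT -integral_indic//.
  rewrite -ge0_integral_sum//.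
  rewrite -muT -[X in (_ + X)%E]mul1e -integral_cst//.
  rewrite -ge0_integralZl_EFin//; first last.
  - exact/measurable_EFinP.
  - by move=> x _; rewrite lee_fin; case/andP: (f01 x).
  rewrite -ge0_integralD//; first last.
  - by apply/measurable_EFinP; exact: measurable_funM.
  - by move=> x _; rewrite lee_fin mulr_ge0//; case/andP: (f01 x).
  apply: ge0_le_integral => //.
  - by move=> x _; apply: sume_ge0 => k _; rewrite lee_fin.
  - exact: emeasurable_sum.
  - apply: emeasurable_funD => //.
    by apply/measurable_EFinP; exact: measurable_funM.
  move=> x _; rewrite sumEFin -EFinM -EFinD lee_fin.
  have /andP[f0 f1] := f01 x.
  have := @sum_above (n%:R * f (j x)) n; rewrite mulr_ge0// => /(_ isT).
  rewrite le_min => /andP[+ _]; apply: le_trans; apply: ler_sum => k _.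
  rewrite indicE /O; case: (boolP (_ \in _)); rewrite ?ler0n//.
  by move/set_mem => /= ->.
have : (n%:R%:E * (Lam f)%:E <=
    n%:R%:E * (\int[riesz_measure]_x (f (j x))%:E + e%:E))%E.
  rewrite -EFinM (le_trans (y := (\sum_(k < n) Lam (u k))%:E))//.
  rewrite -sumEFin (le_trans (y := (\sum_(k < n) riesz_measure (O k))%E))//.
    by apply: lee_sum => k _; exact: Lu.
  apply: (le_trans intO).
  have I0 : (0 <= \int[riesz_measure]_x (f (j x))%:E)%E.
    by apply: integral_ge0 => x _; rewrite lee_fin; case/andP: (f01 x).
  move: I0; move: (integral _ _ _) => I I0.
  rewrite ge0_muleDr ?lee_fin ?(ltW e0)// -EFinM leeD2l// lee_fin.
  by rewrite -ler_pdivrMr// ltW// truncnS_gt.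
by rewrite lee_pmul2l// lte_fin.
Qed.

Let mfj (f : Y -> R) : continuous f ->
  measurable_fun [set: borel X] (f \o j : borel X -> measurableTypeR R).
Proof.
move=> cf; apply: continuous_borel_measurable => x.
by apply: continuous_comp; [exact: jcont|exact: cf].
Qed.

Let intfj (f : Y -> R) (M : R) : continuous f -> (forall x, `|f (j x)| <= M) ->
  riesz_measure.-integrable [set: borel X] (fun x => (f (j x))%:E).
Proof.
move=> cf fM; apply: measurable_bounded_integrable => //.
- by rewrite riesz_measureT ltry.
- exact: mfj.
- by exists M; rewrite num_real; split=> // N MN x _; exact: le_trans (fM x) (ltW MN).
Qed.

(** The inequality missing from [Lam_le_integral] is the same one for [1 - f]. *)
Let riesz_integral01 (f : Y -> R) : continuous f ->
  (forall x, 0 <= f (j x) <= 1) ->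
  (\int[riesz_measure]_x (f (j x))%:E = (Lam f)%:E)%E.
Proof.
move=> cf f01; apply/eqP; rewrite eq_le Lam_le_integral// andbT.
pose g y := -1 * f y + one y.
have cNf : continuous (fun y => -1 * f y) by exact: continuous_scale.
have cg : continuous g by exact: continuous_add.
have g01 x : 0 <= g (j x) <= 1 by rewrite /g /one; have := f01 x; lra.
have ig := intfj (M := 1) cg; have if_ := intfj (M := 1) cf.
have := Lam_le_integral cg g01.
have -> : Lam g = Lam one - Lam f by rewrite LamD// LamZ// mulN1r addrC.
have b1 (h : Y -> R) : (forall x, 0 <= h (j x) <= 1) -> forall x, `|h (j x)| <= 1.
  by move=> h01 x; rewrite ger0_norm; case/andP: (h01 x).
have -> : (\int[riesz_measure]_x (g (j x))%:E =
    (Lam one)%:E - \int[riesz_measure]_x (f (j x))%:E)%E.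
  rewrite -riesz_measureT -[riesz_measure _]mul1e -integral_cst//.
  rewrite -integralB//; last first.
  - exact: if_ (b1 _ f01).
  - by apply: (intfj (M := 1) cone) => x; rewrite /one normr1.
  by apply: eq_integral => x _; rewrite /g mulN1r -EFinB addrC.
have : (\int[riesz_measure]_x (f (j x))%:E)%E \is a fin_num.
  by apply: integrable_fin_num => //; exact: if_ (b1 _ f01).
by move=> /fineK <-; rewrite -EFinB !lee_fin; lra.
Qed.

(** An affine change of scale brings a bounded function into [[0, 1]]. *)
Theorem riesz_integral (f : Y -> R) : continuous f ->
  (exists M : R, forall x, `|f (j x)| <= M) ->
  (\int[riesz_measure]_x (f (j x))%:E = (Lam f)%:E)%E.
Proof.
move=> cf [M fM]; have M0 : 0 <= M by apply: le_trans (fM point).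
pose c := (2 * (M + 1))^-1; have c0 : 0 < c by rewrite invr_gt0; lra.
pose g y := c * f y + 1/2 * one y.
have ccf : continuous (fun y => c * f y) by exact: continuous_scale.
have c1 : continuous (fun y => 1/2 * one y) by exact: continuous_scale.
have cg : continuous g by exact: continuous_add.
have g01 x : 0 <= g (j x) <= 1.
  rewrite /g /one; have := fM x; rewrite ler_norml => /andP[f1 f2].
  have h : c * (2 * (M + 1)) = 1 by rewrite mulVf//; lra.
  have : c * - M <= c * f (j x) by rewrite ler_wpM2l// ltW.
  have : c * f (j x) <= c * M by rewrite ler_wpM2l// ltW.
  by lra.
have := riesz_integral01 cg g01.
have -> : Lam g = c * Lam f + 1/2 * Lam one by rewrite LamD// !LamZ.
have i1 : riesz_measure.-integrable [set: borel X] (fun x => (1/2 * one (j x))%:E).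
  by apply: (intfj (M := 1/2) c1) => x; rewrite /one ger0_norm; lra.
have i2 : riesz_measure.-integrable [set: borel X] (fun x => (c%:E * (f (j x))%:E)%E).
  exact/integrableZl/(intfj cf fM).
have -> : (\int[riesz_measure]_x (g (j x))%:E =
    c%:E * \int[riesz_measure]_x (f (j x))%:E + (1/2)%:E * (Lam one)%:E)%E.
  rewrite -riesz_measureT -integral_cst// -integralZl//; last exact: intfj fM.
  rewrite -integralD//; first by apply: eq_integral => x _; rewrite /g /one mulr1.
  rewrite (_ : cst _ = fun x => (1/2 * one (j x))%:E)//.
  by apply/funext => x; rewrite /one mulr1.
have : (\int[riesz_measure]_x (f (j x))%:E)%E \is a fin_num.
  by apply: integrable_fin_num => //; exact: intfj fM.
move=> /fineK <-; rewrite -!EFinM -EFinD => -[] /addIr /(mulfI (lt0r_neq0 c0)).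
by move=> ->.
Qed.

End riesz.

(** * Polynomial approximation *)

Section bernstein.
Context {R : realType}.

(** The expectation of [g] under the binomial distribution of parameters [n, x]. *)
Let E (n : nat) (x : R) (g : nat -> R) : R :=
  \sum_(k < n.+1) 'C(n, k)%:R * x ^+ k * (1 - x) ^+ (n - k) * g k.

Let ED n x g h : E n x (fun k => g k + h k) = E n x g + E n x h.
Proof. by rewrite /E -big_split/=; apply: eq_bigr => k _; rewrite mulrDr. Qed.

Let EZ n x c g : E n x (fun k => c * g k) = c * E n x g.
Proof. by rewrite /E mulr_sumr; apply: eq_bigr => k _; rewrite mulrCA. Qed.

Let Ele n x g h : 0 <= x <= 1 -> (forall k, (k <= n)%N -> g k <= h k) ->
  E n x g <= E n x h.
Proof.
move=> /andP[x0 x1] gh; apply: ler_sum => k _; apply: ler_wpM2l.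
  by rewrite !mulr_ge0 ?exprn_ge0 ?subr_ge0.
by apply: gh; rewrite -ltnS.
Qed.

Let E1 n x : E n x (fun=> 1) = 1.
Proof.
rewrite /E -[RHS](expr1n _ n) -[in RHS](subrK x 1) exprDn.
apply: eq_bigr => k _; rewrite mulr1 -mulr_natl; ring.
Qed.

Let Eshift n x g :
  E n.+1 x (fun k => k%:R * g k) = n.+1%:R * x * E n x (fun k => g k.+1).
Proof.
rewrite /E big_ord_recl/= mul0r mulr0 add0r mulr_sumr; apply: eq_bigr => k _.
rewrite /bump/= add1n subSS exprS.
have := mul_bin_diag n.+1 k; move/(congr1 (fun m => m%:R : R)).
rewrite !natrM => h; rewrite [LHS](_ : _ =
  (k.+1%:R * 'C(n.+1, k.+1)%:R) * x * x ^+ k * (1 - x) ^+ (n - k) * g k.+1); last by ring.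
by rewrite -h/=; ring.
Qed.

Let Eid n x : E n x (fun k => k%:R) = n%:R * x.
Proof.
case: n => [|n]; first by rewrite /E big_ord_recl big_ord0 !mulr0 mul0r addr0.
rewrite [LHS](_ : _ = E n.+1 x (fun k => k%:R * 1)).
  by rewrite Eshift E1 mulr1.
by apply: eq_bigr => k _; rewrite mulr1.
Qed.

Let Evar n x : E n.+1 x (fun k => (k%:R - n.+1%:R * x) ^+ 2) = n.+1%:R * x * (1 - x).
Proof.
rewrite [LHS](_ : _ = E n.+1 x (fun k => (k%:R * k%:R + (- 2 * n.+1%:R * x) * k%:R) + (n.+1%:R * x) ^+ 2 * 1)).
  rewrite !ED !EZ E1 Eid Eshift.
  rewrite [X in _ * X](_ : _ = E n x (fun k => k%:R + 1)); last first.
    by apply: eq_bigr => k _; rewrite natr1.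
  by rewrite ED E1 Eid -natr1; ring.
by apply: eq_bigr => k _; ring.
Qed.

(** Continuity on a segment makes the modulus quadratic up to [e]: nearby points
    are handled by a finite cover, distant ones by boundedness. *)
Let quadratic_modulus (f : R -> R) (e : R) : continuous f -> 0 < e ->
  exists2 L, 0 <= L & forall s t, 0 <= s <= 1 -> 0 <= t <= 1 ->
    `|f s - f t| <= e + L * (s - t) ^+ 2.
Proof.
move=> cf e0.
have cI : compact (`[0, 1] : set R) by exact: segment_compact.
have [B [_ /(_ (B + 1)) fB]] : [bounded f t | t in (`[0, 1] : set R)].
  have /compact_bounded[B [rB hB]] : compact [set f x | x in (`[0, 1] : set R)].
    by apply: continuous_compact => //; exact: continuous_subspaceT.
  by exists B; split => // N BN t It; apply: (hB N BN); exists t.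
have {fB} fB t : 0 <= t <= 1 -> `|f t| <= B + 1.
  by move=> t01; apply: fB => //=; rewrite ?in_itv//= ltrDl.
have B0 : 0 <= B + 1 by apply: le_trans (fB 0 _) => //; rewrite lexx ler01.
have H (t : R) : exists d : R, 0 < d /\ forall s, `|t - s| < d -> `|f t - f s| < e / 2.
  have e20 : 0 < e / 2 by rewrite divr_gt0.
  have /cvgrPdist_lt/(_ _ e20)/nbhs_ballP[d /= d0 dP] := cf t.
  by exists d; split => // s ts; exact: dP.
have [d dP] := choice H.
have := cI; rewrite compact_cover => /(_ R setT (fun t => ball t (d t / 2))).
case.
- by move=> t _; apply: ball_open; rewrite divr_gt0//; case: (dP t).
- by move=> t _; exists t => //; apply: ballxx; rewrite divr_gt0//; case: (dP t).
move=> D _ cD.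
(* If [d i / 2 <= |s - t|], then [c i * (s - t) ^ 2] is at least the bound
   [2 * (B + 1)] of the oscillation. *)
pose c i := 2 * (B + 1) * (2 / d i) ^+ 2.
have c0 i : 0 <= c i by rewrite /c mulr_ge0 ?sqr_ge0// mulr_ge0.
exists (\sum_(i <- D) c i); first exact: sumr_ge0.
move=> s t s01 t01.
have [i iD /= it] : cover [set` D] (fun t => ball t (d t / 2)) t by apply: cD; rewrite /= in_itv.
have [di0 diP] := dP i.
move: it; rewrite /ball/= => it.
have [st|ts] := ltP `|s - t| (d i / 2).
  have h1 : `|f i - f t| < e / 2 by apply: diP; lra.
  have h2 : `|f i - f s| < e / 2.
    by apply: diP; apply: (le_lt_trans (ler_distD t i s)); rewrite (distrC t s); lra.
  apply: (@le_trans _ _ e).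
    by rewrite (le_trans (ler_distD (f i) _ _))// (distrC (f s)); lra.
  by rewrite lerDl mulr_ge0 ?sqr_ge0 ?sumr_ge0.
apply: (@le_trans _ _ (2 * (B + 1))).
  by rewrite (le_trans (ler_normB _ _))//; have := fB _ s01; have := fB _ t01; lra.
apply: (@le_trans _ _ (c i * (s - t) ^+ 2)); last first.
  rewrite -[leLHS]add0r lerD ?(ltW e0)// ler_wpM2r ?sqr_ge0//.
  by rewrite (big_rem i)//= lerDl sumr_ge0.
rewrite /c -mulrA -exprMn ler_peMr ?mulr_ge0//.
rewrite -real_normK ?num_real// exprn_ege1// normrM ger0_norm ?divr_ge0 ?(ltW di0)//.
by rewrite mulrAC ler_pdivlMr// mul1r; lra.
Qed.

(** Weighting the quadratic modulus at [k / n] by the binomial distribution of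
    parameter [x] bounds the error by [e / 2 + L * x * (1 - x) / n]. *)
Let bernstein (f : R -> R) (e : R) : continuous f -> 0 < e ->
  exists p : {poly R}, forall t, 0 <= t <= 1 -> `|p.[t] - f t| <= e.
Proof.
move=> cf e0; have e20 : 0 < e / 2 by rewrite divr_gt0.
have [L L0 LP] := quadratic_modulus cf e20.
(* This [n] satisfies [L / n <= e / 2]. *)
pose m := Num.truncn (L / (e / 2)); pose n := m.+1.
have n0 : 0 < n%:R :> R by rewrite ltr0n.
have nL : L <= e / 2 * n%:R.
  by rewrite mulrC -ler_pdivrMr// ltW// truncnS_gt.
pose g k := f (k%:R / n%:R).
pose p := \sum_(k < n.+1) ('C(n, k)%:R * g k) *: ('X ^+ k * (1 - 'X) ^+ (n - k)).
exists p => x x01; have /andP[x0 x1] := x01.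
have -> : p.[x] = E n x g.
  rewrite horner_sum; apply: eq_bigr => k _.
  rewrite hornerZ hornerM hornerXn horner_exp hornerD hornerN hornerX hornerC; ring.
have nx : n%:R != 0 :> R by rewrite gt_eqF.
have bnd k : (k <= n)%N -> `|g k - f x| <= e / 2 + L / n%:R ^+ 2 * (k%:R - n%:R * x) ^+ 2.
  move=> kn; rewrite (le_trans (LP _ x _ x01))//.
    by rewrite divr_ge0//= ler_pdivrMr// mul1r ler_nat.
  rewrite lerD2l le_eqVlt; apply/orP; left; apply/eqP.
  by field.
have EB : e / 2 + L / n%:R ^+ 2 * E n x (fun k => (k%:R - n%:R * x) ^+ 2) <= e.
  rewrite Evar -/n [e in leRHS]splitr lerD2l.
  rewrite (_ : _ * _ = L * (x * (1 - x)) / n%:R); last by field.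
  rewrite ler_pdivrMr// (le_trans _ nL)// ler_piMr//.
  by rewrite mulr_ile1 ?subr_ge0// lerBlDr lerDl.
have -> : E n x g - f x = E n x (fun k => g k + - f x * 1).
  by rewrite ED EZ E1 mulr1.
have EB' c : E n x (fun k => e / 2 * 1 + c * (k%:R - n%:R * x) ^+ 2) =
    e / 2 + c * E n x (fun k => (k%:R - n%:R * x) ^+ 2).
  by rewrite ED !EZ E1 mulr1.
rewrite ler_norml; apply/andP; split.
  rewrite lerNl -mulN1r -EZ; apply: le_trans EB; rewrite -EB'; apply: Ele => // k /bnd.
  by rewrite !mulr1 ler_norml => /andP[]; lra.
apply: le_trans EB; rewrite -EB'; apply: Ele => // k /bnd.
by rewrite !mulr1 ler_norml => /andP[]; lra.
Qed.

(** The segment [[- M, M]] is mapped affinely onto [[0, 1]]. *)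
Theorem weierstrass (M : R) (f : R -> R) (e : R) : 0 < M -> continuous f -> 0 < e ->
  exists p : {poly R}, forall t, `|t| <= M -> `|p.[t] - f t| <= e.
Proof.
move=> M0 cf e0.
pose g t := f (2 * M * t - M).
have cg : continuous g.
  move=> t; apply: continuous_comp; last exact: cf.
  by apply: cvgB; [apply: cvgMr; exact: cvg_id|exact: cvg_cst].
have [p pP] := bernstein cg e0.
have M20 : 2 * M != 0 by rewrite gt_eqF//; lra.
exists (p \Po ((2 * M)^-1 *: ('X + M%:P))) => t; rewrite ler_norml => /andP[t1 t2].
rewrite horner_comp !hornerE; set s := (2 * M)^-1 * _.
have sE : 2 * M * s - M = t by rewrite /s mulVKf//; ring.
rewrite -[t in f t]sE; apply: pP; apply/andP; split.
  by rewrite mulr_ge0 ?invr_ge0//; lra.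
by rewrite /s mulrC ler_pdivrMr; lra.
Qed.

End bernstein.

(** * Weighted square summable functions *)

Section real_sums.
Context {R : realType} {T : choiceType}.
Implicit Types f g P Q : T -> R.

Let S f := (\esum_(x in [set: T]) (f x)%:E)%E.

Definition summing f := (S (fun x => `|f x|%R) < +oo)%E.

Let S_ge0 f : (forall x, 0 <= f x) -> (0 <= S f)%E.
Proof. by move=> f0; apply: esum_ge0 => x _; rewrite lee_fin. Qed.

Let S_le f g : (forall x, f x <= g x) -> (S f <= S g)%E.
Proof. by move=> fg; apply: le_esum => x _; rewrite lee_fin. Qed.

Let fin f : (forall x, 0 <= f x) -> (S f < +oo)%E -> S f \is a fin_num.
Proof. by move=> f0; rewrite ge0_fin_numE// S_ge0. Qed.

Let SD f g : (forall x, 0 <= f x) -> (forall x, 0 <= g x) ->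
  S (fun x => f x + g x) = (S f + S g)%E.
Proof. by move=> f0 g0; rewrite /S -esumD// => x _; rewrite lee_fin. Qed.

Lemma summing_le f g : (forall x, `|f x| <= g x) -> (S g < +oo)%E -> summing f.
Proof. by move=> fg; apply: le_lt_trans; exact: S_le. Qed.

(** Any decomposition into nonnegative summable parts computes the sum, not only
    the one into positive and negative parts. *)
Lemma rsumE f P Q : (forall x, 0 <= P x) -> (forall x, 0 <= Q x) ->
  (S P < +oo)%E -> (S Q < +oo)%E -> (forall x, f x = P x - Q x) ->
  rsum f = fine (S P) - fine (S Q).
Proof.
move=> P0 Q0 SP SQ fE; rewrite /rsum -!/(S _).
have p0 x : 0 <= f^\+%R x by rewrite le_max lexx orbT.
have n0 x : 0 <= f^\-%R x by rewrite le_max lexx orbT.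
have pP : (S f^\+%R < +oo)%E.
  apply: le_lt_trans SP; apply: S_le => x.
  by rewrite /funrpos ge_max P0 fE andbT lerBlDr lerDl.
have nQ : (S f^\-%R < +oo)%E.
  apply: le_lt_trans SQ; apply: S_le => x.
  by rewrite /funrneg ge_max Q0 fE andbT; have := P0 x; lra.
have : (S f^\+%R + S Q = S P + S f^\-%R)%E.
  rewrite -!SD//; congr esum; apply/funext => x; congr (_%:E).
  rewrite /funrpos /funrneg.
  have := fE x; set a := f x; set b := P x; set c := Q x.
  by rewrite !maxEle; do ![case: ifP]; lra.
move=> /(congr1 fine); rewrite !fineD ?fin//; lra.
Qed.

Let pn_le f x : f^\+%R x <= `|f x| /\ f^\-%R x <= `|f x|.
Proof. by rewrite /funrpos /funrneg !ge_max normr_ge0 !andbT ler_norm -normrN ler_norm. Qed.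

Let p_ge0 f x : 0 <= f^\+%R x. Proof. by rewrite le_max lexx orbT. Qed.
Let n_ge0 f x : 0 <= f^\-%R x. Proof. by rewrite le_max lexx orbT. Qed.

Let p_fin f : summing f -> (S f^\+%R < +oo)%E.
Proof. by apply: le_lt_trans; apply: S_le => x; case: (pn_le f x). Qed.
Let n_fin f : summing f -> (S f^\-%R < +oo)%E.
Proof. by apply: le_lt_trans; apply: S_le => x; case: (pn_le f x). Qed.

Let pnE f x : f x = f^\+%R x - f^\-%R x.
Proof. by rewrite /funrpos /funrneg !maxEle; do ![case: ifP]; lra. Qed.

Let fine_S f : (forall x, 0 <= f x) -> (S f < +oo)%E -> ((fine (S f))%:E = S f)%E.
Proof. by move=> f0 ffin; rewrite fineK// ge0_fin_numE// S_ge0. Qed.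

Let SZ (c : R) f : 0 <= c -> (forall x, 0 <= f x) -> (S f < +oo)%E ->
  S (fun x => c * f x) = (c%:E * S f)%E.
Proof.
move=> c0 f0 ffin; rewrite /S /esum -ereal_supZl//; last by apply/set0P; exists 0%E; exists set0; [exact: fsets_set0|rewrite fsbig_set0].
congr ereal_sup; apply/seteqP; split => [_ [X [fX _] <-]|_ [_ [X [fX _] <-] <-]].
  exists (\sum_(x \in X) (f x)%:E)%E; first by exists X.
  by rewrite !fsbig_finite//= !sumEFin -EFinM mulr_sumr.
exists X => //; by rewrite !fsbig_finite//= !sumEFin -EFinM mulr_sumr.
Qed.

Lemma summingZ (c : R) f : summing f -> summing (fun x => c * f x).
Proof.
move=> sf; apply: (@summing_le _ (fun x => `|c| * `|f x|)) => [x|].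
  by rewrite normrM.
by rewrite SZ// -fine_S//= ltry.
Qed.

Lemma rsumD f g : summing f -> summing g ->
  rsum (fun x => f x + g x) = rsum f + rsum g.
Proof.
move=> sf sg; rewrite (@rsumE _ (fun x => f^\+%R x + g^\+%R x) (fun x => f^\-%R x + g^\-%R x)).
- rewrite !SD// !fineD ?fin ?(p_fin sf) ?(n_fin sf) ?(p_fin sg) ?(n_fin sg)//.
  by rewrite /rsum -!/(S _); lra.
- by move=> x; rewrite addr_ge0.
- by move=> x; rewrite addr_ge0.
- by rewrite SD// lte_add_pinfty ?(p_fin sf) ?(p_fin sg).
- by rewrite SD// lte_add_pinfty ?(n_fin sf) ?(n_fin sg).
- by move=> x; rewrite (pnE f) (pnE g); lra.
Qed.

Lemma rsumN f : summing f -> rsum (fun x => - f x) = - rsum f.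
Proof.
move=> sf; rewrite (@rsumE _ f^\-%R f^\+%R) ?(p_fin sf) ?(n_fin sf)//.
- by rewrite /rsum -!/(S _) opprB.
- by move=> x; rewrite {1}(pnE f); lra.
Qed.

Lemma rsumZ (c : R) f : summing f -> rsum (fun x => c * f x) = c * rsum f.
Proof.
move=> sf; wlog c0 : c / 0 <= c => [H|].
  have [/H->//|c0] := leP 0 c.
  rewrite -[in RHS](opprK c) mulNr -H; last by rewrite oppr_ge0 ltW.
  rewrite -rsumN; last exact: summingZ.
  by congr rsum; apply/funext => x; lra.
rewrite (@rsumE _ (fun x => c * f^\+%R x) (fun x => c * f^\-%R x)).
- rewrite (SZ c0 (p_ge0 f)) ?(p_fin sf)// (SZ c0 (n_ge0 f)) ?(n_fin sf)// !fineM ?fin ?(p_fin sf) ?(n_fin sf)//.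
  by rewrite /rsum -!/(S _) mulrBr.
- by move=> x; rewrite mulr_ge0.
- by move=> x; rewrite mulr_ge0.
- by rewrite SZ ?(p_fin sf)// -fine_S ?(p_fin sf)//= ltry.
- by rewrite SZ ?(n_fin sf)// -fine_S ?(n_fin sf)//= ltry.
- by move=> x; rewrite {1}(pnE f) mulrBr.
Qed.

Lemma rsum_nneg f : (forall x, 0 <= f x) -> (S f < +oo)%E -> rsum f = fine (S f).
Proof.
move=> f0 ffin; rewrite (@rsumE _ f (fun=> 0))//.
- by rewrite [S (fun=> 0)]esum1 ?subr0.
- by rewrite [S (fun=> 0)]esum1.
- by move=> x; rewrite subr0.
Qed.

Lemma rsum_single f x0 : (forall x, x != x0 -> f x = 0) -> rsum f = f x0.
Proof.
move=> f0.
have H g : (forall x, 0 <= g x) -> (forall x, x != x0 -> g x = 0) -> S g = (g x0)%:E.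
  move=> g0 gz; rewrite /S (esumID [set x0])//; last by move=> x _; rewrite lee_fin.
  rewrite setTI esum_set1 ?lee_fin// esum1 ?adde0// => x [_ /= /eqP xx].
  by rewrite gz.
rewrite [RHS](pnE f) /rsum -!/(S _) !H//.
- by move=> x /f0; rewrite /funrneg => ->; rewrite oppr0 maxxx.
- by move=> x /f0; rewrite /funrpos => ->; rewrite maxxx.
Qed.

End real_sums.

Section l2_space.
Local Open Scope complex_scope.
Context {R : realType} {T : choiceType}.
Variable w : T -> R.
Hypothesis w_gt0 : forall x, 0 < w x.
Implicit Types (u v : T -> R[i]) (c : R[i]).

Let w_ge0 x : 0 <= w x. Proof. exact: ltW. Qed.

Lemma normc_ge0 c : 0 <= normc c.
Proof. by case: c => a b; exact: sqrtr_ge0. Qed.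

Lemma sqr_normcE c : normc c ^+ 2 = complex.Re c ^+ 2 + complex.Im c ^+ 2.
Proof. by case: c => a b; rewrite /= sqr_sqrtr// addr_ge0 ?sqr_ge0. Qed.

Lemma Re_le_normc c : `|complex.Re c| <= normc c.
Proof.
by case: c => a b /=; rewrite -[leLHS]sqrtr_sqr ler_wsqrtr// lerDl sqr_ge0.
Qed.

Lemma normcD (a b : R[i]) : normc (a + b) <= normc a + normc b.
Proof. exact: le_normcD. Qed.

(** The square of [l2norm]. *)
Let q u : \bar R := (\esum_(x in [set: T]) (normc (u x) ^+ 2 * w x)%:E)%E.

Let q_ge0 u : (0 <= q u)%E.
Proof. by apply: esum_ge0 => x _; rewrite lee_fin mulr_ge0 ?sqr_ge0. Qed.

(** A real-valued [l2norm]; it is only meaningful on [l2], as [fine] sends an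
    infinite norm to [0]. *)
Definition hnorm u : R := Num.sqrt (fine (q u)).

Lemma l2P u : l2 w u <-> (q u < +oo)%E.
Proof.
rewrite /l2 /l2norm/= -/(q u).
by case: (q u) (q_ge0 u) => [r| |]//=; rewrite ?ltry.
Qed.

Lemma l2normE u : l2 w u -> l2norm w u = (hnorm u)%:E.
Proof.
move=> /l2P; rewrite /hnorm /l2norm -/(q u).
by case: (q u) (q_ge0 u).
Qed.

Lemma hnorm_ge0 u : 0 <= hnorm u. Proof. exact: sqrtr_ge0. Qed.
#[local] Hint Resolve hnorm_ge0 normc_ge0 : core.

Let qE u : l2 w u -> q u = (hnorm u ^+ 2)%:E.
Proof.
move=> /l2P qu; rewrite sqr_sqrtr ?fine_ge0// fineK// ge0_fin_numE//.
Qed.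

(** Membership and norm bounds are checked on finite sets of points, so that no
    infinite sum is manipulated afterwards. *)
Lemma l2_esum_le u (M : R) : 0 <= M ->
  (forall X : {fset T}, \sum_(x <- X) normc (u x) ^+ 2 * w x <= M ^+ 2) ->
  l2 w u /\ hnorm u <= M.
Proof.
move=> M0 H.
have qM : (q u <= (M ^+ 2)%:E)%E.
  apply: ge_ereal_sup => _ [X [fX _] <-].
  by rewrite fsbig_finite//= sumEFin lee_fin; exact: H.
have lu : l2 w u by apply/l2P; apply: le_lt_trans qM _; rewrite ltry.
split => //; rewrite -(ler_pXn2r (n := 2))// ?nnegrE//.
by rewrite -lee_fin -qE.
Qed.

Lemma esum_le_l2 u (X : {fset T}) : l2 w u ->
  \sum_(x <- X) normc (u x) ^+ 2 * w x <= hnorm u ^+ 2.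
Proof.
move=> lu; rewrite -lee_fin -qE// -sumEFin; apply: ereal_sup_ubound.
by exists [set` X]; [split|rewrite fsbig_finite//= set_fsetK].
Qed.

Lemma pointwise_le u x : l2 w u -> normc (u x) ^+ 2 * w x <= hnorm u ^+ 2.
Proof. by move=> /(esum_le_l2 [fset x]%fset); rewrite big_seq_fset1. Qed.

Lemma hnorm_eq0 u : l2 w u -> hnorm u = 0 -> u = 0.
Proof.
move=> lu u0; apply/funext => x; apply/eq0_normc/eqP.
have := pointwise_le x lu; rewrite u0 expr0n/= pmulr_lle0// => h.
by rewrite -sqrf_eq0 eq_le h sqr_ge0.
Qed.

Lemma l2_0 : l2 w 0.
Proof.
by have [] := @l2_esum_le 0 0 (lexx _) => // X; rewrite big1 ?expr0n// => x _; rewrite normc0 expr0n mul0r.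
Qed.

Lemma l2Z c u : l2 w u -> l2 w (c *: u).
Proof.
move=> lu; have [] := @l2_esum_le (c *: u) (normc c * hnorm u) => //.
  by rewrite mulr_ge0.
move=> X; rewrite exprMn (le_trans _ (ler_wpM2l _ (esum_le_l2 X lu))) ?sqr_ge0// mulr_sumr.
by apply: ler_sum => x _; rewrite mulrA -exprMn -normcM.
Qed.

Lemma l2D u v : l2 w u -> l2 w v -> l2 w (u + v).
Proof.
move=> lu lv.
have [] := @l2_esum_le (u + v) (Num.sqrt (2 * hnorm u ^+ 2 + 2 * hnorm v ^+ 2)) => //.
move=> X; rewrite sqr_sqrtr ?addr_ge0 ?mulr_ge0 ?sqr_ge0//.
have := esum_le_l2 X lu; have := esum_le_l2 X lv => hv hu.
apply: le_trans (lerD (ler_wpM2l _ hu) (ler_wpM2l _ hv)) => //.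
rewrite !mulr_sumr -big_split/=; apply: ler_sum => x _.
rewrite !mulrA -mulrDl ler_wpM2r//; have := normcD (u x) (v x).
have := normc_ge0 (u x); have := normc_ge0 (v x); have := normc_ge0 (u x + v x).
move: (normc (u x)) (normc (v x)) (normc _) => a b d d0 b0 a0 dab.
have : d ^+ 2 <= (a + b) ^+ 2 by rewrite ler_pXn2r ?nnegrE ?addr_ge0.
have : 0 <= (a - b) ^+ 2 by exact: sqr_ge0.
by rewrite !expr2; nra.
Qed.

Lemma l2B u v : l2 w u -> l2 w v -> l2 w (u - v).
Proof. by move=> lu lv; rewrite -scaleN1r; apply: l2D => //; exact: l2Z. Qed.

Lemma l2_sum (I : Type) (r : seq I) (F : I -> T -> R[i]) :
  (forall i, l2 w (F i)) -> l2 w (\sum_(i <- r) F i).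
Proof.
move=> lF; elim: r => [|i r IH]; rewrite ?big_nil ?big_cons; first exact: l2_0.
exact: l2D.
Qed.

(** ** The inner product *)

Let ip u v x : R[i] := (u x)^* * v x * (w x)%:C.

Let csumming (f : T -> R[i]) :=
  summing (fun x => complex.Re (f x)) /\ summing (fun x => complex.Im (f x)).

Let csumD f g : csumming f -> csumming g -> csum (fun x => f x + g x) = csum f + csum g.
Proof.
move=> [rf jf] [rg jg]; rewrite /csum.
rewrite (_ : (fun x => complex.Re (f x + g x)) = fun x => complex.Re (f x) + complex.Re (g x)); last first.
  by apply/funext => x; case: (f x); case: (g x).
rewrite (_ : (fun x => complex.Im (f x + g x)) = fun x => complex.Im (f x) + complex.Im (g x)); last first.
  by apply/funext => x; case: (f x); case: (g x).
by rewrite !rsumD.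
Qed.

Let csumZ c f : csumming f -> csum (fun x => c * f x) = c * csum f.
Proof.
move=> [rf jf]; case: c => a b; rewrite /csum.
rewrite (_ : (fun x => complex.Re _) = fun x => a * complex.Re (f x) + (- b) * complex.Im (f x)); last first.
  by apply/funext => x; case: (f x) => ? ? /=; rewrite mulNr.
rewrite (_ : (fun x => complex.Im _) = fun x => a * complex.Im (f x) + b * complex.Re (f x)); last first.
  by apply/funext => x; case: (f x).
rewrite !rsumD ?rsumZ//; do ?exact: summingZ.
by apply/eqP; rewrite eq_complex/= mulNr !eqxx.
Qed.

Let csum_conj f : csumming f -> csum (fun x => (f x)^*) = (csum f)^*.
Proof.
move=> [rf jf]; rewrite /csum.
rewrite (_ : (fun x => complex.Re _) = fun x => complex.Re (f x)); last first.
  by apply/funext => x; case: (f x).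
rewrite (_ : (fun x => complex.Im _) = fun x => - complex.Im (f x)); last first.
  by apply/funext => x; case: (f x).
by rewrite rsumN.
Qed.

Let ip_summing u v : l2 w u -> l2 w v -> csumming (ip u v).
Proof.
move=> /l2P lu /l2P lv.
have H : (\esum_(x in [set: T]) (normc (u x) ^+ 2 * w x + normc (v x) ^+ 2 * w x)%:E < +oo)%E.
  under eq_esum do rewrite EFinD.
  by rewrite esumD ?lte_add_pinfty// => x _; rewrite lee_fin mulr_ge0 ?sqr_ge0.
(* [2 |ad| <= a^2 + d^2] bounds both parts of [conj (u x) * v x]. *)
have amgm (a b d e : R) : `|a * d + b * e| <= (a ^+ 2 + b ^+ 2) + (d ^+ 2 + e ^+ 2).
  have := sqr_ge0 (a + d); have := sqr_ge0 (a - d); have := sqr_ge0 (b + e); have := sqr_ge0 (b - e).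
  have := sqr_ge0 a; have := sqr_ge0 b; have := sqr_ge0 d; have := sqr_ge0 e.
  by rewrite ler_norml !expr2; nra.
split; apply: summing_le H => x; rewrite -mulrDl !sqr_normcE /ip.
  case: (u x) (v x) => a b [d e] /=; rewrite mulr0 subr0 normrM (ger0_norm (w_ge0 x)).
  rewrite ler_wpM2r// (_ : _ - _ = a * d + b * e); last by ring.
  exact: amgm.
case: (u x) (v x) => a b [d e] /=; rewrite mulr0 add0r normrM (ger0_norm (w_ge0 x)).
rewrite ler_wpM2r//.
by apply: le_trans (amgm _ _ _ _) _; rewrite sqrrN [d ^+ 2 + _]addrC.
Qed.

Lemma innerDr u v v' : l2 w u -> l2 w v -> l2 w v' ->
  inner w u (v + v') = inner w u v + inner w u v'.
Proof.
move=> lu lv lv'; rewrite /inner -!/(ip _ _ _) -csumD; try exact: ip_summing.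
by congr csum; apply/funext => x; rewrite /= mulrDr mulrDl.
Qed.

Lemma innerZr c u v : l2 w u -> l2 w v -> inner w u (c *: v) = c * inner w u v.
Proof.
move=> lu lv; rewrite /inner -csumZ; last exact: ip_summing.
by congr csum; apply/funext => x; rewrite /= [in LHS]mulrCA !mulrA.
Qed.

Lemma innerC u v : l2 w u -> l2 w v -> inner w v u = (inner w u v)^*.
Proof.
move=> lu lv; rewrite /inner -csum_conj; last exact: ip_summing.
congr csum; apply/funext => x; case: (u x) (v x) => a b [d e].
by apply/eqP; rewrite eq_complex/=; apply/andP; split; apply/eqP; ring.
Qed.

Lemma inner_self u : l2 w u -> inner w u u = (hnorm u ^+ 2)%:C.
Proof.
move=> lu; rewrite /inner /csum.
have E x : (u x)^* * u x * (w x)%:C = (normc (u x) ^+ 2 * w x)%:C.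
  rewrite [_^* * _]mulrC -sqr_normc normc_def sqr_normcE -rmorphXn -rmorphM/=.
  by rewrite sqr_sqrtr// addr_ge0 ?sqr_ge0.
rewrite (_ : (fun x => complex.Re _) = fun x => normc (u x) ^+ 2 * w x); last first.
  by apply/funext => x; rewrite E.
rewrite (_ : (fun x => complex.Im _) = fun=> 0); last first.
  by apply/funext => x; rewrite E.
rewrite rsum_nneg; last 2 first.
- by move=> x; rewrite mulr_ge0 ?sqr_ge0.
- exact/l2P.
rewrite rsum_nneg//; last by rewrite esum1 ?ltry.
by rewrite [X in _ +i* fine X]esum1//= -/(q u) qE.
Qed.

(** The norm of [u - t * conj z * v] is nonnegative for every real [t]; the best
    choice is [t = 1 / |v|^2], and if [v] vanishes a large [t] forces [z = 0]. *)
Lemma cauchy_schwarz u v : l2 w u -> l2 w v -> normc (inner w u v) <= hnorm u * hnorm v.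
Proof.
move=> lu lv; set z := inner w u v.
have H (t : R) : 0 <= hnorm u ^+ 2 - 2 * t * normc z ^+ 2 + t ^+ 2 * normc z ^+ 2 * hnorm v ^+ 2.
  pose c : R[i] := - (t%:C * z^*).
  have lcv : l2 w (c *: v) by exact: l2Z.
  have luv : l2 w (u + c *: v) by exact: l2D.
  have := inner_self luv; rewrite innerDr// innerZr//.
  rewrite (innerC lu luv) (innerC lv luv) !innerDr// !innerZr//.
  rewrite (innerC lu lv) !inner_self// => E; move: E (sqr_ge0 (hnorm (u + c *: v))).
  rewrite /c -/z sqr_normcE; case: (z) => a b /(congr1 (@complex.Re R)) /= <-.
  by lra.
have [v0|v0] := eqVneq (hnorm v) 0.
  rewrite v0 mulr0.
  have [->//|z0] := eqVneq (normc z) 0.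
  have := H ((hnorm u ^+ 2 + 1) / (2 * normc z ^+ 2)).
  rewrite v0 expr0n/= mulr0 addr0.
  rewrite (_ : 2 * _ * _ = hnorm u ^+ 2 + 1); first by lra.
  by field.
have := H (hnorm v ^+ 2)^-1.
rewrite (_ : _ - _ + _ = hnorm u ^+ 2 - normc z ^+ 2 / hnorm v ^+ 2); last by field.
rewrite subr_ge0 ler_pdivrMr ?exprn_even_gt0// -exprMn.
by rewrite ler_pXn2r ?nnegrE ?mulr_ge0.
Qed.

Lemma hnormZ c u : l2 w u -> hnorm (c *: u) = normc c * hnorm u.
Proof.
move=> lu; apply: (@pexpIrn _ 2) => //; rewrite ?nnegrE ?mulr_ge0//.
have lcu := l2Z c lu.
have := inner_self lcu; rewrite innerZr// (innerC lu lcu) innerZr// inner_self//.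
move=> /(congr1 (@complex.Re R)) /= <-.
by rewrite exprMn sqr_normcE; case: c {lcu} => a b /=; ring.
Qed.

Lemma hnormD u v : l2 w u -> l2 w v -> hnorm (u + v) <= hnorm u + hnorm v.
Proof.
move=> lu lv; rewrite -(ler_pXn2r (n := 2))// ?nnegrE ?addr_ge0//.
have luv := l2D lu lv.
have := inner_self luv; rewrite innerDr// (innerC lu luv) (innerC lv luv) !innerDr//.
rewrite (innerC lu lv) !inner_self//.
have := cauchy_schwarz lu lv.
have := le_trans (ler_norm _) (Re_le_normc (inner w u v)).
move: (inner w u v) => [a b] /= h1 h2 /(congr1 (@complex.Re R)) /= <-.
by rewrite expr2; lra.
Qed.

Lemma hnormN u : l2 w u -> hnorm (- u) = hnorm u.
Proof. by move=> lu; rewrite -scaleN1r hnormZ// normcN normc1 mul1r. Qed.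

Lemma hnormB u v : l2 w u -> l2 w v -> hnorm (u - v) <= hnorm u + hnorm v.
Proof.
by move=> lu lv; rewrite -(hnormN lv); apply: hnormD => //; rewrite -scaleN1r; exact: l2Z.
Qed.

Lemma hnorm0 : hnorm 0 = 0.
Proof. by rewrite -(scale0r (0 : T -> R[i])) hnormZ ?normc0 ?mul0r//; exact: l2_0. Qed.

End l2_space.

(** * Bounded operators and polynomials in an operator *)

Lemma cvg0e_le (R : realType) (f : nat -> \bar R) (e : R) : f @ \oo --> 0%E -> 0 < e ->
  \forall n \near \oo, (f n <= e%:E)%E.
Proof.
move=> cf e0.
have : nbhs (0 : \bar R)%E [set x | (x < e%:E)%E].
  by apply: open_nbhs_nbhs; split; [exact: open_ereal_lt_ereal|rewrite /= lte_fin].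
move=> nb; have : \forall n \near \oo, (f n < e%:E)%E by exact: (cf _ nb).
by apply: filterS => n /ltW.
Qed.

Lemma le_cvg0e (R : realType) (f : nat -> \bar R) : (forall n, (0 <= f n)%E) ->
  (forall e : R, 0 < e -> \forall n \near \oo, (f n <= e%:E)%E) -> f @ \oo --> 0%E.
Proof.
move=> f0 H.
have fin n (e : R) : (f n <= e%:E)%E -> f n \is a fin_num.
  by move=> fe; rewrite ge0_fin_numE//; apply: le_lt_trans fe _; rewrite ltry.
apply/fine_cvgP; split; first by apply: filterS (H 1 ltr01) => n /fin.
apply/cvgrPdist_le => e e0; apply: filterS (H e e0) => n fe /=.
by rewrite sub0r normrN ger0_norm ?fine_ge0// -lee_fin fineK//; exact: fin fe.
Qed.

Lemma le_of_sqr (R : realType) (a b : R) : 0 <= b -> a ^+ 2 <= b ^+ 2 -> a <= b.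
Proof. by move=> b0 ab; rewrite leNgt; apply/negP => ba; move: ab; rewrite !expr2; nra. Qed.

Section bounded_operators.
Local Open Scope complex_scope.
Context {R : realType} {T : choiceType}.
Variable w : T -> R.
Hypothesis w_gt0 : forall x, 0 < w x.
Implicit Types (u v : T -> R[i]) (c : R[i]) (A B : oper R T).

Let l2_0 := l2_0 w_gt0.
Let l2Z := l2Z w_gt0.
Let l2D := l2D w_gt0.
Let l2B := l2B w_gt0.
Let hnorm_ge0 := @hnorm_ge0 R T w.
Let normc_ge0 := @normc_ge0 R.
#[local] Hint Resolve l2_0 l2Z l2D l2B hnorm_ge0 normc_ge0 : core.

Definition lin_oper A := forall c u v, l2 w u -> l2 w v ->
  A (c *: u + v) = c *: A u + A v.

(** Boundedness with an explicit real constant, the form in which operators are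
    handled; [bounded_byP] relates it to [bounded_oper]. *)
Definition bounded_by A (M : R) := [/\ 0 <= M, lin_oper A,
  forall u, l2 w u -> l2 w (A u) &
  forall u, l2 w u -> hnorm w (A u) <= M * hnorm w u].

Lemma lin_oper0 A : lin_oper A -> A 0 = 0.
Proof.
move=> lA; have := lA 1 0 0 l2_0 l2_0.
by rewrite !scale1r addr0 => /esym/eqP; rewrite -subr_eq0 addrK => /eqP.
Qed.

Lemma lin_operZ A c u : lin_oper A -> l2 w u -> A (c *: u) = c *: A u.
Proof. by move=> lA lu; rewrite -[c *: u]addr0 lA// lin_oper0// addr0. Qed.

Lemma lin_operD A u v : lin_oper A -> l2 w u -> l2 w v -> A (u + v) = A u + A v.
Proof. by move=> lA lu lv; rewrite -[u in LHS]scale1r lA// scale1r. Qed.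

Lemma lin_operB A u v : lin_oper A -> l2 w u -> l2 w v -> A (u - v) = A u - A v.
Proof. by move=> lA lu lv; rewrite addrC -scaleN1r lA// scaleN1r addrC. Qed.

Lemma lin_oper_sum A (I : Type) (r : seq I) (F : I -> T -> R[i]) :
  lin_oper A -> (forall i, l2 w (F i)) ->
  A (\sum_(i <- r) F i) = \sum_(i <- r) A (F i).
Proof.
move=> lA lF; elim: r => [|i r IH]; first by rewrite !big_nil lin_oper0.
by rewrite !big_cons lin_operD ?IH//; exact: (l2_sum w_gt0).
Qed.

Lemma lin_oper_sub A B : lin_oper A -> lin_oper B -> lin_oper (fun u => A u - B u).
Proof.
move=> lA lB c u v lu lv; rewrite lA// lB// scalerBr opprD !addrA; congr (_ + _).
by rewrite -!addrA; congr (_ + _); rewrite addrC.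
Qed.

Lemma hnorm_small u (C : R) : l2 w u ->
  (forall e, 0 < e -> hnorm w u <= e * C) -> u = 0.
Proof.
move=> lu H; apply: (hnorm_eq0 w_gt0 lu); apply/eqP; rewrite eq_le hnorm_ge0 andbT.
have C0 : 0 <= C by rewrite -[C]mul1r; apply: le_trans (H 1 ltr01).
apply/ler_addgt0Pr => e e0; rewrite add0r.
apply: (le_trans (H (e / (C + 1)) _)); first by rewrite divr_gt0// ltr_wpDl.
by rewrite mulrAC ler_pdivrMr ?ltr_wpDl// ler_wpM2l ?(ltW e0)// lerDl.
Qed.

(** ** The operator norm *)

(** Linearity reduces a vector to one of norm [1]. *)
Lemma opnorm_leP A (M : R) : lin_oper A -> 0 <= M ->
  (opnorm w A <= M%:E)%E <->
  (forall u, l2 w u -> l2 w (A u) /\ hnorm w (A u) <= M * hnorm w u).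
Proof.
move=> lA M0; split => [AM u lu|H].
  have H v : l2 w v -> hnorm w v <= 1 -> l2 w (A v) /\ hnorm w (A v) <= M.
    move=> lv v1.
    have Av : (l2norm w (A v) <= M%:E)%E.
      apply: le_trans AM; apply: ereal_sup_ubound; exists v => //=.
      by rewrite l2normE// lee_fin.
    have lAv : l2 w (A v) by apply: le_lt_trans Av _; rewrite ltry.
    by split => //; rewrite -lee_fin -l2normE.
  have [u0|u0] := eqVneq (hnorm w u) 0.
    have -> : u = 0 by exact: (hnorm_eq0 w_gt0 lu u0).
    by rewrite lin_oper0// (hnorm0 w_gt0) mulr0.
  have up : 0 < hnorm w u by rewrite lt_def u0 hnorm_ge0.
  pose c : R[i] := (hnorm w u)%:C.
  have c0 : c != 0 by rewrite /c eq_complex/= eqxx andbT.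
  have nc : normc c = hnorm w u by rewrite /c/= expr0n addr0 sqrtr_sqr ger0_norm.
  have lv : l2 w (c^-1 *: u) by exact: l2Z.
  have [] := H _ lv.
    by rewrite (hnormZ w_gt0)// normcV nc mulVf.
  rewrite lin_operZ// => lAv hAv.
  have -> : A u = c *: (c^-1 *: A u) by rewrite scalerA divff// scale1r.
  split; first exact: l2Z.
  by rewrite (hnormZ w_gt0)// nc mulrC ler_wpM2r.
apply: ge_ereal_sup => _ [u /= u1 <-].
have lu : l2 w u by apply: le_lt_trans u1 _; rewrite ltry.
have [lAu Au] := H _ lu; rewrite l2normE// lee_fin (le_trans Au)//.
by rewrite ler_piMr// -lee_fin -l2normE.
Qed.

Lemma bounded_byP A : (exists M, bounded_by A M) <-> bounded_oper w A.
Proof.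
split => [[M [M0 lA A2 AM]]|[A2 lA]].
  split => //; apply: (@le_lt_trans _ _ M%:E); last exact: ltry.
  by apply/opnorm_leP => // u lu; split; [exact: A2|exact: AM].
have : (0 <= opnorm w A)%E.
  apply: (@le_trans _ _ (l2norm w (A 0))).
    by rewrite l2normE ?lee_fin//; exact: A2.
  apply: ereal_sup_ubound; exists 0 => //=.
  by rewrite l2normE// (hnorm0 w_gt0) lee_fin.
case E : (opnorm w A) => [M| |]// M0 _; exists M; rewrite lee_fin in M0.
have : (opnorm w A <= M%:E)%E by rewrite E.
by move=> /opnorm_leP H; split => // u lu; case: (H lA M0 u lu).
Qed.

Lemma opnorm_ge0 A : lin_oper A -> (0 <= opnorm w A)%E.
Proof.
move=> lA; apply: (@le_trans _ _ (l2norm w (A 0))).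
  by rewrite lin_oper0// l2normE ?lee_fin.
apply: ereal_sup_ubound; exists 0 => //=.
by rewrite l2normE// (hnorm0 w_gt0) lee_fin.
Qed.

Lemma norm_cvgP (An : nat -> oper R T) A : (forall n, lin_oper (An n)) -> lin_oper A ->
  norm_cvg w An A <-> forall e, 0 < e -> \forall n \near \oo, forall u, l2 w u ->
    l2 w (An n u - A u) /\ hnorm w (An n u - A u) <= e * hnorm w u.
Proof.
move=> lAn lA; have lB n := lin_oper_sub (lAn n) lA.
split => [cv e e0|H].
  apply: filterS (cvg0e_le cv e0) => n /= /(opnorm_leP (lB n) (ltW e0)); exact.
apply: le_cvg0e => [n|e e0]; first exact: opnorm_ge0.
by apply: filterS (H e e0) => n Hn; apply/(opnorm_leP (lB n) (ltW e0)).
Qed.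

(** ** Completeness *)

Let cvg_normc (f : nat -> R[i]) (a : R[i]) (z : R[i]) :
  (fun n => complex.Re (f n)) @ \oo --> complex.Re a ->
  (fun n => complex.Im (f n)) @ \oo --> complex.Im a ->
  (fun n => normc (f n - z) ^+ 2) @ \oo --> normc (a - z) ^+ 2.
Proof.
move=> ra ia; rewrite sqr_normcE.
rewrite (_ : (fun n => _) = fun n => (complex.Re (f n) - complex.Re z) ^+ 2 +
    (complex.Im (f n) - complex.Im z) ^+ 2); last first.
  by apply/funext => n; rewrite sqr_normcE; case: (f n); case: z.
rewrite (_ : complex.Re (a - z) = complex.Re a - complex.Re z); last by case: a {ra ia}; case: z.
rewrite (_ : complex.Im (a - z) = complex.Im a - complex.Im z); last by case: a {ra ia}; case: z.
apply: cvgD; rewrite expr2; under eq_fun do rewrite expr2.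
- by apply: cvgM; apply: cvgB => //; exact: cvg_cst.
- by apply: cvgM; apply: cvgB => //; exact: cvg_cst.
Qed.

Let cvg_fsum (X : {fset T}) (F : T -> nat -> R) (l : T -> R) :
  (forall x, F x @ \oo --> l x) ->
  (fun n => \sum_(x <- X) F x n) @ \oo --> \sum_(x <- X) l x.
Proof.
move=> Fl; elim: (X : seq T) => [|x s IH].
  by under eq_fun do rewrite big_nil; rewrite big_nil; exact: cvg_cst.
by under eq_fun do rewrite big_cons; rewrite big_cons; exact: cvgD.
Qed.

(** The limit is pointwise. A bound on the norm of a difference is a family of
    closed conditions, one for each finite set of points, hence survives; it is
    kept for every stage [N] so that operators can reuse it. *)
Let l2_cauchy (u_ : nat -> T -> R[i]) : (forall n, l2 w (u_ n)) ->
  (forall e, 0 < e -> exists N, forall m n, (N <= m)%N -> (N <= n)%N ->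
     hnorm w (u_ m - u_ n) <= e) ->
  exists u, l2 w u /\ forall e N, 0 <= e -> (forall m n, (N <= m)%N -> (N <= n)%N ->
     hnorm w (u_ m - u_ n) <= e) -> forall n, (N <= n)%N -> hnorm w (u - u_ n) <= e.
Proof.
move=> lu H.
have cauchy_real (p : R[i] -> R) : (forall z, `|p z| <= normc z) ->
    (forall z z', p (z - z') = p z - p z') ->
    forall x, exists l : R, (fun n => p (u_ n x)) @ \oo --> l.
  move=> pz pB x; apply/cvg_ex/cauchy_cvgP/cauchy_exP => e e0.
  have d0 : 0 < e / 2 * Num.sqrt (w x) by rewrite mulr_gt0 ?divr_gt0 ?sqrtr_gt0.
  have [N HN] := H _ d0; exists (p (u_ N x)); exists N => // n /= Nn.
  rewrite /ball/= -pB (le_lt_trans (pz _))//.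
  apply: (@le_lt_trans _ _ (e / 2)); last by rewrite ltr_pdivrMr// ltr_pMr// ltr1n.
  apply: le_of_sqr; rewrite ?divr_ge0 ?(ltW e0)// -(ler_pM2r (w_gt0 x)).
  apply: (le_trans (pointwise_le w_gt0 x (l2B (lu N) (lu n)))).
  rewrite -[w x]sqr_sqrtr ?(ltW (w_gt0 x))// -exprMn ler_pXn2r ?nnegrE//; last exact: ltW.
  exact: HN.
have RImax (z : R[i]) (y : R) : y ^+ 2 <= normc z ^+ 2 -> `|y| <= normc z.
  by move=> yz; rewrite ler_norml lerNl; apply/andP; split; apply: le_of_sqr; rewrite ?sqrrN.
have [re reP] : {re : T -> R & forall x, (fun n => complex.Re (u_ n x)) @ \oo --> re x}.
  apply: (@choice _ _ (fun x l => (fun n => complex.Re (u_ n x)) @ \oo --> l)).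
  apply: (cauchy_real (@complex.Re R)) => [z|[a b] [c d]]//.
  by apply: RImax; rewrite sqr_normcE lerDl sqr_ge0.
have [im imP] : {im : T -> R & forall x, (fun n => complex.Im (u_ n x)) @ \oo --> im x}.
  apply: (@choice _ _ (fun x l => (fun n => complex.Im (u_ n x)) @ \oo --> l)).
  apply: (cauchy_real (@complex.Im R)) => [z|[a b] [c d]]//.
  by apply: RImax; rewrite sqr_normcE lerDr sqr_ge0.
pose u x := re x +i* im x.
have K e N : 0 <= e -> (forall m n, (N <= m)%N -> (N <= n)%N ->
     hnorm w (u_ m - u_ n) <= e) -> forall n, (N <= n)%N ->
     l2 w (u - u_ n) /\ hnorm w (u - u_ n) <= e.
  move=> e0 HN n Nn; apply: (l2_esum_le w_gt0) => // X.
  have cv : (fun m => \sum_(x <- X) normc (u_ m x - u_ n x) ^+ 2 * w x) @ \oo -->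
      \sum_(x <- X) normc (u x - u_ n x) ^+ 2 * w x.
    apply: (@cvg_fsum X (fun x m => normc (u_ m x - u_ n x) ^+ 2 * w x)) => x.
    apply: cvgMl; apply: cvg_normc; [exact: reP|exact: imP].
  apply: (closed_cvg (fun y => y <= e ^+ 2) (@closed_le _ _) _ _ cv).
  exists N => // m /= Nm.
  apply: (le_trans (esum_le_l2 w_gt0 X (l2B (lu m) (lu n)))).
  by rewrite ler_pXn2r ?nnegrE//; exact: HN.
have [N HN] := H 1 ltr01.
exists u; split; last by move=> e N' e0 /(K e N' e0) h n /h[].
rewrite -(subrK (u_ N) u); apply: l2D => //.
by have [] := K 1 N ler01 HN N (leqnn N).
Qed.

(** The limits of the [B_ n u] for single vectors [u] assemble to an operator;
    it is linear because the [B_ n], which are, approximate it uniformly. *)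
Lemma oper_complete (B_ : nat -> oper R T) :
  (forall n, exists M, bounded_by (B_ n) M) ->
  (forall e, 0 < e -> exists N, forall m n, (N <= m)%N -> (N <= n)%N ->
     forall u, l2 w u -> hnorm w (B_ m u - B_ n u) <= e * hnorm w u) ->
  exists B, (exists M, bounded_by B M) /\
    forall e N, 0 <= e -> (forall m n, (N <= m)%N -> (N <= n)%N ->
     forall u, l2 w u -> hnorm w (B_ m u - B_ n u) <= e * hnorm w u) ->
    forall n u, (N <= n)%N -> l2 w u -> hnorm w (B u - B_ n u) <= e * hnorm w u.
Proof.
move=> bB H.
have lB n u : l2 w u -> l2 w (B_ n u) by have [M [_ _ + _]] := bB n; exact.
have H1 u : exists b, l2 w u -> l2 w b /\ forall e N, 0 <= e ->
    (forall m n, (N <= m)%N -> (N <= n)%N -> hnorm w (B_ m u - B_ n u) <= e) ->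
    forall n, (N <= n)%N -> hnorm w (b - B_ n u) <= e.
  have [lu|nlu] := pselect (l2 w u); last by exists 0.
  have [|e e0|b bP] := @l2_cauchy (fun n => B_ n u); first by move=> n; exact: lB.
    have d0 : 0 < e / (hnorm w u + 1) by rewrite divr_gt0// ltr_wpDl.
    have [N HN] := H _ d0; exists N => m n Nm Nn; apply: (le_trans (HN _ _ Nm Nn _ lu)).
    by rewrite mulrAC ler_pdivrMr ?ltr_wpDl// ler_wpM2l ?(ltW e0)// lerDl.
  by exists b.
have [B BP] := choice H1.
have BB e N n u : 0 <= e -> (forall m n, (N <= m)%N -> (N <= n)%N ->
     forall u, l2 w u -> hnorm w (B_ m u - B_ n u) <= e * hnorm w u) ->
     (N <= n)%N -> l2 w u -> hnorm w (B u - B_ n u) <= e * hnorm w u.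
  move=> e0 HN Nn lu; have [_ h] := BP _ lu; apply: (h _ N) => //; first exact: mulr_ge0.
  by move=> p r Np Nr; exact: HN.
have lBu u : l2 w u -> l2 w (B u) by move=> /BP[].
exists B; split; last by move=> e N e0 HN n u Nn lu; exact: (BB e N).
have [N HN] := H 1 ltr01; have [M [M0 linN _ MN]] := bB N.
exists (1 + M); split => //; first by rewrite addr_ge0.
  move=> c u v lu lv; apply/eqP; rewrite -subr_eq0; apply/eqP.
  have lcuv : l2 w (c *: u + v) by exact/l2D/lv/l2Z.
  apply: (@hnorm_small _ (hnorm w (c *: u + v) + normc c * hnorm w u + hnorm w v)).
    by apply: l2B; [exact: lBu|apply: l2D; [apply: l2Z; exact: lBu|exact: lBu]].
  move=> e e0; have [N' HN'] := H _ e0.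
  have K x lx := BB e N' N' x (ltW e0) HN' (leqnn _) lx.
  have [M' [_ lin' _ _]] := bB N'.
  rewrite (_ : _ - _ = (B (c *: u + v) - B_ N' (c *: u + v)) -
      (c *: (B u - B_ N' u) + (B v - B_ N' v))); last first.
    rewrite lin'// scalerBr; apply/funext => x; rewrite !fctE/=; ring.
  have l1 x : l2 w x -> l2 w (B x - B_ N' x) by move=> lx; apply: l2B; [exact: lBu|exact: lB].
  apply: (le_trans (hnormB w_gt0 _ _)); [exact: l1|by apply: l2D; [apply: l2Z; exact: l1|exact: l1]|].
  rewrite !mulrDr -addrA; apply: lerD; first exact: K.
  apply: (le_trans (hnormD w_gt0 _ _)); [by apply: l2Z; exact: l1|exact: l1|].
  apply: lerD; last exact: K.
  rewrite (hnormZ w_gt0); last exact: l1.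
  by rewrite [leRHS]mulrCA ler_wpM2l//; exact: K.
move=> u lu; rewrite -(subrK (B_ N u) (B u)).
apply: (le_trans (hnormD w_gt0 _ _)); [by apply: l2B; [exact: lBu|exact: lB]|exact: lB|].
by rewrite mulrDl; apply: lerD; [exact: (BB 1 N)|exact: MN].
Qed.

(** ** Polynomials in an operator *)

Definition peval (p : {poly R[i]}) A u : T -> R[i] :=
  \sum_(i < size p) p`_i *: iter i A u.

Section polynomials.
Variables (A : oper R T) (M : R).
Hypothesis AM : bounded_by A M.

Let linA : lin_oper A. Proof. by case: AM. Qed.
Let A2 u : l2 w u -> l2 w (A u). Proof. by case: AM => _ _ + _; exact. Qed.

Let iter2 i u : l2 w u -> l2 w (iter i A u).
Proof. by move=> lu; elim: i => //= i; exact: A2. Qed.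

Let pevalE n (p : {poly R[i]}) u : (size p <= n)%N ->
  peval p A u = \sum_(i < n) p`_i *: iter i A u.
Proof.
move=> pn; rewrite /peval (big_ord_widen n (fun i => p`_i *: iter i A u))//.
rewrite big_mkcond; apply: eq_bigr => i _; case: ltnP => // /(nth_default 0) ->.
by rewrite scale0r.
Qed.

Lemma pevalD p q u : peval (p + q) A u = peval p A u + peval q A u.
Proof.
rewrite (@pevalE (maxn (size p) (size q)) (p + q)) ?size_polyD//.
rewrite (@pevalE (maxn (size p) (size q)) p) ?leq_maxl//.
rewrite (@pevalE (maxn (size p) (size q)) q) ?leq_maxr//.
by rewrite -big_split; apply: eq_bigr => i _; rewrite coefD scalerDl.
Qed.

Lemma pevalC c u : peval c%:P A u = c *: u.
Proof. by rewrite (@pevalE 1) ?size_polyC_leq1// big_ord1 coefC. Qed.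

Lemma pevalMX p u : l2 w u -> peval (p * 'X) A u = A (peval p A u).
Proof.
move=> lu; rewrite (@pevalE (size p).+1 (p * 'X)); last first.
  by have [->|p0] := eqVneq p 0; rewrite ?mul0r ?size_poly0// size_mulX.
rewrite big_ord_recl coefMX/= scale0r add0r /peval lin_oper_sum//; last first.
  by move=> i; apply: l2Z; exact: iter2.
by apply: eq_bigr => i _; rewrite coefMX/= lin_operZ//; exact: iter2.
Qed.

Lemma peval_bounded p : exists N, bounded_by (peval p A) N.
Proof.
elim/poly_ind: p => [|p c [N [N0 linN N2 HN]]].
  exists 0; have E u : peval 0 A u = 0 by rewrite /peval size_poly0 big_ord0.
  by split => // [c u v lu lv|u lu|u lu]; rewrite !E ?scaler0 ?addr0 ?(hnorm0 w_gt0) ?mul0r.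
have [M0 _ _ HM] := AM.
have E u : l2 w u -> peval (p * 'X + c%:P) A u = A (peval p A u) + c *: u.
  by move=> lu; rewrite pevalD pevalMX// pevalC.
exists (M * N + normc c); split; first by rewrite addr_ge0 ?mulr_ge0.
- move=> d u v lu lv; rewrite !E//; last by apply: l2D => //; exact: l2Z.
  rewrite linN// linA; [|exact: N2|exact: N2].
  by apply/funext => x; rewrite !fctE/= /GRing.scale/=; ring.
- by move=> u lu; rewrite E//; apply: l2D; [exact/A2/N2|exact: l2Z].
move=> u lu; rewrite E//; apply: (le_trans (hnormD w_gt0 _ _)); [exact/A2/N2|exact: l2Z|].
rewrite mulrDl (hnormZ w_gt0)// lerD2r -mulrA.
by apply: (le_trans (HM _ (N2 _ lu))); rewrite ler_wpM2l//; exact: HN.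
Qed.

Let p2 p u : l2 w u -> l2 w (peval p A u).
Proof. by move=> lu; have [N [_ _ + _]] := peval_bounded p; exact. Qed.

Lemma pevalM p q u : l2 w u -> peval (p * q) A u = peval p A (peval q A u).
Proof.
move=> lu; elim/poly_ind: p => [|p c IH].
  by rewrite mul0r /peval size_poly0 !big_ord0.
rewrite mulrDl !pevalD mulrAC mul_polyC; congr (_ + _).
  by rewrite (pevalMX (p * q) lu) IH (pevalMX p (p2 q lu)).
rewrite pevalC -mul_polyC.
elim/poly_ind: q {IH} => [|q d IHq].
  by rewrite mulr0 /peval size_poly0 !big_ord0 scaler0.
rewrite mulrDr mulrA !pevalD !pevalMX// IHq scalerDr lin_operZ//; last exact: p2.
by rewrite -polyCM !pevalC scalerA.
Qed.

Lemma pevalZ c p u : l2 w u -> peval (c *: p) A u = c *: peval p A u.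
Proof. by move=> lu; rewrite -mul_polyC pevalM// pevalC. Qed.

Lemma pevalB p q u : l2 w u -> peval (p - q) A u = peval p A u - peval q A u.
Proof. by move=> lu; rewrite pevalD -scaleN1r pevalZ// scaleN1r. Qed.

Lemma pevalX u : peval 'X A u = A u.
Proof. by rewrite (@pevalE 2) ?size_polyX// !big_ord_recl big_ord0 !coefX scale0r scale1r addr0 add0r. Qed.

End polynomials.

End bounded_operators.

(** * Functional calculus of a self-adjoint operator *)

Section spectral_calculus.
Local Open Scope complex_scope.
Context {R : realType} {T : choiceType}.
Variable w : T -> R.
Hypothesis w_gt0 : forall x, 0 < w x.
Implicit Types (u v : T -> R[i]) (c z : R[i]).

Let l2_0 := l2_0 w_gt0.
Let l2Z := l2Z w_gt0.
Let l2D := l2D w_gt0.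
Let l2B := l2B w_gt0.
Let hnorm_ge0 := @hnorm_ge0 R T w.
Let normc_ge0 := @normc_ge0 R.
#[local] Hint Resolve l2_0 l2Z l2D l2B hnorm_ge0 normc_ge0 : core.

Variables (A : oper R T) (M : R).
Hypothesis AM : bounded_by w A M.
Hypothesis selfadj : forall u v, l2 w u -> l2 w v -> inner w (A u) v = inner w u (A v).

Let linA : lin_oper w A. Proof. by case: AM. Qed.
Let A2 u : l2 w u -> l2 w (A u). Proof. by case: AM => _ _ + _; exact. Qed.
Let peval2 p u : l2 w u -> l2 w (peval p A u).
Proof. by move=> lu; have [N [_ _ + _]] := peval_bounded w_gt0 AM p; exact. Qed.

Definition rpeval (p : {poly R}) u := peval (map_poly (real_complex R) p) A u.

Lemma poly_operE p u : poly_oper p A u = rpeval p u.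
Proof.
rewrite /poly_oper /rpeval /peval size_map_poly; apply: eq_bigr => i _.
by rewrite coef_map.
Qed.

Let rp2 p u : l2 w u -> l2 w (rpeval p u). Proof. exact: peval2. Qed.
#[local] Hint Resolve A2 peval2 rp2 : core.

Let conjD (a b : R[i]) : (a + b)^* = a^* + b^*. Proof. exact: rmorphD. Qed.
Let conjM (a b : R[i]) : (a * b)^* = a^* * b^*. Proof. exact: rmorphM. Qed.

Let innerDl u u' v : l2 w u -> l2 w u' -> l2 w v ->
  inner w (u + u') v = inner w u v + inner w u' v.
Proof.
move=> lu lu' lv; rewrite (innerC w_gt0 lv (l2D lu lu')) (innerDr w_gt0)// conjD.
by rewrite [inner w u v](innerC w_gt0 lv lu) [inner w u' v](innerC w_gt0 lv lu').
Qed.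

Let innerZl c u v : l2 w u -> l2 w v -> inner w (c *: u) v = c^* * inner w u v.
Proof.
move=> lu lv; rewrite (innerC w_gt0 lv (l2Z c lu)) (innerZr w_gt0)// conjM.
by rewrite [inner w u v](innerC w_gt0 lv lu).
Qed.

Let innerRl (a : R) u v : l2 w u -> l2 w v -> inner w (a%:C *: u) v = a%:C * inner w u v.
Proof. by move=> lu lv; rewrite innerZl//; congr (_ * _); exact: conjc_real. Qed.

Lemma rpeval_selfadj p u v : l2 w u -> l2 w v ->
  inner w (rpeval p u) v = inner w u (rpeval p v).
Proof.
move=> lu lv; elim/poly_ind: p v lv => [|p c IH] v lv.
  have E x : rpeval 0 x = 0 by rewrite /rpeval map_poly0 /peval size_poly0 big_ord0.
  rewrite !E; transitivity (0 : R[i]).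
    have := innerZl 0 lu lv; rewrite scale0r => ->.
    by rewrite [X in X * _](_ : _ = 0) ?mul0r//; apply/eqP; rewrite eq_complex/= oppr0 !eqxx.
  by rewrite -(scale0r v) (innerZr w_gt0)// mul0r.
rewrite /rpeval rmorphD rmorphM/= map_polyX map_polyC/= !(pevalD A) !(pevalMX w_gt0 AM)// !(pevalC A).
rewrite innerDl ?(innerDr w_gt0)//; try by auto.
rewrite innerRl ?(innerZr w_gt0)//; congr (_ + _).
rewrite selfadj//; last by auto.
rewrite [LHS](IH _ (A2 lv)); congr (inner w u _).
rewrite /rpeval -(pevalMX w_gt0 AM)// (pevalM w_gt0 AM)//.
by rewrite (pevalX A).
Qed.

Definition bounded_below z := exists2 c : R, 0 < c &
  forall u, l2 w u -> c * hnorm w u <= hnorm w (A u - z *: u).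

(** The quadratic form of [A] is real, so off the real axis the imaginary part of
    [z] bounds [A - z] from below. *)
Lemma nonreal_bounded_below z : complex.Im z != 0 -> bounded_below z.
Proof.
move=> z0; exists `|complex.Im z|; first by rewrite normr_gt0.
move=> u lu; have lAz : l2 w (A u - z *: u) by apply: l2B; auto.
have [->|u0] := eqVneq (hnorm w u) 0; first by rewrite mulr0.
have up : 0 < hnorm w u by rewrite lt_def u0 hnorm_ge0.
rewrite -(ler_pM2l up); apply: le_trans (cauchy_schwarz w_gt0 lu lAz).
have rA : complex.Im (inner w u (A u)) = 0.
  have := selfadj lu lu; rewrite (innerC w_gt0 lu (A2 lu)).
  by case: (inner w u (A u)) => a b [] /= h; lra.
rewrite -scaleN1r scalerA (innerDr w_gt0) ?(innerZr w_gt0) ?(inner_self w_gt0)//; try by auto.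
move: rA; case: (inner w u (A u)) => a b /= ->.
apply: le_of_sqr => //; rewrite sqr_normcE; case: (z) => x y /=.
rewrite mulrCA exprMn real_normK ?num_real//.
rewrite [X in _ <= _ + X](_ : _ = y ^+ 2 * (hnorm w u ^+ 2) ^+ 2); last by ring.
rewrite [leLHS](_ : _ = y ^+ 2 * (hnorm w u ^+ 2) ^+ 2); last by ring.
by rewrite lerDr sqr_ge0.
Qed.

Lemma far_bounded_below (t : R) : M < `|t| -> bounded_below t%:C.
Proof.
move=> Mt; exists (`|t| - M); first by rewrite subr_gt0.
move=> u lu; have [_ _ _ HM] := AM.
have lt : l2 w (t%:C *: u) by exact: l2Z.
have := hnormB w_gt0 (A2 lu) (l2B (A2 lu) lt).
rewrite opprB addrCA subrr addr0 (hnormZ w_gt0)// (_ : normc t%:C = `|t|); last first.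
  by rewrite /= expr0n addr0 sqrtr_sqr.
by have := HM _ lu; lra.
Qed.

(** The [X - z] factors of a polynomial bound it from below one at a time. *)
Let poly_bounded_below (p : {poly R[i]}) : p != 0 ->
  (forall z, root p z -> bounded_below z) ->
  exists2 c : R, 0 < c & forall u, l2 w u -> c * hnorm w u <= hnorm w (peval p A u).
Proof.
have [n] := ubnP (size p); elim: n p => // n IH p pn p0 H.
have [p1|p1] := eqVneq (size p) 1%N.
  move/eqP/size_poly1P: p1 => [c c0 ->]; exists (normc c).
    by rewrite lt_def normc_ge0 andbT; apply: contra c0 => /eqP/eq0_normc ->.
  by move=> u lu; rewrite (pevalC A) (hnormZ w_gt0).
have /closed_rootP [z pz] := p1.
have [zc zc0 zP] := H z pz.
have /factor_theorem[q qE] := pz.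
have q0 : q != 0 by apply: contra p0 => /eqP q0; rewrite qE q0 mul0r.
have [||c c0 cP] := IH q _ q0.
- by rewrite -ltnS (leq_trans _ pn)// qE size_Mmonic ?monicXsubC// size_XsubC addn2.
- by move=> y qy; apply: H; rewrite qE rootM qy.
exists (c * zc); first by rewrite mulr_gt0.
move=> u lu; rewrite qE (pevalM w_gt0 AM)// -mulrA.
have E : peval ('X - z%:P) A u = A u - z *: u.
  by rewrite (pevalB w_gt0 AM)// (pevalX A) (pevalC A).
apply: le_trans (cP _ (peval2 _ lu)); rewrite ler_wpM2l ?(ltW c0)// E.
exact: zP.
Qed.

Lemma hnormB_sqr u v : l2 w u -> l2 w v ->
  hnorm w (u - v) ^+ 2 = hnorm w u ^+ 2 - 2 * complex.Re (inner w u v) + hnorm w v ^+ 2.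
Proof.
move=> lu lv; have := inner_self w_gt0 (l2B lu lv).
rewrite -scaleN1r innerDl ?innerZl ?(innerDr w_gt0) ?(innerZr w_gt0) ?(inner_self w_gt0)//; try by auto.
rewrite (innerC w_gt0 lu lv); move: (inner w u v) => [a b] /(congr1 (@complex.Re R))/= <-.
by rewrite !oppr0 !mulr0 !mul0r; ring.
Qed.

(** [S] is any set of reals outside of which [A - t] is bounded below. It is used
    for the segment [[- M, M]], which gives the existence of the calculus, and
    then for the spectrum. *)
Section spectral_bound.
Variables (S : set R) (HS : forall t, ~ S t -> bounded_below t%:C).

(** If the norm [N] of [q = p(A)] exceeded [m], then [N^2 - p^2] would have no
    root where [A - t] fails to be bounded below, so [N^2 - q^2] would be bounded
    below; self-adjointness turns this into a bound for [q] smaller than [N]. *)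
Let spectral_bound_nonconstant (p : {poly R}) (m : R) : 0 <= m -> (1 < size p)%N ->
  (forall t, S t -> `|p.[t]| <= m) ->
  forall u, l2 w u -> hnorm w (rpeval p u) <= m * hnorm w u.
Proof.
move=> m0 p1 pm.
pose P (N : R) := 0 <= N /\ forall u, l2 w u -> hnorm w (rpeval p u) <= N * hnorm w u.
have step (N : R) : P N -> m < N -> exists2 N', N' < N & P N'.
  move=> [N0 HN] mN; have Np : 0 < N by exact: le_lt_trans mN.
  pose r := (N ^+ 2)%:P - p * p.
  have [||c c0 cP] := @poly_bounded_below (map_poly (real_complex R) r).
  - rewrite map_poly_eq0 /r subr_eq0; apply/eqP => /(congr1 (fun p : {poly R} => size p)).
    have p0 : p != 0 by rewrite -size_poly_gt0 (leq_trans _ p1).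
    rewrite size_mul// => E; have := size_polyC_leq1 (N ^+ 2); rewrite E.
    by case: (size p) p1 => [|[|k]]//; rewrite addSn/= addnS.
  - move=> z; have [z0|z0] := eqVneq (complex.Im z) 0; last by move=> _; exact: nonreal_bounded_below.
    rewrite (_ : z = (complex.Re z)%:C); last by case: (z) z0 => a b /= ->.
    rewrite /root horner_map fmorph_eq0 /r !hornerE subr_eq0 => /eqP Nt.
    apply: HS => /pm pt.
    have : N ^+ 2 <= m ^+ 2.
      by rewrite Nt -expr2 -real_normK ?num_real// ler_pXn2r ?nnegrE.
    by rewrite !expr2; nra.
  (* The estimate obtained below is [N^2 |p(A) u|^2 <= (N^4 - c^2) |u|^2]. *)
  pose N2 := N ^+ 2 - c ^+ 2 / N ^+ 2.
  have N20 : 0 < N ^+ 2 by rewrite exprn_gt0.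
  have cN : 0 < c ^+ 2 / N ^+ 2 by rewrite divr_gt0// exprn_gt0.
  exists (Num.sqrt N2).
    rewrite -[ltRHS]ger0_norm// -sqrtr_sqr ltr_sqrt//.
    by rewrite /N2 ltrBlDr ltrDl.
  split; first exact: sqrtr_ge0.
  move=> u lu; set y := hnorm w (rpeval p u); set n := hnorm w u.
  have cu : c * n <= hnorm w ((N ^+ 2)%:C *: u - rpeval p (rpeval p u)).
    have := cP u lu; have -> : map_poly (real_complex R) r = ((N ^+ 2)%:C)%:P -
        map_poly (real_complex R) p * map_poly (real_complex R) p.
      by rewrite /r rmorphB/= map_polyC/= -rmorphM.
    rewrite (pevalB w_gt0 AM)//.
    by rewrite (pevalC A) (pevalM w_gt0 AM).
  have n0 : 0 <= n by exact: hnorm_ge0.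
  have y0 : 0 <= y by exact: hnorm_ge0.
  have lNu : l2 w ((N ^+ 2)%:C *: u) by exact: l2Z.
  have cu2 : c ^+ 2 * n ^+ 2 <= (N ^+ 2) ^+ 2 * n ^+ 2 - N ^+ 2 * y ^+ 2.
    have : (c * n) ^+ 2 <= hnorm w ((N ^+ 2)%:C *: u - rpeval p (rpeval p u)) ^+ 2.
      by rewrite ler_pXn2r ?nnegrE ?mulr_ge0 ?(ltW c0).
    rewrite hnormB_sqr; try by auto.
    rewrite innerRl; try by auto.
    rewrite -rpeval_selfadj; try by auto.
    rewrite (inner_self w_gt0); try by auto.
    rewrite -rmorphM/= (hnormZ w_gt0)// -/y -/n.
    rewrite (_ : normc (N ^+ 2)%:C = N ^+ 2); last first.
      by rewrite /= expr0n addr0 sqrtr_sqr ger0_norm// ltW.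
    have : hnorm w (rpeval p (rpeval p u)) ^+ 2 <= (N * y) ^+ 2.
      by rewrite ler_pXn2r ?nnegrE ?mulr_ge0//; apply: HN; auto.
    by rewrite !exprMn; lra.
  have yn : y ^+ 2 <= N2 * n ^+ 2.
    have N2E : N ^+ 2 * N2 = (N ^+ 2) ^+ 2 - c ^+ 2 by rewrite /N2; field; rewrite gt_eqF.
    by rewrite -(ler_pM2l N20) [leRHS]mulrA N2E; lra.
  apply: le_of_sqr; first by rewrite mulr_ge0 ?sqrtr_ge0 ?hnorm_ge0.
  rewrite exprMn; case: (leP 0 N2) => [N2p|N2n]; first by rewrite (sqr_sqrtr N2p).
  rewrite ltr0_sqrtr// expr0n mul0r (le_trans yn)// mulr_le0_ge0 ?sqr_ge0//.
  exact: ltW.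
have [N1 [N10 _ _ HN1]] := peval_bounded w_gt0 AM (map_poly (real_complex R) p).
have hP : has_inf [set N | P N] by split; [exists N1|exists 0 => N []].
pose N := inf [set N | P N].
have PN : P N.
  split; first by apply: lb_le_inf; [exists N1|move=> x []].
  move=> u lu; apply/ler_addgt0Pr => e e0.
  have d0 : 0 < e / (hnorm w u + 1) by rewrite divr_gt0// ltr_wpDl.
  have [N' [_ PN'] NN'] := inf_adherent d0 hP.
  apply: (le_trans (PN' _ lu)).
  apply: (@le_trans _ _ ((N + e / (hnorm w u + 1)) * hnorm w u)).
    by rewrite ler_wpM2r// ltW.
  rewrite mulrDl lerD2l mulrAC ler_pdivrMr ?ltr_wpDl// ler_wpM2l ?(ltW e0)//.
  by rewrite lerDl.
have [Nm u lu|mN] := leP N m; first by apply: (le_trans (PN.2 u lu)); rewrite ler_wpM2r.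
have [N' N'N PN'] := step N PN mN.
have : N <= N' by apply: ge_inf; [case: hP|].
by rewrite leNgt N'N.
Qed.

Theorem spectral_bound (p : {poly R}) (m : R) : 0 <= m ->
  (forall t, S t -> `|p.[t]| <= m) ->
  forall u, l2 w u -> hnorm w (rpeval p u) <= m * hnorm w u.
Proof.
move=> m0 pm u lu; have [p1|] := ltnP 1 (size p).
  exact: spectral_bound_nonconstant.
move/size1_polyC => pE.
have [[t St]|nS] := pselect (S !=set0).
  rewrite pE /rpeval map_polyC/= (pevalC A) (hnormZ w_gt0)// ler_wpM2r//.
  have := pm t St; rewrite [in p.[t]]pE hornerC /= expr0n addr0 sqrtr_sqr.
  exact.
(* An empty exceptional set forces the space to be trivial. *)
have A0 : hnorm w (rpeval 'X u) <= 0 * hnorm w u.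
  apply: spectral_bound_nonconstant => //; first by rewrite size_polyX.
  by move=> t St; exfalso; apply: nS; exists t.
have [c c0 cP] : bounded_below (0 : R)%:C by apply: HS => S0; apply: nS; exists 0.
have u0 : hnorm w u = 0.
  apply/eqP; rewrite eq_le hnorm_ge0 andbT -(pmulr_rle0 _ c0).
  apply: (le_trans (cP _ lu)); rewrite scale0r subr0.
  by move: A0; rewrite mul0r /rpeval map_polyX (pevalX A).
have -> : u = 0 by exact: (hnorm_eq0 w_gt0).
have [_ [_ lp _ _]] := peval_bounded w_gt0 AM (map_poly (real_complex R) p).
by rewrite /rpeval (lin_oper0 w_gt0 lp) (hnorm0 w_gt0) mulr0.
Qed.

End spectral_bound.

Let rpevalB p q u : l2 w u -> rpeval (p - q) u = rpeval p u - rpeval q u.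
Proof. by move=> lu; rewrite /rpeval rmorphB/= (pevalB w_gt0 AM). Qed.

Let rpeval_lin p : lin_oper w (rpeval p).
Proof. by have [N []] := peval_bounded w_gt0 AM (map_poly (real_complex R) p). Qed.

Lemma segment_bound (p : {poly R}) (m : R) : 0 <= m ->
  (forall t, `|t| <= M -> `|p.[t]| <= m) ->
  forall u, l2 w u -> hnorm w (rpeval p u) <= m * hnorm w u.
Proof.
apply: (@spectral_bound [set t | `|t| <= M]) => t /= /negP; rewrite -ltNge.
exact: far_bounded_below.
Qed.

Let approx_diff (S : set R) (phi : R -> R) (p q : {poly R}) (e d : R) :
  (forall t, S t -> `|p.[t] - phi t| <= e) -> (forall t, S t -> `|q.[t] - phi t| <= d) ->
  forall t, S t -> `|(p - q).[t]| <= e + d.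
Proof.
move=> hp hq t St; rewrite hornerD hornerN.
rewrite (_ : _ - _ = (p.[t] - phi t) - (q.[t] - phi t)); last by ring.
by apply: (le_trans (ler_normB _ _)); rewrite lerD ?hp ?hq.
Qed.

Let small_inv (e : R) : 0 < e -> exists N, forall n, (N <= n)%N -> n.+1%:R^-1 <= e.
Proof.
move=> e0; exists (Num.truncn e^-1) => n Nn.
rewrite -[e]invrK lef_pV2 ?posrE ?invr_gt0//.
by rewrite ltW// (lt_le_trans (truncnS_gt _))// ler_nat.
Qed.

(** By [segment_bound], Weierstrass approximants of [phi] on [[- M, M]] yield a
    Cauchy sequence of operators. *)
Let calculus_exists (phi : R -> R) : continuous phi -> exists F : oper R T,
  (exists N, bounded_by w F N) /\ forall (p : {poly R}) (e : R), 0 <= e ->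
    (forall t, `|t| <= M -> `|p.[t] - phi t| <= e) ->
    forall u, l2 w u -> hnorm w (F u - rpeval p u) <= e * hnorm w u.
Proof.
move=> cphi; have M10 : 0 < M + 1 by case: AM => M0 _ _ _; rewrite ltr_wpDl.
have H (n : nat) : exists p : {poly R}, forall t, `|t| <= M -> `|p.[t] - phi t| <= n.+1%:R^-1.
  have n0 : 0 < n.+1%:R^-1 :> R by rewrite invr_gt0.
  have [p pP] := weierstrass M10 cphi n0.
  by exists p => t tM; apply: pP; rewrite (le_trans tM)// lerDl.
have [p_ pP] := choice H.
have cauchy (e : R) : 0 < e -> exists N, forall m n, (N <= m)%N -> (N <= n)%N ->
     forall u, l2 w u -> hnorm w (rpeval (p_ m) u - rpeval (p_ n) u) <= e * hnorm w u.
  move=> e0; have e20 : 0 < e / 2 by rewrite divr_gt0.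
  have [N HN] := small_inv e20.
  exists N => m n Nm Nn u lu; rewrite -rpevalB//; apply: segment_bound => //.
    exact: ltW.
  move=> t tM; apply: (@le_trans _ _ (e / 2 + e / 2)); last by rewrite -splitr.
  by apply: (@approx_diff [set t | `|t| <= M] phi) => // s sM; exact: le_trans (pP _ _ sM) (HN _ _).
have [F [FN FP]] := oper_complete w_gt0 (fun n => peval_bounded w_gt0 AM (map_poly (real_complex R) (p_ n))) cauchy.
exists F; split => // p e e0 pe u lu.
have lF : l2 w (F u) by have [N [_ _ + _]] := FN; exact.
apply/ler_addgt0Pr => d0' d0'0.
pose d := d0' / 2 / (hnorm w u + 1).
have d0 : 0 < d by rewrite !divr_gt0// ltr_wpDl.
have [N HN] := cauchy d d0; have [N' HN'] := small_inv d0.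
pose n := maxn N N'.
have h1 : hnorm w (F u - rpeval (p_ n) u) <= d * hnorm w u.
  by apply: (FP d N (ltW d0) HN) => //; exact: leq_maxl.
have h2 : hnorm w (rpeval (p_ n) u - rpeval p u) <= (d + e) * hnorm w u.
  rewrite -rpevalB//; apply: segment_bound => //; first by rewrite addr_ge0// ltW.
  apply: (@approx_diff [set t | `|t| <= M] phi) => // s sM; apply: le_trans (pP _ _ sM) _.
  by apply: HN'; exact: leq_maxr.
have h3 : d * hnorm w u <= d0' / 2.
  by rewrite /d mulrAC ler_pdivrMr ?ltr_wpDl// ler_wpM2l ?lerDl// ltW// divr_gt0.
rewrite -(subrKA (rpeval (p_ n) u)).
apply: (le_trans (hnormD w_gt0 _ _)); [by auto|by auto|].
by move: h1 h2; rewrite mulrDl; lra.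
Qed.

(** If [M < |t|], the calculus applied to [x |-> (x - t)^-1] inverts [A - t].
    Clipping [x] to [[- M, M]] makes this function continuous on the line
    without changing it where it matters. *)
Lemma spectrum_le (t : R) : spectrum w A t%:C -> `|t| <= M.
Proof.
move=> st; rewrite leNgt; apply/negP => Mt; apply: st.
pose clip (x : R) := Num.max (- M) (Num.min M x).
have M0 : 0 <= M by case: AM.
have clipM x : `|clip x| <= M.
  by rewrite ler_norml /clip le_max lexx/= ge_max ge_min lexx/= andbT; lra.
have clip_id x : `|x| <= M -> clip x = x.
  by rewrite ler_norml => /andP[x1 x2]; rewrite /clip min_r// max_r.
have ct x : clip x - t != 0.
  by rewrite subr_eq0; apply: contraTneq Mt => <-; rewrite -leNgt.
have cphi : continuous (fun x => (clip x - t)^-1).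
  move=> x; apply: cvgV; first exact: ct.
  apply: cvgB; last exact: cvg_cst.
  apply: (@continuous_max _ _ (fun=> - M) (fun x => Num.min M x)); first exact: cst_continuous.
  apply: (@continuous_min _ _ (fun=> M) id); first exact: cst_continuous.
  by move=> y; exact: cvg_id.
have [F [FN FP]] := calculus_exists cphi.
exists F; split; first by apply/bounded_byP.
move=> u lu; have lF v : l2 w v -> l2 w (F v) by have [N [_ _ + _]] := FN; exact.
have ltu v : l2 w v -> l2 w (t%:C *: v) by exact: l2Z.
pose K := M + `|t|; have K0 : 0 <= K by rewrite addr_ge0.
have E p v : l2 w v -> rpeval (p * ('X - t%:P)) v = rpeval p (A v - t%:C *: v).
  move=> lv; rewrite /rpeval rmorphM rmorphB/= map_polyX map_polyC/= (pevalM w_gt0 AM)//.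
  by rewrite (pevalB w_gt0 AM)// (pevalX A) (pevalC A).
have E' p v : l2 w v -> rpeval (p * ('X - t%:P)) v = A (rpeval p v) - t%:C *: rpeval p v.
  move=> lv; rewrite mulrC /rpeval rmorphM rmorphB/= map_polyX map_polyC/= (pevalM w_gt0 AM)//.
  by rewrite (pevalB w_gt0 AM)// ?(pevalX A) ?(pevalC A)//; auto.
have near_id (p : {poly R}) e : 0 <= e -> (forall x, `|x| <= M -> `|p.[x] - (clip x - t)^-1| <= e) ->
    hnorm w (rpeval (p * ('X - t%:P)) u - u) <= e * K * hnorm w u.
  move=> e0 pe; have {2}-> : u = rpeval 1%:P u by rewrite /rpeval map_polyC/= (pevalC A) scale1r.
  rewrite -rpevalB//; apply: segment_bound => //; first by rewrite mulr_ge0.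
  move=> x xM; rewrite !hornerE -(mulVf (ct x)) clip_id// -mulrBl normrM.
  apply: ler_pM => //; first by have := pe x xM; rewrite clip_id.
  by apply: (le_trans (ler_normB _ _)); rewrite lerD2r.
have [pol polP] : {pol : R -> {poly R} & forall e, 0 < e -> forall x, `|x| <= M ->
    `|(pol e).[x] - (clip x - t)^-1| <= e}.
  apply: (@choice _ _ (fun (e : R) (p : {poly R}) => 0 < e -> forall x, `|x| <= M ->
    `|p.[x] - (clip x - t)^-1| <= e)) => e.
  have [e0|ne0] := pselect (0 < e); last by exists 0 => /ne0.
  have M10 : 0 < M + 1 by rewrite ltr_wpDl.
  have [p pP] := weierstrass M10 cphi e0.
  by exists p => _ x xM; apply: pP; rewrite (le_trans xM)// lerDl.
have lAt : l2 w (A u - t%:C *: u) by auto.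
split.
  apply/eqP; rewrite -subr_eq0; apply/eqP.
  apply: (@hnorm_small _ _ _ w_gt0 _ (hnorm w (A u - t%:C *: u) + K * hnorm w u)).
    by apply: l2B; auto.
  move=> e e0; rewrite -(subrKA (rpeval (pol e) (A u - t%:C *: u))).
  apply: (le_trans (hnormD w_gt0 _ _)); [by auto|by auto|].
  rewrite mulrDr; apply: lerD; first by apply: FP; [exact: ltW|exact: polP|].
  by rewrite -E// mulrA; apply: near_id; [exact: ltW|exact: polP].
apply/eqP; rewrite -subr_eq0; apply/eqP.
have lFt : l2 w (A (F u) - t%:C *: F u) by auto.
apply: (@hnorm_small _ _ _ w_gt0 _ (K * hnorm w u + K * hnorm w u)).
  by apply: l2B.
move=> e e0; set q := rpeval (pol e) u; pose d := F u - q.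
have lq : l2 w q by exact: rp2.
have ld : l2 w d by apply: l2B; auto.
rewrite (_ : _ - u = (A d - t%:C *: d) + (A q - t%:C *: q - u)); last first.
  rewrite /d (lin_operB linA (lF _ lu) lq).
  by apply/funext => x; rewrite !fctE/= /GRing.scale/=; ring.
apply: (le_trans (hnormD w_gt0 _ _)); [by auto|by apply: l2B; auto|].
rewrite mulrDr; apply: lerD; last first.
  by rewrite -E'// mulrA; apply: near_id; [exact: ltW|exact: polP].
have dle : hnorm w d <= e * hnorm w u by apply: FP; [exact: ltW|exact: polP|].
apply: (le_trans (hnormB w_gt0 _ _)); [by auto|by auto|].
rewrite (hnormZ w_gt0)// (_ : normc t%:C = `|t|); last first.
  by rewrite /= expr0n addr0 sqrtr_sqr.
have [_ _ _ HM] := AM; apply: (le_trans (lerD (HM _ ld) (lexx _))).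
by rewrite -mulrDl -/K mulrCA ler_wpM2l.
Qed.

(** The polynomials that define [funcalc] are only controlled on the spectrum.
    As [A - t] is bounded below for every real [t] off the spectrum,
    [spectral_bound] nevertheless compares them with approximants on
    [[- M, M]]. *)
Theorem funcalc_approx (phi : R -> R) : continuous phi ->
  (forall u, l2 w u -> l2 w (funcalc w phi A u)) /\
  forall (p : {poly R}) (e : R), 0 <= e ->
    (forall t, `|t| <= M -> `|p.[t] - phi t| <= e) ->
    forall u, l2 w u -> hnorm w (funcalc w phi A u - rpeval p u) <= e * hnorm w u.
Proof.
move=> cphi.
have M10 : 0 < M + 1 by case: AM => M0 _ _ _; rewrite ltr_wpDl.
have [F0 [F0N F0P]] := calculus_exists cphi.
have calcF : is_funcalc w phi A F0.
  split; first exact/bounded_byP.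
  have H (n : nat) : exists p : {poly R}, forall t, `|t| <= M -> `|p.[t] - phi t| <= n.+1%:R^-1.
    have n0 : 0 < n.+1%:R^-1 :> R by rewrite invr_gt0.
    have [p pP] := weierstrass M10 cphi n0.
    by exists p => t tM; apply: pP; rewrite (le_trans tM)// lerDl.
  have [p pP] := choice H; exists p; split.
    move=> e e0; have [N HN] := small_inv e0; exists N => // n /= Nn t /spectrum_le tM.
    exact: le_trans (pP _ _ tM) (HN _ Nn).
  have [N [N0 F0lin F02 _]] := F0N.
  apply/(norm_cvgP w_gt0) => [n||e e0].
  - by rewrite (_ : poly_oper (p n) A = rpeval (p n))//; apply/funext => u; exact: poly_operE.
  - exact: F0lin.
  have [N' HN] := small_inv e0; exists N' => // n /= Nn u lu; rewrite poly_operE.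
  have lF0 := F02 _ lu; split; first by auto.
  rewrite -(hnormN w_gt0) ?opprB; last by auto.
  apply: (le_trans (F0P _ _ _ (pP n) _ lu)); first by rewrite invr_ge0.
  by rewrite ler_wpM2r// HN.
have := @xgetPex _ (fun _ _ => 0) [set F : oper R T | is_funcalc w phi A F] (ex_intro _ _ calcF).
rewrite -/(funcalc w phi A) => -[bF [p' [p'phi p'cv]]].
have [N [N0 linF F2 FN]] := (bounded_byP w_gt0 _).2 bF.
split => // p e e0 pe u lu.
have lFu := F2 _ lu.
apply/ler_addgt0Pr => d0' d0'0.
pose d := d0' / 2 / (hnorm w u + 1).
have d0 : 0 < d by rewrite !divr_gt0// ltr_wpDl.
have h3 : d * hnorm w u <= d0' / 2.
  by rewrite /d mulrAC ler_pdivrMr ?ltr_wpDl// ler_wpM2l ?lerDl// ltW// divr_gt0.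
have cvE : (fun n => poly_oper (p' n) A) = fun n => rpeval (p' n).
  by apply/funext => n; apply/funext => v; exact: poly_operE.
rewrite cvE in p'cv.
have ncv := (norm_cvgP w_gt0 (fun n => rpeval_lin (p' n)) linF).1 p'cv d d0.
have [n [nP npP]] := filter_ex (filterI ncv (p'phi d d0)).
have h1 : hnorm w (funcalc w phi A u - rpeval (p' n) u) <= d * hnorm w u.
  rewrite -(hnormN w_gt0) ?opprB; last by auto.
  by case: (nP u lu).
have h2 : hnorm w (rpeval (p' n) u - rpeval p u) <= (d + e) * hnorm w u.
  rewrite -rpevalB//; apply: (@spectral_bound [set t | spectrum w A t%:C]) => //.
  - move=> t /= /contrapT [B [/bounded_byP[//|NB [NB0 linB B2 BN]] BP]].
    exists (NB + 1)^-1; first by rewrite invr_gt0 ltr_wpDl.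
    move=> v lv; have [Bv _] := BP v lv.
    rewrite mulrC ler_pdivrMr ?ltr_wpDl// mulrC -[in leLHS]Bv.
    have lAv : l2 w (A v - t%:C *: v) by apply: l2B; auto.
    by apply: (le_trans (BN _ lAv)); rewrite ler_wpM2r// lerDl.
  - by rewrite addr_ge0// ltW.
  - apply: (@approx_diff [set t | spectrum w A t%:C] phi) => t St; first exact: npP.
    by apply: pe; exact: spectrum_le.
rewrite -(subrKA (rpeval (p' n) u)).
apply: (le_trans (hnormD w_gt0 _ _)); [by auto|by auto|].
by move: h1 h2; rewrite mulrDl; lra.
Qed.

End spectral_calculus.

(** * Point masses *)

Section point_masses.
Local Open Scope complex_scope.
Context {R : realType} {T : choiceType}.
Variable w : T -> R.
Hypothesis w_gt0 : forall x, 0 < w x.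
Implicit Types (u v : T -> R[i]) (x y : T).

Let l2Z := l2Z w_gt0.
Let l2D := l2D w_gt0.
Let l2B := l2B w_gt0.
Let hnorm_ge0 := @hnorm_ge0 R T w.
Let normc_ge0 := @normc_ge0 R.
#[local] Hint Resolve l2Z l2D l2B hnorm_ge0 normc_ge0 : core.

Definition point_mass x : T -> R[i] := fun y => (y == x)%:R.

Let csum_single (f : T -> R[i]) x : (forall y, y != x -> f y = 0) -> csum f = f x.
Proof.
move=> f0; rewrite /csum !(@rsum_single _ _ _ x); first by case: (f x).
all: by move=> y /f0 ->.
Qed.

Lemma inner_point_mass x u : inner w (point_mass x) u = u x * (w x)%:C.
Proof.
rewrite /inner (@csum_single _ x) => [|y yx]; rewrite /point_mass.
  rewrite eqxx [X in X * _ * _](_ : _ = 1) ?mul1r//.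
  by apply/eqP; rewrite eq_complex/= oppr0 !eqxx.
rewrite (negbTE yx) [X in X * _ * _](_ : _ = 0) ?mul0r//.
by apply/eqP; rewrite eq_complex/= oppr0 !eqxx.
Qed.

Lemma l2_point_mass x : l2 w (point_mass x).
Proof.
have w0 : 0 <= Num.sqrt (w x) by exact: sqrtr_ge0.
have [] := @l2_esum_le _ _ _ w_gt0 (point_mass x) _ w0 => // X.
rewrite sqr_sqrtr ?(ltW (w_gt0 x))//.
have [xX|xX] := boolP (x \in X).
  rewrite (big_fsetD1 x)//= /point_mass eqxx normc1 expr1n mul1r big_seq big1 ?addr0// => y.
  by rewrite !inE => /andP[/negbTE -> _]; rewrite normc0 expr0n mul0r.
rewrite big_seq big1 ?ltW// => y yX; rewrite /point_mass.
case: eqP => [yx|_]; first by rewrite yx (negbTE xX) in yX.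
by rewrite normc0 expr0n mul0r.
Qed.

Lemma hnorm_point_mass x : hnorm w (point_mass x) ^+ 2 = w x.
Proof.
have := inner_self w_gt0 (l2_point_mass x).
by rewrite inner_point_mass /point_mass eqxx mul1r => -[].
Qed.

(** [u] is cut off outside a finite set that carries all of its squared norm but
    [e ^ 2]. *)
Lemma point_mass_dense u (e : R) : l2 w u -> 0 < e ->
  exists X : {fset T}, hnorm w (u - \sum_(x <- X) u x *: point_mass x) <= e.
Proof.
move=> lu e0.
have [X HX] : exists X : {fset T}, hnorm w u ^+ 2 - e ^+ 2 <= \sum_(x <- X) normc (u x) ^+ 2 * w x.
  have [he|he] := ltP (hnorm w u ^+ 2) (e ^+ 2).
    by exists fset0; rewrite big_seq_fset0; lra.
  apply: contrapT => H.
  have : hnorm w u <= Num.sqrt (hnorm w u ^+ 2 - e ^+ 2).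
    have [] := @l2_esum_le _ _ _ w_gt0 u (Num.sqrt (hnorm w u ^+ 2 - e ^+ 2)) => //.
    move=> X; rewrite sqr_sqrtr ?subr_ge0//; apply: contrapT => /negP; rewrite -ltNge => h.
    by apply: H; exists X; exact: ltW.
  set s := Num.sqrt _ => hs.
  have sE : s ^+ 2 = hnorm w u ^+ 2 - e ^+ 2 by rewrite sqr_sqrtr ?subr_ge0.
  have : hnorm w u ^+ 2 <= s ^+ 2 by rewrite ler_pXn2r ?nnegrE ?sqrtr_ge0.
  by rewrite sE; have := exprn_gt0 2 e0; lra.
exists X; set f := \sum_(x <- X) _.
have fE y : f y = if y \in X then u y else 0.
  have zE z : (u z *: point_mass z) y = u z * (y == z)%:R by [].
  rewrite /f fct_sumE; under eq_bigr do rewrite zE.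
  have [yX|yX] := boolP (y \in X).
    rewrite (big_fsetD1 y)//= eqxx mulr1 big_seq big1 ?addr0// => z.
    by rewrite !inE => /andP[zy _]; rewrite eq_sym (negbTE zy) mulr0.
  rewrite big_seq big1// => z zX.
  by case: eqP => [yz|_]; rewrite ?mulr0//; rewrite yz zX in yX.
have [] := @l2_esum_le _ _ _ w_gt0 (u - f) e (ltW e0) => // Y.
have /= := esum_le_l2 w_gt0 (X `|` Y)%fset lu.
rewrite (big_fsetID _ (mem X))/= => H.
have E1 : [fset x in (X `|` Y)%fset | x \in X]%fset = X.
  by apply/fsetP => z; rewrite !inE; case: (z \in X); rewrite ?andbF.
rewrite E1 in H.
have E2 : \sum_(x <- Y) normc ((u - f) x) ^+ 2 * w x <=
    \sum_(x <- [fset x in (X `|` Y)%fset | x \notin X]%fset) normc (u x) ^+ 2 * w x.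
  rewrite (big_fsetID _ (mem X))/= big_seq big1 ?add0r; last first.
    move=> z; rewrite !inE/= => /andP[_ zX].
    by rewrite !fctE/= fE zX subrr normc0 expr0n mul0r.
  rewrite (_ : [fset x in (X `|` Y)%fset | x \notin X]%fset = [fset x in Y | x \notin X]%fset); last first.
    by apply/fsetP => z; rewrite !inE; case: (z \in X) => //=; rewrite !andbF.
  rewrite le_eqVlt; apply/orP; left; apply/eqP; rewrite big_seq [RHS]big_seq.
  apply: eq_bigr => z; rewrite !inE/= => /andP[_ zX].
  by rewrite !fctE/= fE (negbTE zX) subr0.
by apply: (le_trans E2); lra.
Qed.

Lemma functional_eq0 (F : (T -> R[i]) -> R[i]) (C : R) :
  (forall c u v, l2 w u -> l2 w v -> F (c *: u + v) = c * F u + F v) ->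
  (forall u, l2 w u -> normc (F u) <= C * hnorm w u) ->
  (forall x, F (point_mass x) = 0) -> forall u, l2 w u -> F u = 0.
Proof.
move=> Flin FC F0 u lu.
have C0 : 0 <= `|C| by [].
have F00 : F 0 = 0.
  have := Flin 1 0 0 (l2_0 w_gt0) (l2_0 w_gt0).
  by rewrite scale1r addr0 mul1r => /esym/eqP; rewrite -subr_eq0 addrK => /eqP.
have Fsum (X : seq T) : F (\sum_(x <- X) u x *: point_mass x) = 0 /\ l2 w (\sum_(x <- X) u x *: point_mass x).
  elim: X => [|x X [IH l]]; first by rewrite big_nil; split => //; exact: l2_0.
  have lx := l2_point_mass x.
  rewrite big_cons; split; first by rewrite Flin// IH F0 mulr0 addr0.
  by apply: l2D => //; exact: l2Z.
apply/eq0_normc/eqP; rewrite eq_le normc_ge0 andbT; apply/ler_addgt0Pr => e e0; rewrite add0r.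
have d0 : 0 < e / (`|C| + 1) by rewrite divr_gt0// ltr_wpDl.
have [X HX] := point_mass_dense lu d0.
have [FX lX] := Fsum X.
have -> : F u = F (u - \sum_(x <- X) u x *: point_mass x).
  by rewrite addrC -scaleN1r Flin// FX mulr0 add0r.
apply: (le_trans (FC _ (l2B lu lX))).
apply: (@le_trans _ _ (`|C| * (e / (`|C| + 1)))).
  apply: (@le_trans _ _ (`|C| * hnorm w (u - \sum_(x <- X) u x *: point_mass x))).
    by rewrite ler_wpM2r// ler_norm.
  by rewrite ler_wpM2l.
by rewrite mulrCA ler_piMr ?(ltW e0)// ler_pdivrMr ?ltr_wpDl// mul1r lerDl.
Qed.

(** Density of the point masses is used twice: in the second argument, and then,
    by conjugate symmetry, in the first. *)
Lemma selfadj_point_masses (A : oper R T) (M : R) : bounded_by w A M ->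
  (forall x y, inner w (A (point_mass x)) (point_mass y) =
               inner w (point_mass x) (A (point_mass y))) ->
  forall u v, l2 w u -> l2 w v -> inner w (A u) v = inner w u (A v).
Proof.
move=> [M0 linA A2 AM] H.
have innerBr u v v' : l2 w u -> l2 w v -> l2 w v' -> inner w u (v - v') = inner w u v - inner w u v'.
  move=> lu lv lv'; rewrite -scaleN1r (innerDr w_gt0)//; last exact: l2Z.
  by rewrite (innerZr w_gt0)// mulN1r.
have key a b : l2 w a -> l2 w b ->
    (forall x, inner w (A a) (point_mass x) = inner w a (A (point_mass x))) ->
    inner w (A a) b = inner w a (A b).
  move=> la lb Hx; apply/eqP; rewrite -subr_eq0; apply/eqP.
  apply: (@functional_eq0 (fun v => inner w (A a) v - inner w a (A v)) (2 * M * hnorm w a)) => //.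
  - move=> c u v lu lv; have lAa := A2 _ la; have lAu := A2 _ lu; have lAv := A2 _ lv.
    have lcu := l2Z c lu; have lcAu := l2Z c lAu.
    rewrite linA// !(innerDr w_gt0)// !(innerZr w_gt0)//; ring.
  - move=> u lu; have lAa := A2 _ la; have lAu := A2 _ lu.
    apply: (le_trans (normcD _ _)); rewrite normcN.
    apply: (le_trans (lerD (cauchy_schwarz w_gt0 lAa lu) (cauchy_schwarz w_gt0 la lAu))).
    have h1 := AM _ la; have h2 := AM _ lu.
    have h3 : hnorm w (A a) * hnorm w u <= M * hnorm w a * hnorm w u by rewrite ler_wpM2r.
    have h4 : hnorm w a * hnorm w (A u) <= hnorm w a * (M * hnorm w u) by rewrite ler_wpM2l.
    by lra.
  - by move=> x; rewrite Hx subrr.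
move=> u v lu lv; apply: (key) => // x.
have lx := l2_point_mass x; have lAx := A2 _ lx; have lAu := A2 _ lu.
rewrite (innerC w_gt0 lx lAu) (innerC w_gt0 lAx lu); congr (_^*).
by symmetry; apply: (key) => // y; rewrite H.
Qed.

End point_masses.

(** * The Chabauty-Fell topology and the space of Delone sets *)

Section fell_topology.
Context {Z : topologicalType}.
Implicit Types (Y : closedset Z) (C O : set Z).

Lemma fell_basic_open (p : set Z * {fset (set Z)}) : fell_dom p ->
  open (fell_basic p).
Proof. by move=> dp; exists [set p] => [q -> //|]; rewrite bigcup_set1. Qed.

Lemma fell_miss_open C : compact C -> open [set Y | C `&` pts Y = set0].
Proof.
move=> cC; rewrite (_ : [set Y | _] = fell_basic (C, fset0)).
  by apply: fell_basic_open; split.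
by apply/seteqP; split=> Y /= [].
Qed.

Lemma fell_hit_open O : open O -> open [set Y | O `&` pts Y !=set0].
Proof.
move=> oO; rewrite (_ : [set Y | _] = fell_basic (set0, [fset O]%fset)).
  apply: fell_basic_open; split; first exact: compact0.
  by move=> ? /fset1P ->.
apply/seteqP; split=> Y /=.
  by move=> h; split=> /=; [rewrite set0I|move=> ? /fset1P ->].
by move=> [_]; apply; exact/fset1P.
Qed.

Lemma fell_nbhs Y (A : set (closedset Z)) : nbhs Y A ->
  exists p, [/\ fell_dom p, fell_basic p Y & fell_basic p `<=` A].
Proof.
rewrite nbhsE => -[B [[I sI <-] [p Ip Yp]] BA].
by exists p; split=> //; [exact: sI|move=> X Xp; apply: BA; exists p].
Qed.

Lemma fell_cvgP {T : Type} (F : set_system T) {FF : Filter F}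
    (f : T -> closedset Z) Y :
  (forall C, compact C -> C `&` pts Y = set0 ->
     \forall t \near F, C `&` pts (f t) = set0) ->
  (forall O, open O -> O `&` pts Y !=set0 ->
     \forall t \near F, O `&` pts (f t) !=set0) ->
  f @ F --> Y.
Proof.
move=> miss hit A /fell_nbhs[[C Os] [[/= cC oOs] [/= CY OsY] sA]].
have hits : \forall t \near F, forall O, O \in Os -> O `&` pts (f t) !=set0.
  apply: filterS (@filter_bigI _ _ Os (fun O => [set t | O `&` pts (f t) !=set0])
    F _ _); last by move=> O OO; apply: hit; [exact: oOs|exact: OsY].
  by move=> t /= h O OO; exact: (h O).
rewrite !nbhs_simpl /=; apply: filterS2 hits (miss _ cC CY) => t h m.
exact: sA.
Qed.

Lemma fell_cvg_miss {T : Type} (F : set_system T) {FF : Filter F}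
    (f : T -> closedset Z) Y C : f @ F --> Y -> compact C -> C `&` pts Y = set0 ->
  \forall t \near F, C `&` pts (f t) = set0.
Proof.
move=> fY cC CY; have : nbhs Y [set Y | C `&` pts Y = set0].
  by apply: open_nbhs_nbhs; split=> //; exact: fell_miss_open.
by move/fY.
Qed.

Lemma fell_cvg_hit {T : Type} (F : set_system T) {FF : Filter F}
    (f : T -> closedset Z) Y O : f @ F --> Y -> open O -> O `&` pts Y !=set0 ->
  \forall t \near F, O `&` pts (f t) !=set0.
Proof.
move=> fY oO OY; have : nbhs Y [set Y | O `&` pts Y !=set0].
  by apply: open_nbhs_nbhs; split=> //; exact: fell_hit_open.
by move/fY.
Qed.

Lemma closedset_inj : injective (@pts Z).
Proof.
move=> [A cA] [B cB] /= AB; case: B / AB cB => cB.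
by congr ClosedSet; exact: Prop_irrelevance.
Qed.

(** The limit consists of the points all of whose neighbourhoods are hit by the
    sets along the ultrafilter. A compact set missing the limit is covered by
    finitely many open sets that are missed along the ultrafilter. *)
Lemma fell_ultra_cvg {T : Type} (F : set_system T) {FU : UltraFilter F}
    (f : T -> closedset Z) :
  exists Y, f @ F --> Y.
Proof.
pose Y0 := [set z | forall O, open O -> O z -> F [set t | O `&` pts (f t) !=set0]].
have cY0 : closed Y0.
  move=> z clz O oO Oz.
  have [|y [Yy Oy]] := clz O; first exact: open_nbhs_nbhs.
  exact: Yy.
exists (ClosedSet cY0); apply: fell_cvgP => [C cC CY|O oO [z [Oz Yz]]]; last first.
  exact: Yz.
have cover : forall z, C z -> exists O, [/\ open O, O z &
    F [set t | O `&` pts (f t) = set0]].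
  move=> z Cz; have /existsNP[ O /not_implyP[oO /not_implyP[Oz nF]]] : ~ Y0 z.
    by move=> Yz; rewrite -[False]/((set0 : set Z) z) -CY.
  exists O; split=> //; have [//|] := in_ultra_setVsetC
    [set t | O `&` pts (f t) = set0] FU.
  move=> FC; exfalso; apply: nF; apply: filterS FC => t /= /eqP.
  by rewrite set0P.
have := cC; rewrite compact_near_coveringP => /(_ T F (fun t z => ~ pts (f t) z)).
have -> : (\forall t \near F, C `<=` (fun z => ~ pts (f t) z)) =
  (\forall t \near F, C `&` pts (f t) = set0).
  by congr (F _); apply/seteqP; split=> t /=; rewrite -disjoints_subset.
apply=> z /cover[ O [oO Oz FO]].
exists (O, [set t | O `&` pts (f t) = set0]) => /=.
  by split=> //; exact: open_nbhs_nbhs.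
move=> [y t] /= [Oy Ot] fy; rewrite -[False]/((set0 : set Z) y) -Ot.
by split.
Qed.

(** A point of [Y1] outside [Y2] has a compact neighbourhood [C] missing [Y2]:
    hitting the interior of [C] and missing [C] are disjoint open conditions. *)
Lemma fell_hausdorff : locally_compact [set: Z] -> hausdorff_space Z ->
  hausdorff_space (closedset Z).
Proof.
move=> lcZ hZ.
have sep : forall Y1 Y2 z, pts Y1 z -> ~ pts Y2 z -> exists A B : set (closedset Z),
    [/\ open A, open B, A Y1, B Y2 & A `&` B = set0].
  move=> Y1 Y2 z Y1z Y2z.
  have [V zV [cV clV]] := lcZ z I.
  have nV : nbhs z V.
    have := zV; rewrite withinET //.
  have nY : nbhs z (~` pts Y2).
    by apply: open_nbhs_nbhs; split=> //; apply/closed_openC/closed_pts.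
  have [W zW cW] := compact_regular hZ cV nV nY.
  pose C := V `&` closure W.
  have cC : compact C by apply: compact_closedI => //; exact: closed_closure.
  have CY2 : C `&` pts Y2 = set0.
    by apply/seteqP; split=> // y [[_ /cW]].
  have nC : nbhs z C.
    by apply: filterI => //; apply: filterS zW; exact: subset_closure.
  exists [set Y | (interior C) `&` pts Y !=set0], [set Y | C `&` pts Y = set0].
  split; [| |by exists z|by []|].
  - by apply: fell_hit_open; exact: open_interior.
  - exact: fell_miss_open.
  - apply/seteqP; split=> // Y /= [[y [Cy Yy]] CY].
    rewrite -[False]/((set0 : set Z) y) -CY; split=> //.
    exact: interior_subset.
rewrite open_hausdorff => Y1 Y2 /eqP Y12.
have [z [[Y1z Y2z]|[Y2z Y1z]]] : exists z, pts Y1 z /\ ~ pts Y2 z \/ pts Y2 z /\ ~ pts Y1 z.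
  apply: contrapT => h; apply: Y12; apply: closedset_inj; apply/seteqP.
  split=> z Yz; apply: contrapT => Yz'; apply: h; exists z; [left|right]; split=> //.
- have [A [B [oA oB A1 B2 AB]]] := sep _ _ _ Y1z Y2z.
  by exists (A, B); [by split; exact/mem_set|split=> //; apply/eqP].
- have [A [B [oA oB A1 B2 AB]]] := sep _ _ _ Y2z Y1z.
  by exists (B, A); [by split; exact/mem_set|split=> //; rewrite setIC; apply/eqP].
Qed.

End fell_topology.

Section subtype_topology.
Context {X : topologicalType} (A : set X).

Lemma val_continuous : continuous (\val : A -> X).
Proof. exact: (@initial_continuous A X set_val). Qed.

Lemma cvg_val (F : set_system A) {FF : Filter F} (x : A) :
  (\val @ F) --> \val x -> F --> x.
Proof.
move=> Fx B [_ [[C oC <-] /= Cx] sB].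
have /Fx : nbhs (\val x) C by apply: open_nbhs_nbhs.
by rewrite nbhs_simpl /=; apply: filterS.
Qed.

Lemma subtype_hausdorff : hausdorff_space X -> hausdorff_space A.
Proof.
move=> hX x y cl; apply: val_inj; apply: hX => B C Bx Cy.
have [z [Bz Cz]] := cl _ _ (val_continuous Bx) (val_continuous Cy).
by exists (\val z).
Qed.

Lemma subtype_compact : compact A -> compact [set: A].
Proof.
move=> cA F FF _.
have FA : (\val @ F) A.
  by rewrite /= nbhs_simpl /=; apply: filterE => z; exact: set_valP.
have [x [Ax Fx]] := cA _ _ FA.
exists (exist _ x (mem_set Ax)); split=> // B C FB [_ [[V oV <-] /= Vx] sC].
have [||_ [[b Bb <-] Vb]] := Fx (\val @` B) V.
- by rewrite nbhs_simpl /=; apply: filterS FB => b Bb; exists b.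
- exact: open_nbhs_nbhs.
- by exists b; split=> //; exact: sC.
Qed.
End subtype_topology.

Section product_topology.
Context {X Y : topologicalType}.

Lemma prod_hausdorff : hausdorff_space X -> hausdorff_space Y ->
  hausdorff_space (X * Y)%type.
Proof.
move=> hX hY [x y] [x' y'] cl; congr (_, _).
- apply: hX => B C Bx Cx'.
  have [||z [Bz Cz]] := cl (fst @^-1` B) (fst @^-1` C).
  + exact: (@cvg_fst _ _ (nbhs x) (nbhs y)).
  + exact: (@cvg_fst _ _ (nbhs x') (nbhs y')).
  by exists z.1.
- apply: hY => B C Bx Cx'.
  have [||z [Bz Cz]] := cl (snd @^-1` B) (snd @^-1` C).
  + exact: (@cvg_snd _ _ (nbhs x) (nbhs y)).
  + exact: (@cvg_snd _ _ (nbhs x') (nbhs y')).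
  by exists z.2.
Qed.

Lemma prod_locally_compact : locally_compact [set: X] ->
  locally_compact [set: Y] -> locally_compact [set: (X * Y)%type].
Proof.
move=> lX lY [x y] _.
have [V xV [cV clV]] := lX x I.
have [W yW [cW clW]] := lY y I.
exists (V `*` W); last first.
  split; first exact: compact_setX.
  rewrite (_ : V `*` W = fst @^-1` V `&` snd @^-1` W); last by [].
  by apply: closedI; apply: preimage_closed => // z _; [exact: cvg_fst|exact: cvg_snd].
move: xV yW; rewrite !withinET => xV yW.
by exists (V, W).
Qed.
End product_topology.

Section delone_topology.
Context {G H : topGroupType}.
Hypotheses (lcG : lcsc_hausdorff G) (lcH : lcsc_hausdorff H).
Local Notation Z := (G * H)%type.
Local Notation lshift := Defs.lshift.

Lemma Z_hausdorff : hausdorff_space Z.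
Proof. by case: lcG lcH => [_ _ hG] [_ _ hH]; exact: prod_hausdorff. Qed.

Lemma Z_locally_compact : locally_compact [set: Z].
Proof. by case: lcG lcH => [hG _ _] [hH _ _]; exact: prod_locally_compact. Qed.

Lemma lshift_open (p : Z) (O : set Z) : open O -> open (lshift p O).
Proof.
by rewrite lshiftE => oO; move/continuousP: (@lmul_continuous G H (p^-1)%g); apply.
Qed.

Lemma lshift_compact (p : Z) (C : set Z) : compact C -> compact (lshift p C).
Proof.
move=> cC; apply: continuous_compact => //.
exact/continuous_subspaceT/lmul_continuous.
Qed.

Lemma inv_continuous : continuous (fun x : Z => (x^-1)%g).
Proof.
move=> x.
apply: (@cvg_pair _ _ _ (nbhs x) (nbhs (x.1^-1)%g) (nbhs (x.2^-1)%g)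
  _ _ _ (fun y : Z => y.1^-1)%g (fun y : Z => y.2^-1)%g).
- apply: (cvg_comp (fun y : Z => y.1) (fun g : G => g^-1)%g _ (@invg_continuous G x.1)).
  exact: cvg_fst.
- apply: (cvg_comp (fun y : Z => y.2) (fun g : H => g^-1)%g _ (@invg_continuous H x.2)).
  exact: cvg_snd.
Qed.

Variables (U K : set Z).
Hypotheses (openU : open U) (U1 : U 1%g) (compactK : compact K).

(** Both conditions pass to limits: if [Y] missed the compact set [x K^-1], so
    would the Delone sets nearby, and two points of [Y] in a translate of the
    open set [U] would be approximated by two such points of a Delone set. *)
Lemma delone_ultra_limit {T : Type} (F : set_system T) {FU : UltraFilter F}
    (f : T -> closedset Z) Y : (forall t, delone U K (pts (f t))) ->
  f @ F --> Y -> delone U K (pts Y).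
Proof.
move=> df fY.
have YK : [set (d * k)%g | d in pts Y & k in K] = [set: Z].
  rewrite -subTset => x _.
  pose C := [set (x * k^-1)%g | k in K].
  have cC : compact C.
    apply: continuous_compact => //; apply: continuous_subspaceT => k.
    apply: (@continuous_comp Z Z Z (fun k : Z => (k^-1)%g) (fun z : Z => (x * z)%g)).
      exact: inv_continuous.
    exact: lmul_continuous.
  have [/(fell_cvg_miss fY cC)/filter_ex[t CF]|] := pselect (C `&` pts Y = set0).
    have [_ _ /seteqP[_ /(_ x I)[d fd [k Kk dk]]]] := df t.
    exfalso; rewrite -[False]/((set0 : set Z) d) -CF; split=> //.
    by exists k => //; rewrite -dk mulgK.
  move/eqP/set0P => [_ [[k Kk <-] Yk]].
  by exists (x * k^-1)%g => //; exists k => //; rewrite mulgVK.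
split=> //.
  have : [set: Z] 1%g by [].
  by rewrite -YK => -[d Yd _]; exists d.
move=> x y z [xUy Yy] [xUz Yz]; apply: contrapT => /eqP yz.
have := Z_hausdorff; rewrite open_hausdorff => /(_ _ _ yz).
move=> [[A B] [/= /set_mem Ay /set_mem Bz] [oA oB /eqP AB]].
have oxU := lshift_open (p := x) openU.
have [|t [[a [[Aa Ua] fa]] [b [[Bb Ub] fb]]]] := @filter_ex _ F _
    [set t | (A `&` lshift x U) `&` pts (f t) !=set0 /\ (B `&` lshift x U) `&` pts (f t) !=set0].
  apply: filterI; apply: (fell_cvg_hit fY); first exact: openI.
  - by exists y.
  - exact: openI.
  - by exists z.
have [_ /(_ x a b)] := df t.
move=> /(_ (conj Ua fa) (conj Ub fb)) ab _.
by rewrite -[False]/((set0 : set Z) a) -AB; split; rewrite // ab.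
Qed.

Lemma Del_compact : compact [set: Del U K].
Proof.
rewrite compact_ultra => F FU _.
have [Y FY] := @fell_ultra_cvg Z _ F FU (\val).
have dY : delone U K (pts Y).
  by apply: delone_ultra_limit FY => t; exact: (set_valP t).
by exists (exist _ Y (mem_set dY)); split=> //; exact: cvg_val.
Qed.

Lemma Del_hausdorff : hausdorff_space (Del U K).
Proof.
exact/subtype_hausdorff/fell_hausdorff/Z_hausdorff/Z_locally_compact.
Qed.

Lemma Del_act_continuous p : continuous (@Del_act G H U K p).
Proof.
move=> D.
have FD : Filter (Del_act p @ nbhs D) := fmap_filter _ (nbhs_filter D).
apply: (@cvg_val _ _ _ FD).
apply: (@fell_cvgP _ _ (nbhs D) _ (fun D' => \val (Del_act p D'))) => [C cC CD|O oO [z [Oz Dz]]].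
- have cC' := lshift_compact (p := (p^-1)%g) cC.
  have CD' : lshift (p^-1)%g C `&` pts (\val D) = set0.
    apply/seteqP; split=> // z [[c Cc <-] Dz].
    exfalso; rewrite -[False]/((set0 : set Z) c) -CD; split=> //=.
    by exists (p^-1 * c)%g => //; rewrite mulVKg.
  apply: filterS (fell_cvg_miss (@val_continuous _ _ D) cC' CD') => D' CD''.
  apply/seteqP; split=> // y [/= Cz [z Dz zz]].
  exfalso; rewrite -[False]/((set0 : set Z) z) -CD''; split=> //.
  by exists y; rewrite // -zz mulKg.
- have oO' := lshift_open (p := (p^-1)%g) oO.
  have OD' : lshift (p^-1)%g O `&` pts (\val D) !=set0.
    case: Dz Oz => y Dy <- Oy; exists y; split=> //.
    by exists (p * y)%g => //; rewrite mulKg.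
  apply: filterS (fell_cvg_hit (@val_continuous _ _ D) oO' OD') => D'.
  move=> [y [[x Ox <-] Dy]]; exists x; split=> //=.
  by exists (p^-1 * x)%g => //; rewrite mulVKg.
Qed.

Lemma hull_compact (Om : invariant_closed U K) : compact [set: hull Om].
Proof.
apply: subtype_compact; apply: subclosed_compact Del_compact _ => //.
exact: closed_pts.
Qed.
End delone_topology.

(** * Sums over the points of a Delone set *)

Lemma filter_seq {T : Type} {I : eqType} (F : set_system T) {FF : Filter F}
    (r : seq I) (P : I -> set T) :
  (forall i, i \in r -> F (P i)) -> F [set t | forall i, i \in r -> P i t].
Proof.
elim: r => [|i r IH] FP; first exact: filterE.
apply: filterS2 (FP i _) (IH _) => [t Pi Pr j|| j jr].
- by rewrite inE => /orP[/eqP -> //|/Pr].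
- exact: mem_head.
- by apply: FP; rewrite inE jr orbT.
Qed.

Section local_sums.
Context {G H : topGroupType}.
Hypotheses (lcG : lcsc_hausdorff G) (lcH : lcsc_hausdorff H).
Local Notation Z := (G * H)%type.
Local Notation lshift := Defs.lshift.
Variables (U K : set Z).
Hypotheses (openU : open U) (U1 : U 1%g).

Lemma lshift_id p : lshift p U p.
Proof. by exists 1%g; rewrite ?mulg1. Qed.

(** The filter of finite lists ordered by inclusion turns the covering property
    into [compact_near_coveringP]. *)
Lemma compact_translates (C : set Z) : compact C ->
  exists s : seq Z, forall z, C z -> exists2 x, x \in s & lshift x U z.
Proof.
pose F := filter_from setT (fun s : seq Z => [set t : seq Z | {subset s <= t}]).
have FF : Filter F.
  apply: filter_from_filter; first by exists [::].
  move=> s t _ _; exists (s ++ t) => // r sr; split=> x xs; apply: sr.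
    by rewrite mem_cat xs.
  by rewrite mem_cat xs orbT.
rewrite compact_near_coveringP => /(_ _ F (fun s z => exists2 x, x \in s & lshift x U z)).
move=> /(_ FF) [z Cz|s _ sC]; last by exists s => z Cz; exact: (sC s).
exists (lshift z U, [set t : seq Z | z \in t]) => /=; last first.
  by move=> [y t] /= [zy zt]; exists z.
split; first by apply: open_nbhs_nbhs; split; [exact: lshift_open|exact: lshift_id].
by exists [:: z] => // t; apply; exact: mem_head.
Qed.

(** A translate of [U] contains at most one point of [D]. *)
Lemma delone_size (D : set Z) (s t : seq Z) : delone U K D -> uniq t ->
  (forall z, z \in t -> D z /\ exists2 x, x \in s & lshift x U z) ->
  (size t <= size s)%N.
Proof.
move=> [_ DU _] ut ts.
have /choice[c cP] : forall z, exists c, z \in t -> c \in s /\ lshift c U z.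
  move=> z; have [zt|] := boolP (z \in t); last by exists z.
  by have [_ [x xs xz]] := ts z zt; exists x.
rewrite -(size_map c); apply: uniq_leq_size.
  rewrite map_inj_in_uniq// => x y xt yt cxy.
  apply: (DU (c x)).
    by split; [case: (cP x xt)|case: (ts x xt)].
  by split; [rewrite cxy; case: (cP y yt)|case: (ts y yt)].
by move=> _ /mapP[z zt ->]; case: (cP z zt).
Qed.

(** The bound [N] is the length of a covering of [C] by translates of [U]; moving
    the covering by [p] makes it independent of [p]. *)
Lemma delone_count (C : set Z) : compact C -> exists N, forall D p, delone U K D ->
  exists t : seq Z, [/\ uniq t, (size t <= N)%N &
    forall z, z \in t <-> D z /\ lshift p C z].
Proof.
move=> /compact_translates[s sC]; exists (size s) => D p dD.
have bound : forall t, uniq t -> (forall z, z \in t -> D z /\ lshift p C z) ->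
    (size t <= size s)%N.
  move=> t ut tD; rewrite -(size_map (fun x => p * x)%g s).
  apply: (delone_size dD) => // z /tD[Dz [c Cc cz]]; split=> //; rewrite -cz.
  have [x xs [u Uu xu]] := sC c Cc.
  exists (p * x)%g; first by apply/mapP; exists x.
  by exists u; rewrite // -mulgA xu.
have fin : finite_set (D `&` lshift p C).
  apply: contrapT => /(infinite_set_fset (size s).+1)[B BD].
  by apply/negP; rewrite -ltnNge ltnS; apply: bound => [|z zB]; [exact: fset_uniq|exact: BD].
exists (fset_set (D `&` lshift p C)).
have mem z : z \in fset_set (D `&` lshift p C) <-> D z /\ lshift p C z.
  by rewrite in_fset_set//; split=> [/set_mem|/mem_set].
by split=> [||//]; [exact: fset_uniq|apply: bound => [|z /mem//]; exact: fset_uniq].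
Qed.

Lemma disjoint_nbhds (r : seq Z) : exists V : Z -> set Z,
  [/\ forall z, open (V z), forall z, V z z, forall z, V z `<=` lshift z U &
      forall y z w, y \in r -> z \in r -> V y w -> V z w -> y = z].
Proof.
have hZ := Z_hausdorff lcG lcH.
have sep : forall q : Z * Z, exists AB : set Z * set Z, q.1 != q.2 ->
    [/\ open AB.1, open AB.2, AB.1 q.1, AB.2 q.2 & AB.1 `&` AB.2 = set0].
  move=> [x y]; have [->|xy] := eqVneq x y; first by exists (set0, set0).
  move: hZ; rewrite open_hausdorff => /(_ _ _ xy)[[A B] [/= /set_mem Ax /set_mem By]].
  by move=> [oA oB /eqP AB]; exists (A, B).
have [AB ABP] := choice sep.
pose W z y := (AB (z, y)).1 `&` (AB (y, z)).2.
have W_nbhs (z y : Z) : y != z -> nbhs z (W z y).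
  move=> yz; have zy : z != y by rewrite eq_sym.
  have [ oA _ Az _ _] := ABP (z, y) zy; have [_ oB _ Bz _] := ABP (y, z) yz.
  by apply: filterI; apply: open_nbhs_nbhs.
pose N z := [set w | lshift z U w /\ forall y, y \in r -> y != z -> W z y w].
have N_nbhs (z : Z) : nbhs z (N z).
  apply: filterI.
    apply: open_nbhs_nbhs; split; last exact: lshift_id.
    exact: lshift_open.
  apply: (@filter_seq _ _ (nbhs z) _ r (fun y => [set w | y != z -> W z y w])).
  move=> y _; have [->|yz] := eqVneq y z; first exact: filterE.
  by apply: filterS (W_nbhs z y yz) => w Ww _.
exists (fun z => (N z)°); split=> [z|z|z w|y z w yr zr].
- exact: open_interior.
- exact: N_nbhs.
- by move=> /interior_subset[].
- move=> /interior_subset[_ Ny] /interior_subset[_ Nz].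
  apply/eqP/negP => /negP yz; have zy : z != y by rewrite eq_sym.
  have [_ _ _ _ AB0] := ABP (y, z) yz.
  have [A1 _] := Ny z zr zy; have [_ B2] := Nz y yr yz.
  by rewrite -[False]/((set0 : set Z) w) -AB0.
Qed.

Lemma cvg_seq_sum {k : numFieldType} {T I : Type} (F : set_system T) {FF : Filter F}
    (r : seq I) (f : I -> T -> k) (a : I -> k) :
  (forall i, f i @ F --> a i) ->
  (fun t => \sum_(i <- r) f i t) @ F --> \sum_(i <- r) a i.
Proof.
move=> fa; elim: r => [|i r IH].
  by under eq_fun do rewrite big_nil; rewrite big_nil; exact: cvg_cst.
by under eq_fun do rewrite big_cons; rewrite big_cons; apply: cvgD.
Qed.

(** Only points of the compact set [C] contribute. If [r] lists those of the
    limit set, then near each [z] in [r] a nearby Delone set [D t] has exactly one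
    point, namely [sel t z]: at least one by the Fell topology, at most one by
    uniform discreteness. No other point of [D t] in [C] remains, for [C] minus
    these neighbourhoods is compact and missed by the limit set. *)
Lemma cvg_local_sum {k : numFieldType} {T : Type} (F : set_system T) {FF : Filter F}
    (D : T -> closedset Z) (D0 : closedset Z) (C : set Z)
    (f : T -> Z -> k) (f0 : Z -> k) :
  (forall t, delone U K (pts (D t))) -> delone U K (pts D0) -> D @ F --> D0 ->
  compact C ->
  (\forall t \near F, forall z, pts (D t) z -> ~ C z -> f t z = 0) ->
  (forall z, pts D0 z -> ~ C z -> f0 z = 0) ->
  (forall z, pts D0 z ->
    (fun q => f q.1 q.2) @ within [set q | pts (D q.1) q.2] (filter_prod F (nbhs z))
      --> f0 z) ->
  (fun t => \sum_(z \in pts (D t)) f t z) @ F --> \sum_(z \in pts D0) f0 z.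
Proof.
move=> dD dD0 cvD cC fC f0C fz.
have [N /(_ (pts D0) 1%g dD0)[r [ur _ rP]]] := delone_count cC.
have lshift1 z : lshift 1%g C z = C z by rewrite lshiftE /= invg1 mul1g.
have [V [oV Vz VU Vdisj]] := disjoint_nbhds r.
pose W := \bigcup_(z in [set` r]) V z.
have oW : open W by apply: bigcup_open => z _; exact: oV.
have missW : \forall t \near F, (C `&` ~` W) `&` pts (D t) = set0.
  apply: fell_cvg_miss cvD _ _.
    by apply: compact_closedI => //; exact: open_closedC.
  apply/seteqP; split=> // z [[Cz Wz] D0z]; apply: Wz; exists z => //=.
  by apply/rP; rewrite lshift1.
have rD0 z : z \in r -> pts D0 z by move=> /rP[].
have hitV : \forall t \near F, forall z, z \in r -> V z `&` pts (D t) !=set0.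
  apply: (filter_seq (P := fun z => [set t | V z `&` pts (D t) !=set0])) => z zr.
  by apply: fell_cvg_hit cvD _ _ => //; exists z; split=> //; exact: rD0.
pose sel t z := xget z (V z `&` pts (D t)).
have sel_uniq t z w : V z w -> pts (D t) w -> sel t z = w.
  move=> Vw Dw; rewrite /sel; case: xgetP => [y _ [Vy Dy]|/(_ w)[]//].
  have [_ + _] := dD t; move/(_ z y w); apply; split=> //; exact: VU.
have selP t z : V z `&` pts (D t) !=set0 -> V z (sel t z) /\ pts (D t) (sel t z).
  by move=> [w [Vw Dw]]; rewrite (sel_uniq t z w).
have -> : \sum_(z \in pts D0) f0 z = \sum_(z <- r) f0 z.
  rewrite [RHS]fsbig_seq// -(fsbig_widen [set` r] (pts D0) f0) => [//|z /rD0//|z [D0z] /= zr].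
  apply: f0C => // Cz; apply: zr; apply/rP; rewrite lshift1 //.
have sumE : \forall t \near F, \sum_(z <- r) f t (sel t z) = \sum_(z \in pts (D t)) f t z.
  apply: filterS3 missW hitV fC => t miss hit ft0.
  have usel : uniq (map (sel t) r).
    rewrite map_inj_in_uniq// => y z yr zr yz.
    have [Vy _] := selP _ _ (hit y yr); have [Vz' _] := selP _ _ (hit z zr).
    by apply: (Vdisj y z (sel t y)) => //; rewrite yz.
  rewrite -(big_map (sel t) xpredT (f t)) [LHS]fsbig_seq//.
  apply: fsbig_widen => [_ /= /mapP[z zr ->]|z [Dz /= zr]].
    by case: (selP _ _ (hit z zr)).
  apply: ft0 => // Cz; have [[y /= yr Vy]|nW] := pselect (W z).
    by apply: zr; apply/mapP; exists y => //; rewrite (sel_uniq t y z).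
  by rewrite -[False]/((set0 : set Z) z) -miss.
apply: cvg_trans (near_eq_cvg sumE) _.
have cvsel z : z \in r -> (fun t => f t (sel t z)) @ F --> f0 z.
  move=> zr B nB; have /= := fz z (rD0 z zr) B nB.
  rewrite /= nbhs_simpl /= /within /= => -[[P Q] [/= FP Qz] PQ].
  rewrite /= nbhs_simpl /=.
  have hitQ : \forall t \near F, (V z `&` Q°) `&` pts (D t) !=set0.
    apply: fell_cvg_hit cvD _ _; first by apply: openI => //; exact: open_interior.
    by exists z; split; [split=> //; exact: Qz|exact: rD0].
  apply: filterS2 FP hitQ => t Pt [w [[Vw Qw] Dw]].
  rewrite /= (sel_uniq t z w)//; apply: (PQ (t, w)) => //; split=> //=.
  exact: interior_subset.
pose g z := if z \in r then fun t => f t (sel t z) else fun=> f0 z.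
have -> : (fun t => \sum_(z <- r) f t (sel t z)) = (fun t => \sum_(z <- r) g z t).
  apply/funext => t; rewrite big_seq [RHS]big_seq; apply: eq_bigr => z zr.
  by rewrite /g zr.
apply: cvg_seq_sum => z; rewrite /g; case: ifPn => [/cvsel//|_]; exact: cvg_cst.
Qed.

End local_sums.

(** * Schur test and quadratic forms *)

Lemma sqr_sum_le {R : realType} {I : Type} (r : seq I) (b : I -> R) :
  (\sum_(i <- r) b i) ^+ 2 <= (size r)%:R * \sum_(i <- r) b i ^+ 2.
Proof.
elim: r => [|i r IH]; first by rewrite !big_nil expr0n mulr0.
rewrite !big_cons /=; set S := \sum_(j <- r) b j in IH *.
set Q := \sum_(j <- r) b j ^+ 2 in IH *.
have cross : 2 * b i * S <= (size r)%:R * b i ^+ 2 + Q.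
  rewrite {IH}/S /Q {S Q}; elim: r => [|j r IH] /=.
    by rewrite !big_nil mulr0 mul0r addr0.
  rewrite !big_cons -natr1; move: IH (sqr_ge0 (b i - b j)).
  by set x := \sum_(_ <- r) _; set y := \sum_(_ <- r) _; nra.
by rewrite -natr1; nra.
Qed.

Lemma eq_of_close {R : realType} (a b C : R) :
  (forall e, 0 < e -> `|a - b| <= e * C) -> a = b.
Proof.
move=> close; apply/eqP; rewrite -subr_eq0 -normr_le0.
have [C0|C0] := leP C 0.
  by apply: le_trans (close 1 ltr01) _; rewrite mul1r.
apply/ler_addgt0Pr => e e0; rewrite add0r.
have := close (e / C) (divr_gt0 e0 C0).
by rewrite divfK ?gt_eqF.
Qed.

(** A kernel bounded by [M] with at most [N] nonzero entries in each row and each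
    column gives a bounded operator. The list [nb x] enumerates the points
    related to [x]; symmetry of this relation passes from rows to columns. *)
Section schur_test.
Local Open Scope complex_scope.
Context {R : realType} {T : choiceType}.
Variable w : T -> R.
Hypothesis w_gt0 : forall x, 0 < w x.
Variables (k : T -> T -> R[i]) (nb : T -> seq T) (M V : R) (N : nat).
Hypotheses (nb_uniq : forall x, uniq (nb x)) (nb_size : forall x, (size (nb x) <= N)%N).
Hypothesis nb_sym : forall x y, y \in nb x -> x \in nb y.
Hypotheses (M_ge0 : 0 <= M) (k_le : forall x y, normc (k x y) <= M).
Hypothesis k_range : forall x y, y \notin nb x -> k x y = 0.
Hypotheses (V_ge0 : 0 <= V) (w_le : forall x, w x <= V).
Implicit Types (u : T -> R[i]).

Definition kernel_oper u : T -> R[i] :=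
  fun x => \sum_(y \in [set: T]) k x y * u y * (w y)%:C.

Lemma kernel_operE u x : kernel_oper u x = \sum_(y <- nb x) k x y * u y * (w y)%:C.
Proof.
rewrite /kernel_oper [RHS]fsbig_seq//; apply/esym.
apply: (fsbig_widen [set` nb x] setT (fun y => k x y * u y * (w y)%:C)) => // y.
by move=> [_ /= /negP yx]; rewrite k_range ?mul0r//.
Qed.

Let normc_ge0 := @normc_ge0 R.

Let normc_sum (r : seq T) (f : T -> R[i]) :
  normc (\sum_(y <- r) f y) <= \sum_(y <- r) normc (f y).
Proof.
elim: r => [|y r IH]; first by rewrite !big_nil normc0.
by rewrite !big_cons; apply: le_trans (normcD _ _) _; rewrite lerD2l.
Qed.

Let pointwise u x : normc (kernel_oper u x) ^+ 2 * w x <=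
  M ^+ 2 * N%:R * V ^+ 2 * \sum_(y <- nb x) normc (u y) ^+ 2 * w y.
Proof.
have step : normc (kernel_oper u x) <= \sum_(y <- nb x) M * (normc (u y) * w y).
  rewrite kernel_operE; apply: le_trans (normc_sum _ _) _; apply: ler_sum => y _.
  rewrite !normcM -mulrA; apply: ler_pM => //; first by rewrite mulr_ge0.
  by rewrite /= expr0n addr0 sqrtr_sqr ger0_norm// ltW.
have step2 : normc (kernel_oper u x) ^+ 2 <=
    N%:R * \sum_(y <- nb x) (M * (normc (u y) * w y)) ^+ 2.
  apply: le_trans (_ : (\sum_(y <- nb x) M * (normc (u y) * w y)) ^+ 2 <= _).
    by rewrite ler_sqr ?nnegrE// (le_trans (normc_ge0 _) step).
  apply: le_trans (sqr_sum_le _ _) _; rewrite ler_wpM2r ?ler_nat//.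
  by apply: sumr_ge0 => y _; exact: sqr_ge0.
apply: le_trans (_ : N%:R * (\sum_(y <- nb x) (M * (normc (u y) * w y)) ^+ 2) * V <= _).
  by apply: ler_pM => //; [exact: sqr_ge0|exact: ltW].
rewrite -mulrA mulr_suml !mulr_sumr; apply: ler_sum => y _.
rewrite !exprMn.
have -> : N%:R * (M ^+ 2 * (normc (u y) ^+ 2 * w y ^+ 2) * V) =
  (M ^+ 2 * N%:R * normc (u y) ^+ 2 * w y * V) * w y by ring.
have -> : M ^+ 2 * N%:R * V ^+ 2 * (normc (u y) ^+ 2 * w y) =
  (M ^+ 2 * N%:R * normc (u y) ^+ 2 * w y * V) * V by ring.
by apply: ler_wpM2l => //; rewrite !mulr_ge0 ?sqr_ge0 ?ler0n// ltW.
Qed.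

Let kernel_oper_lin : lin_oper w kernel_oper.
Proof.
move=> c u u' _ _; apply/funext => x.
rewrite kernel_operE !fctE !kernel_operE scaler_sumr -big_split /=.
by apply: eq_bigr => y _; rewrite /GRing.scale /=; ring.
Qed.

(** Each [y] occurs in at most [N] of the lists [nb x]. *)
Let double_sum u (X : {fset T}) : l2 w u ->
  \sum_(x <- X) \sum_(y <- nb x) normc (u y) ^+ 2 * w y <= N%:R * hnorm w u ^+ 2.
Proof.
move=> u2; pose q y := normc (u y) ^+ 2 * w y.
have q0 y : 0 <= q y by rewrite mulr_ge0 ?sqr_ge0// ltW.
pose L := flatten [seq nb x | x <- X].
have mult y : (count_mem y L <= N)%N.
  rewrite /L count_flatten -map_comp (eq_map (g := fun x => nat_of_bool (x \in nb y))).
    rewrite sumn_count -size_filter; apply: leq_trans (nb_size y).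
    apply: uniq_leq_size; first exact/filter_uniq/fset_uniq.
    by move=> x; rewrite mem_filter => /andP[].
  move=> x /=; rewrite count_uniq_mem//; congr nat_of_bool.
  by apply/idP/idP; exact: nb_sym.
rewrite -(big_map nb xpredT (fun r => \sum_(y <- r) q y)) -big_flatten.
rewrite -/L -big_undup_iterop_count.
apply: le_trans (_ : \sum_(y <- undup L) N%:R * q y <= _).
  by apply: ler_sum => y _; rewrite Monoid.iteropE /= iter_addr_0 -[_ *+ _]mulr_natl ler_wpM2r// ler_nat.
rewrite -mulr_sumr ler_wpM2l//.
have := esum_le_l2 w_gt0 [fset y in undup L]%fset u2.
rewrite (_ : \sum_(y <- undup L) q y = \sum_(y <- [fset y in undup L]%fset) q y)//.
apply: perm_big; apply: uniq_perm; rewrite ?undup_uniq ?fset_uniq// => y.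
by rewrite !inE.
Qed.

Lemma schur_test : bounded_by w kernel_oper (M * N%:R * V).
Proof.
have main u : l2 w u -> l2 w (kernel_oper u) /\
    hnorm w (kernel_oper u) <= M * N%:R * V * hnorm w u.
  move=> u2; apply: l2_esum_le => // [|X]; first by rewrite !mulr_ge0 ?hnorm_ge0.
  apply: le_trans (ler_sum _ (fun x _ => pointwise u x)) _.
  rewrite -mulr_sumr; apply: le_trans (ler_wpM2l _ (double_sum X u2)) _.
    by rewrite !mulr_ge0 ?sqr_ge0.
  by rewrite !exprMn; rewrite le_eqVlt; apply/orP; left; apply/eqP; ring.
split=> //; first by rewrite !mulr_ge0.
- by move=> u /main[].
- by move=> u /main[].
Qed.

End schur_test.

Section quadratic_form.
Local Open Scope complex_scope.
Context {R : realType} {T : choiceType}.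
Variable w : T -> R.
Hypothesis w_gt0 : forall x, 0 < w x.
Variables (A : oper R T) (M : R).
Hypothesis AM : bounded_by w A M.
Hypothesis selfadj : forall u v, l2 w u -> l2 w v -> inner w (A u) v = inner w u (A v).
Variable u : T -> R[i].
Hypothesis u2 : l2 w u.

Definition qform (phi : R -> R) : R := complex.Re (inner w u (funcalc w phi A u)).
Definition pform (p : {poly R}) : R := complex.Re (inner w u (rpeval A p u)).

Let M1 : 0 < M + 1.
Proof. by case: AM => M0 _ _ _; rewrite ltr_wpDl. Qed.

Let rp2 p : l2 w (rpeval A p u).
Proof. by have [N [_ _ h _]] := peval_bounded w_gt0 AM (map_poly (real_complex R) p); exact: h. Qed.

Let reD a b : l2 w a -> l2 w b ->
  complex.Re (inner w u (a + b)) = complex.Re (inner w u a) + complex.Re (inner w u b).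
Proof.
move=> a2 b2; rewrite (innerDr w_gt0 u2 a2 b2).
by move: (inner w u a) (inner w u b) => [x x'] [y y'].
Qed.

Let reZ (c : R) a : l2 w a ->
  complex.Re (inner w u (c%:C *: a)) = c * complex.Re (inner w u a).
Proof.
move=> a2; rewrite (innerZr w_gt0 c%:C u2 a2).
by move: (inner w u a) => [x x'] /=; rewrite mul0r subr0.
Qed.

Lemma qform_approx (phi : R -> R) (p : {poly R}) (e : R) : continuous phi -> 0 <= e ->
  (forall t, `|t| <= M -> `|p.[t] - phi t| <= e) ->
  `|qform phi - pform p| <= e * hnorm w u ^+ 2.
Proof.
move=> cphi e0 pe.
have [f2 /(_ p e e0 pe u u2) close] := funcalc_approx w_gt0 AM selfadj cphi.
have d2 := l2B w_gt0 (f2 u u2) (rp2 p).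
have -> : qform phi - pform p = complex.Re (inner w u (funcalc w phi A u - rpeval A p u)).
  by apply/eqP; rewrite subr_eq -reD// subrK.
apply: le_trans (Re_le_normc _) _; apply: le_trans (cauchy_schwarz w_gt0 u2 d2) _.
by rewrite mulrC expr2 mulrA ler_wpM2r// hnorm_ge0.
Qed.

Let approx (phi : R -> R) (e : R) : continuous phi -> 0 < e ->
  exists2 p : {poly R}, (forall t, `|t| <= M -> `|p.[t] - phi t| <= e) &
    `|qform phi - pform p| <= e * hnorm w u ^+ 2.
Proof.
move=> cphi e0; have [p pe] := weierstrass M1 cphi e0.
have pe' t : `|t| <= M -> `|p.[t] - phi t| <= e.
  by move=> tM; apply: pe; apply: le_trans tM _; rewrite lerDl.
by exists p => //; apply: qform_approx => //; exact: ltW.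
Qed.

Let pformD p q : pform (p + q) = pform p + pform q.
Proof.
rewrite /pform -reD//; congr (complex.Re (inner w u _)).
by rewrite /rpeval rmorphD pevalD.
Qed.

Let pformZ c p : pform (c *: p) = c * pform p.
Proof.
rewrite /pform -reZ//; congr (complex.Re (inner w u _)).
by rewrite /rpeval map_polyZ (pevalZ w_gt0 AM).
Qed.

Let pform_sqr p : 0 <= pform (p * p).
Proof.
rewrite /pform (_ : rpeval A (p * p) u = rpeval A p (rpeval A p u)); last first.
  by rewrite /rpeval rmorphM (pevalM w_gt0 AM).
rewrite -(rpeval_selfadj w_gt0 AM selfadj p u2 (rp2 p)) (inner_self w_gt0 (rp2 p)).
by rewrite sqr_ge0.
Qed.

Lemma qformD (phi psi : R -> R) : continuous phi -> continuous psi ->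
  qform (fun t => phi t + psi t) = qform phi + qform psi.
Proof.
move=> cphi cpsi; apply: (@eq_of_close _ _ _ (4 * hnorm w u ^+ 2)) => e e0.
have [p pe ap] := approx cphi e0; have [q qe aq] := approx cpsi e0.
have : `|qform (fun t => phi t + psi t) - pform (p + q)| <= (e + e) * hnorm w u ^+ 2.
  apply: qform_approx; first exact: continuous_add.
    by rewrite addr_ge0// ltW.
  move=> t tM; rewrite hornerD opprD addrACA.
  by apply: le_trans (ler_normD _ _) _; apply: lerD; [exact: pe|exact: qe].
rewrite pformD; move: ap aq; rewrite !ler_norml.
move: (qform _) (qform phi) (qform psi) (pform p) (pform q) (hnorm w u ^+ 2).
move=> a b c x y z /andP[? ?] /andP[? ?] /andP[? ?].
by apply/andP; split; lra.
Qed.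

Lemma qformZ (c : R) (phi : R -> R) : continuous phi ->
  qform (fun t => c * phi t) = c * qform phi.
Proof.
move=> cphi; apply: (@eq_of_close _ _ _ ((2 * `|c|) * hnorm w u ^+ 2)) => e e0.
have [p pe ap] := approx cphi e0.
have : `|qform (fun t => c * phi t) - pform (c *: p)| <= (`|c| * e) * hnorm w u ^+ 2.
  apply: qform_approx; first exact: continuous_scale.
    by rewrite mulr_ge0// ltW.
  by move=> t tM; rewrite hornerZ -mulrBr normrM ler_wpM2l// pe.
rewrite pformZ => h.
rewrite -[X in `|X|](subrKA (c * pform p)); apply: le_trans (ler_normD _ _) _.
rewrite -mulrBr normrM (distrC (pform p)).
have := ler_wpM2l (normr_ge0 c) ap; lra.
Qed.

(** If [q] approximates a square root of [phi], then [q ^ 2] approximates [phi],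
    and its quadratic form at [u] is the squared norm of [q(A) u]. *)
Lemma qform_ge0 (phi : R -> R) : continuous phi ->
  (forall t, `|t| <= M -> 0 <= phi t) -> 0 <= qform phi.
Proof.
move=> cphi phi0; pose s t := Num.sqrt (phi t).
have cs : continuous s.
  by move=> t; apply: (@continuous_comp _ _ _ phi Num.sqrt); [exact: cphi|exact: sqrt_continuous].
have [B B0 sB] : exists2 B : R, 0 <= B & forall t, `|t| <= M -> s t <= B.
  have [M0 _ _ _] := AM.
  have [||c cM sc] := @EVT_max R s (- M) M.
  - by rewrite -subr_ge0 opprK addr_ge0.
  - exact: continuous_subspaceT.
  exists (s c); first exact: sqrtr_ge0.
  by move=> t tM; apply: sc; rewrite in_itv/= -ler_norml.
apply/ler_addgt0Pr => d d0.
(* As [e <= 1], approximating [s] up to [e] approximates [phi] up to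
   [e * (2 * B + 1)]. *)
pose C := (2 * B + 1) * hnorm w u ^+ 2 + 1.
have B1 : 0 <= 2 * B + 1 by lra.
have C0 : 0 < C by rewrite /C ltr_wpDl// mulr_ge0 ?sqr_ge0.
pose e := Num.min 1 (d / C).
have e0 : 0 < e by rewrite lt_min ltr01 divr_gt0.
have [q qe _] := approx cs e0.
have : `|qform phi - pform (q * q)| <= (e * (2 * B + 1)) * hnorm w u ^+ 2.
  apply: qform_approx => //; first by rewrite mulr_ge0// ltW.
  move=> t tM; rewrite hornerM.
  have s2 : phi t = s t * s t by rewrite -expr2 sqr_sqrtr// phi0.
  have st0 : 0 <= s t by exact: sqrtr_ge0.
  have sB' := sB t tM; have := qe t tM; rewrite s2.
  have e1 : e <= 1 by rewrite ge_min lexx.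
  rewrite (_ : q.[t] * q.[t] - s t * s t = (q.[t] - s t) * (q.[t] - s t + 2 * s t)); last by ring.
  rewrite normrM => h; apply: ler_pM => //.
  apply: le_trans (ler_normD _ _) _; rewrite (ger0_norm (_ : 0 <= 2 * s t)) ?mulr_ge0//.
  by lra.
rewrite ler_norml => /andP[h _]; have := pform_sqr q.
have eC : e * C <= d by rewrite -ler_pdivlMr// ge_min lexx orbT.
have : e * (2 * B + 1) * hnorm w u ^+ 2 <= e * C.
  by rewrite -mulrA ler_wpM2l ?ltW// /C ltrDl.
lra.
Qed.
End quadratic_form.

Section polynomial_perturbation.
Local Open Scope complex_scope.
Context {R : realType} {T : choiceType}.
Variable w : T -> R.
Hypothesis w_gt0 : forall x, 0 < w x.
Variables (A B : oper R T) (M e : R).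
Hypotheses (AM : bounded_by w A M) (BM : bounded_by w B M) (M1 : 1 <= M) (e0 : 0 <= e).
Hypothesis close : forall u, l2 w u -> hnorm w (A u - B u) <= e * hnorm w u.

Let iter2 (C : oper R T) i u : bounded_by w C M -> l2 w u ->
  l2 w (iter i C u) /\ hnorm w (iter i C u) <= M ^+ i * hnorm w u.
Proof.
move=> [M0 _ C2 CM] u2; elim: i => [|i [IH1 IH2]] /=; first by rewrite mul1r.
split; first exact: C2.
apply: le_trans (CM _ IH1) _; rewrite exprS -mulrA; exact: ler_wpM2l.
Qed.

(** Telescoping, one factor at a time. *)
Let iter_close i u : l2 w u ->
  hnorm w (iter i A u - iter i B u) <= i%:R * M ^+ i * e * hnorm w u.
Proof.
move=> u2; have [M0 linA A2 Abd] := AM; have [_ _ B2 _] := BM.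
elim: i => [|i IH] /=; first by rewrite subrr (hnorm0 w_gt0) !mul0r.
have [a2 _] := iter2 i AM u2; have [b2 ble] := iter2 i BM u2.
have d2 := l2B w_gt0 a2 b2.
rewrite -(subrKA (A (iter i B u))) -(lin_operB linA a2 b2).
apply: le_trans (hnormD w_gt0 _ _) _.
- exact: A2.
- by apply: l2B => //; [exact: A2|exact: B2].
have h1 := Abd _ d2; have h2 := close b2.
have h3 := ler_wpM2l M0 IH; have h4 := ler_wpM2l e0 ble.
have h5 : e * (M ^+ i * hnorm w u) <= M ^+ i.+1 * e * hnorm w u.
  have p0 : 0 <= M ^+ i * e * hnorm w u by rewrite !mulr_ge0 ?exprn_ge0 ?hnorm_ge0.
  rewrite exprS; have := ler_wpM2r p0 M1; lra.
rewrite -natr1 exprS in h5 *; lra.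
Qed.

Lemma rpeval_close (p : {poly R}) u : l2 w u ->
  hnorm w (rpeval A p u - rpeval B p u) <=
  (\sum_(i < size p) `|p`_i| * (i%:R * M ^+ i)) * e * hnorm w u.
Proof.
move=> u2; rewrite -!poly_operE /poly_oper -sumrB.
have t2 i : l2 w ((p`_i)%:C *: iter i A u - (p`_i)%:C *: iter i B u).
  by apply: l2B => //; apply: l2Z => //; [case: (iter2 i AM u2)|case: (iter2 i BM u2)].
have term i : hnorm w ((p`_i)%:C *: iter i A u - (p`_i)%:C *: iter i B u) <=
    `|p`_i| * (i%:R * M ^+ i) * e * hnorm w u.
  rewrite -scalerBr (hnormZ w_gt0); last first.
    by apply: l2B => //; [case: (iter2 i AM u2)|case: (iter2 i BM u2)].
  rewrite (_ : normc (p`_i)%:C = `|p`_i|); last by rewrite /= expr0n addr0 sqrtr_sqr.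
  by have := ler_wpM2l (normr_ge0 p`_i) (iter_close i u2); rewrite !mulrA.
rewrite !mulr_suml; elim: (index_enum _) => [|i r IH]; first by rewrite !big_nil hnorm0.
rewrite !big_cons; apply: le_trans (hnormD w_gt0 (t2 i) _) _.
  by apply: l2_sum => // j; exact: t2.
exact: lerD (term i) IH.
Qed.
End polynomial_perturbation.

(** * Operators given by kernels and their norm limits *)

Lemma normc_conj_close {R : realType} (X Y t s : R[i]) (d1 d2 d3 : R) :
  normc (X - t) <= d1 -> normc (Y - s) <= d2 -> normc (s^*%C - t) <= d3 ->
  normc (Y^*%C - X) <= d1 + d2 + d3.
Proof.
move=> h1 h2 h3.
have -> : Y^*%C - X = (Y - s)^*%C + ((s^*%C - t) - (X - t)).
  case: X Y t s {h1 h2 h3} => [x x'] [y y'] [t t'] [s s'].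
  by apply/eqP; rewrite eq_complex /=; apply/andP; split; apply/eqP; ring.
have hc : normc (Y - s)^*%C = normc (Y - s).
  by case: (Y - s) => p q; rewrite /= sqrrN.
apply: le_trans (normcD _ _) _; rewrite hc.
apply: le_trans (lerD h2 (normcD _ _)) _; rewrite normcN; lra.
Qed.

Section random_operators.
Local Open Scope complex_scope.
Context {R : realType} {G H : topGroupType}.
Variables (U K : set (G * H)) (v : H -> R).
Hypotheses (openU : open U) (U1 : U 1%g) (vwin : window v).
Local Notation Z := (G * H)%type.
Local Notation lshift := Defs.lshift.
Local Notation pt D := (wpts v (pts (\val D))).
Local Notation wt D := (@weight R G H v (pts (\val D))).
Local Notation lam a D := (@lam R G H U K v a D).
Local Notation kernel := (Defs.kernel R U K).
Implicit Types (a b : kernel) (D : Del U K).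

Lemma wptsP D (x : pt D) : pts (\val D) (\val x) /\ v (\val x).2 != 0.
Proof. exact: (set_valP x). Qed.

Lemma wt_gt0 D (x : pt D) : 0 < wt D x.
Proof. by have [_ vx] := wptsP x; rewrite lt_def vx /=; case: vwin => _; exact. Qed.

Lemma wpts_tsupport D (x : pt D) : tsupport v (\val x).2.
Proof. by have [_ vx] := wptsP x; exact: subset_closure. Qed.

Lemma kdom_wpts D (x y : pt D) : kdom v (\val x, D, \val y).
Proof. by split; [case: (wptsP x)|case: (wptsP y)|exact: wpts_tsupport|exact: wpts_tsupport]. Qed.

Lemma Cc_bounded {T : topologicalType} (f : T -> R) : Cc f ->
  exists2 B, 0 <= B & forall t, `|f t| <= B.
Proof.
move=> [cf cS].
have cfS : compact (f @` tsupport f).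
  by apply: continuous_compact => //; exact: continuous_subspaceT.
have [B [_ /(_ (`|B| + 1)) hB]] := compact_bounded cfS.
exists (`|B| + 1); first by rewrite addr_ge0.
move=> t; have [->|ft] := eqVneq (f t) 0; first by rewrite normr0 addr_ge0.
apply: hB; first by rewrite (le_lt_trans (ler_norm _))// ltrDl.
by exists t => //; exact: subset_closure.
Qed.

Lemma weight_bounded : exists2 V, 0 <= V & forall D (x : pt D), wt D x <= V.
Proof.
have [B B0 vB] := Cc_bounded vwin.1.
by exists B => // D x; apply: le_trans (ler_norm _) (vB _).
Qed.

Definition kernel_le a (M : R) :=
  forall D (x y : pt D), normc (a (\val x) D (\val y)) <= M.

Definition kernel_range a (C : set G) :=
  forall D (x y : pt D), ~ C ((\val x)^-1 * \val y)%g.1 -> a (\val x) D (\val y) = 0.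

(** What kernels of finite type share with their differences and adjoints, and
    all that norm estimates need. *)
Definition tame a := exists (M : R) (C : set G), [/\ 0 <= M, compact C,
  (forall g, C g -> C (g^-1)%g), kernel_le a M & kernel_range a C].

Lemma finite_type_tame a : finite_type v a -> tame a.
Proof.
move=> [_ [M aM] [C [cC CV aC]] _]; exists `|M|, C; split=> //.
- by move=> g Cg; rewrite -CV; exists g.
- move=> D x y; have := aM _ _ _ (kdom_wpts x y).
  rewrite lecE /= => /andP[_ h]; apply: le_trans _ (ler_norm _); exact: h.
- by move=> D x y; apply: aC; exact: kdom_wpts.
Qed.

Lemma tame_ksub a b : tame a -> tame b -> tame (ksub a b).
Proof.
move=> [M [C [M0 cC CV aM aC]]] [M' [C' [M'0 cC' CV' bM bC]]].
exists (M + M'), (C `|` C'); split=> //.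
- exact: addr_ge0.
- exact: compactU.
- by move=> g [/CV|/CV']; [left|right].
- move=> D x y; apply: le_trans (normcD _ _) _; rewrite normcN.
  by apply: lerD; [exact: aM|exact: bM].
- by move=> D x y /not_orP[nC nC']; rewrite /ksub aC// bC// subr0.
Qed.

Lemma tame_kstar a : tame a -> tame (kstar a).
Proof.
move=> [M [C [M0 cC CV aM aC]]]; exists M, C; split=> //.
- move=> D x y; apply: le_trans (aM D y x); rewrite /kstar.
  by case: (a _ _ _) => p q; rewrite /= sqrrN.
- move=> D x y nC; rewrite /kstar aC ?conjc0// => Cyx; apply: nC.
  by have := CV _ Cyx; rewrite /= invgM invgK.
Qed.

(** The points related to [x] lie in a translate of [C] times the support of the
    window, which is compact. *)
Lemma neighbour_lists (C : set G) : compact C -> exists N, forall D,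
  exists nb : pt D -> seq (pt D), [/\ forall x, uniq (nb x),
    forall x, (size (nb x) <= N)%N &
    forall x y, y \in nb x <-> C ((\val x)^-1 * \val y)%g.1].
Proof.
move=> cC; have [[_ cS] _] := vwin.
have [N count] := delone_count K openU U1 (compact_setX cC cS).
exists N => D.
have dD : delone U K (pts (\val D)) by exact: (set_valP D).
have nbx (x : pt D) : exists s : seq (pt D), [/\ uniq s, (size s <= N)%N &
    forall y, y \in s <-> C ((\val x)^-1 * \val y)%g.1].
  have [t [ut tN tP]] := count _ ((\val x).1, 1%g) dD.
  exists (pmap insub t); split.
  - exact: pmap_sub_uniq.
  - by rewrite size_pmap_sub; apply: leq_trans tN; exact: count_size.
  - move=> y; rewrite mem_pmap_sub; split.
      by move=> /tP[_]; rewrite lshiftE => -[].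
  move=> Cy; apply/tP; split; first by case: (wptsP y).
  rewrite lshiftE; split => //=; rewrite invg1 mul1g; exact: wpts_tsupport.
have [nb nbP] := choice nbx.
by exists nb; split=> x; have [] := nbP x.
Qed.

Lemma lam_kernel_oper a D : lam a D = kernel_oper (wt D) (fun x y => a (\val x) D (\val y)).
Proof. by []. Qed.

Lemma tame_bounded a : tame a -> exists B, forall D, bounded_by (wt D) (lam a D) B.
Proof.
move=> [M [C [M0 cC CV aM aC]]].
have [N nbN] := neighbour_lists cC; have [V V0 wV] := weight_bounded.
exists (M * N%:R * V) => D; have [nb [nbu nbs nbP]] := nbN D.
apply: (schur_test (@wt_gt0 D) nbu nbs) => // [x y|x y yx].
- by move=> /nbP Cxy; apply/nbP; have := CV _ Cxy; rewrite /= invgM invgK.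
- by apply: aC => Cxy; move/negP: yx; apply; exact/nbP.
Qed.

Lemma lam_ksub a b D u : tame a -> tame b ->
  lam (ksub a b) D u = lam a D u - lam b D u.
Proof.
move=> [M [C [M0 cC CV aM aC]]] [M' [C' [M'0 cC' CV' bM bC]]].
have [N /(_ D)[nb [nbu _ nbP]]] := neighbour_lists (compactU cC cC').
have out x y : y \notin nb x -> a (\val x) D (\val y) = 0 /\ b (\val x) D (\val y) = 0.
  move=> /negP yx; split; [apply: aC|apply: bC] => h; apply: yx; apply/nbP; by [left|right].
apply/funext => x; rewrite !fctE !lam_kernel_oper !(kernel_operE _ nbu).
- by rewrite -sumrB; apply: eq_bigr => y _; rewrite /ksub !mulrBl.
- by move=> y z /out[].
- by move=> y z /out[].
- by move=> y z /out[]; rewrite /ksub => -> ->; rewrite subr0.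
Qed.

Lemma lam_point_mass a D (x y : pt D) :
  lam a D (point_mass y) x = a (\val x) D (\val y) * (wt D y)%:C.
Proof.
rewrite lam_kernel_oper /kernel_oper -(fsbig_widen [set y]) //=.
  by rewrite fsbig_set1 /point_mass eqxx mulr1.
move=> z [_ /= /eqP zy]; rewrite /point_mass (negbTE zy) mulr0 mul0r//.
Qed.

Lemma opnorm_le_knorm a D (e : R) : tame a -> 0 <= e -> (knorm v a <= e%:E)%E ->
  forall u, l2 (wt D) u -> hnorm (wt D) (lam a D u) <= e * hnorm (wt D) u.
Proof.
move=> ta e0 ae u u2; have [B /(_ D)[_ lin _ _]] := tame_bounded ta.
have : (opnorm (wt D) (lam a D) <= e%:E)%E.
  by apply: le_trans ae; apply: ereal_sup_ubound; exists D.
by move=> /(opnorm_leP (@wt_gt0 D) lin e0) h; case: (h u u2).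
Qed.

Section completion.
Variables (a : completion U K v) (A : oper_family U K v).
Arguments A : clear implicits.
Hypothesis aA : forall D, is_lam a (A D).

Lemma kseq_tame n : tame (a n).
Proof. exact/finite_type_tame/kseq_finite_type. Qed.

Let A_bounded D : exists B, bounded_by (wt D) (A D) B.
Proof. by apply/(bounded_byP (@wt_gt0 D)); case: (aA D). Qed.

Let lin n D : lin_oper (wt D) (lam (a n) D).
Proof. by have [B /(_ D)[]] := tame_bounded (kseq_tame n). Qed.

Lemma lam_l2 n D u : l2 (wt D) u -> l2 (wt D) (lam (a n) D u).
Proof. by have [B /(_ D)[_ _ h _]] := tame_bounded (kseq_tame n); exact: h. Qed.

(** The Cauchy condition on the presenting sequence is uniform in the Delone
    set, hence so is the convergence to the limit operators. *)
Lemma lam_uniform_cvg (e : R) : 0 < e -> exists N, forall n D u, (N <= n)%N ->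
  l2 (wt D) u -> hnorm (wt D) (lam (a n) D u - A D u) <= e * hnorm (wt D) u.
Proof.
move=> e0; have e20 : 0 < e / 2 by rewrite divr_gt0.
have [N cau] := kseq_cauchy a e20.
exists N => n D u Nn u2.
have [B [_ linA A2 _]] := A_bounded D.
have [_ /(norm_cvgP (@wt_gt0 D) (fun n => @lin n D) linA)/(_ _ e20)[N' _ cvA]] := aA D.
pose m := maxn N N'.
have [d2 dm] := cvA m (leq_maxr _ _) u u2.
have dnm : hnorm (wt D) (lam (a n) D u - lam (a m) D u) <= e / 2 * hnorm (wt D) u.
  rewrite -lam_ksub; [|exact: kseq_tame|exact: kseq_tame].
  apply: opnorm_le_knorm => //; last exact: cau (leq_maxl _ _).
    by apply: tame_ksub; exact: kseq_tame.
  exact: ltW.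
rewrite -(subrKA (lam (a m) D u)); apply: le_trans (hnormD (@wt_gt0 D) _ d2) _.
  by apply: (l2B (@wt_gt0 D)); exact: lam_l2.
lra.
Qed.

Lemma family_bounded : exists M N, [/\ 1 <= M,
  forall D, bounded_by (wt D) (A D) M &
  forall n D, (N <= n)%N -> bounded_by (wt D) (lam (a n) D) M].
Proof.
have [N close] := lam_uniform_cvg ltr01.
have [B Bd] := tame_bounded (kseq_tame N).
have Abd D u : l2 (wt D) u -> hnorm (wt D) (A D u) <= (`|B| + 1) * hnorm (wt D) u.
  move=> u2; have [B' [_ linA A2 _]] := A_bounded D.
  have [_ _ l2a /(_ u u2) bu] := Bd D.
  have := close N D u (leqnn N) u2.
  have a2 := A2 _ u2; have la := l2a _ u2.
  have := hnormB (@wt_gt0 D) la (l2B (@wt_gt0 D) la a2); rewrite subKr.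
  move=> h1 h2; apply: le_trans h1 _; rewrite mulrDl; apply: lerD h2.
  by apply: le_trans bu _; rewrite ler_wpM2r ?hnorm_ge0// ler_norm.
exists (`|B| + 2), N; split.
- by rewrite -[leLHS]add0r lerD// ler1n.
- move=> D; have [B' [_ linA A2 _]] := A_bounded D.
  split=> // u u2; apply: le_trans (Abd D u u2) _.
  by rewrite ler_wpM2r ?hnorm_ge0// lerD2l ler1n.
- move=> n D Nn; split=> // u u2; first exact: lam_l2.
  have [B' [_ linA A2 _]] := A_bounded D.
  rewrite -(subrK (A D u) (lam (a n) D u)).
  apply: le_trans (hnormD (@wt_gt0 D) _ (A2 _ u2)) _.
    by apply: (l2B (@wt_gt0 D)); [exact: lam_l2|exact: A2].
  apply: le_trans (lerD (close n D u Nn u2) (Abd D u u2)) _.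
  by rewrite -mulrDl addrCA.
Qed.

(** It suffices to test on point masses, where the matrix entries of the
    approximants and of their adjoints are weighted values of the kernels. *)
Lemma family_selfadj : completion_selfadj a -> forall D u u',
  l2 (wt D) u -> l2 (wt D) u' -> inner (wt D) (A D u) u' = inner (wt D) u (A D u').
Proof.
move=> sa D; have [M [N0 [_ /(_ D) bA _]]] := family_bounded.
have w0 := @wt_gt0 D; have [_ _ A2 _] := bA.
apply: (selfadj_point_masses w0 bA) => x y.
have dx := l2_point_mass w0 x; have dy := l2_point_mass w0 y.
set dX := point_mass x in dx *; set dY := point_mass y in dy *.
rewrite (innerC w0 dy (A2 _ dx)).
pose C := hnorm (wt D) dX * hnorm (wt D) dY.
have small (e : R) n z (u : pt D -> R[i]) : l2 (wt D) u ->
    l2 (wt D) (lam (a n) D u) -> 0 < e -> l2 (wt D) z ->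
    hnorm (wt D) (lam (a n) D u - A D u) <= e * hnorm (wt D) u ->
    normc (inner (wt D) z (A D u) - inner (wt D) z (lam (a n) D u)) <=
      e * (hnorm (wt D) z * hnorm (wt D) u).
  move=> u2 lu e0 z2 le; have Au := A2 _ u2.
  rewrite -normcN opprB.
  have -> : inner (wt D) z (lam (a n) D u) - inner (wt D) z (A D u) =
      inner (wt D) z (lam (a n) D u - A D u).
    by apply/eqP; rewrite subr_eq -(innerDr w0)// ?subrK//; exact: (l2B w0).
  apply: le_trans (cauchy_schwarz w0 z2 (l2B w0 lu Au)) _.
  by rewrite mulrCA ler_wpM2l ?hnorm_ge0.
suff : normc ((inner (wt D) dY (A D dX))^* - inner (wt D) dX (A D dY)) = 0.
  by move/eq0_normc/eqP; rewrite subr_eq0 => /eqP.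
apply: (@eq_of_close _ _ _ (3 * C)) => e e0.
rewrite subr0 ger0_norm ?normc_ge0//.
have [N close] := lam_uniform_cvg e0.
have [N' _ clN'] := cvg0e_le sa e0.
pose n := maxn N N'.
have Nn : (N <= n)%N := leq_maxl _ _.
have lx := lam_l2 n dx; have ly := lam_l2 n dy.
have h1 := small e n dX dY dy ly e0 dx (close n D dY Nn dy).
have h2 := small e n dY dX dx lx e0 dy (close n D dX Nn dx).
have ta := kseq_tame n; have tk := tame_kstar ta.
have h3 := opnorm_le_knorm (D := D) (tame_ksub ta tk) (ltW e0) (clN' n (leq_maxr _ _)) dy.
have h4 : normc ((inner (wt D) dY (lam (a n) D dX))^* - inner (wt D) dX (lam (a n) D dY)) <= e * C.
  rewrite -normcN opprB.
  have -> : inner (wt D) dX (lam (a n) D dY) - (inner (wt D) dY (lam (a n) D dX))^* =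
      inner (wt D) dX (lam (ksub (a n) (kstar (a n))) D dY).
    rewrite /dX /dY !inner_point_mass !lam_point_mass /ksub /kstar.
    move: (a n _ _ _) (a n _ _ _) => [p q] [r s].
    by apply/eqP; rewrite eq_complex /=; apply/andP; split; apply/eqP; ring.
  apply: le_trans (cauchy_schwarz w0 dx _) _; last by rewrite mulrCA ler_wpM2l ?hnorm_ge0.
  by have [B /(_ D)[_ _ h _]] := tame_bounded (tame_ksub ta tk); exact: h.
apply: le_trans (normc_conj_close h1 h2 h4) _; rewrite /C.
move: (hnorm _ dX) (hnorm _ dY) => p q.
by rewrite le_eqVlt (_ : _ + _ = e * (3 * (p * q))) ?eqxx//; ring.
Qed.
End completion.

End random_operators.

(** * Continuity of the entries of powers of kernels *)

Section complex_limits.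
Local Open Scope complex_scope.
Context {R : realType} {T : Type} (F : set_system T) {FF : Filter F}.

Lemma normcE_C (z : R[i]) : `|z| = (normc z)%:C.
Proof. by []. Qed.

Lemma cvg_complexP (f : T -> R[i]) (l : R[i]) :
  (f : T -> (R[i] : numFieldType)) @ F --> (l : (R[i] : numFieldType)) <->
  forall e : R, 0 < e -> \forall t \near F, normc (l - f t) < e.
Proof.
split.
- move=> /cvgrPdist_lt h e e0; have e0' : (0 : R[i]) < e%:C by rewrite ltcR.
  by apply: filterS (h _ e0') => t; rewrite normcE_C ltcR.
- move=> h; apply/cvgrPdist_lt => e e0.
  have e_real : e = (complex.Re e)%:C.
    by move: e0; case: e => x y; rewrite ltcE /= => /andP[/eqP -> _].
  rewrite e_real ltcR in e0 *.
  by apply: filterS (h _ e0) => t; rewrite normcE_C ltcR.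
Qed.

Lemma cvg_real_complex (f : T -> R) (l : R) : f @ F --> l ->
  (fun t => (f t)%:C : (R[i] : numFieldType)) @ F --> (l%:C : (R[i] : numFieldType)).
Proof.
move=> /cvgrPdist_lt h; apply/cvg_complexP => e /h; apply: filterS => t.
by rewrite -rmorphB /= expr0n addr0 sqrtr_sqr.
Qed.

Lemma cvg_Re (f : T -> (R[i] : numFieldType)) (l : (R[i] : numFieldType)) :
  f @ F --> l -> (fun t => complex.Re (f t)) @ F --> complex.Re l.
Proof.
move=> /cvg_complexP h; apply/cvgrPdist_lt => e /h; apply: filterS => t.
apply: le_lt_trans; move: {h} l (f t) => [a b] [c d] /=.
by rewrite -[leLHS]sqrtr_sqr ler_wsqrtr// lerDl sqr_ge0.
Qed.
End complex_limits.

Section kernel_powers.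
Local Open Scope complex_scope.
Context {R : realType} {G H : topGroupType}.
Hypotheses (lcG : lcsc_hausdorff G) (lcH : lcsc_hausdorff H).
Variables (U K : set (G * H)) (v : H -> R).
Hypotheses (openU : open U) (U1 : U 1%g) (vwin : window v).
Local Notation Z := (G * H)%type.
Local Notation C := (R[i] : numFieldType).
Local Notation lshift := Defs.lshift.
Local Notation pt D := (wpts v (pts (\val D))).
Local Notation wt D := (@weight R G H v (pts (\val D))).
Local Notation lam a D := (@lam R G H U K v a D).
Local Notation kernel := (Defs.kernel R U K).
Implicit Types (a b : kernel) (D : Del U K).

Definition pair_dom : set (Z * Del U K * Z) :=
  [set q | pts (\val q.1.2) q.1.1 /\ pts (\val q.1.2) q.2].

(** Continuity at the pairs of points of a common Delone set, whether or not
    they lie over the support of [v]. *)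
Definition kernel_continuous (f : Z -> Del U K -> Z -> C) := forall D (x y : Z),
  pts (\val D) x -> pts (\val D) y ->
  (fun q => f q.1.1 q.1.2 q.2) @ within pair_dom (nbhs (x, D, y)) --> f x D y.

Definition half_weight (x : Z) : R := Num.sqrt (v x.2).
Local Notation hw := half_weight.

Let v_ge0 h : 0 <= v h. Proof. by case: vwin. Qed.

Lemma half_weight_ge0 x : 0 <= hw x. Proof. exact: sqrtr_ge0. Qed.

Lemma half_weight_sqr x : hw x * hw x = v x.2.
Proof. by rewrite -expr2 sqr_sqrtr. Qed.

Lemma half_weight_eq0 x : (hw x == 0) = (v x.2 == 0).
Proof. by rewrite -half_weight_sqr mulf_eq0 orbb. Qed.

Lemma half_weight_continuous : continuous hw.
Proof.
move=> x; apply: (@continuous_comp _ _ _ (fun x : Z => v x.2) Num.sqrt).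
  by apply: (@continuous_comp _ _ _ snd v); [exact: cvg_snd|case: vwin.1 => cv _; exact: cv].
exact: sqrt_continuous.
Qed.

Lemma half_weight_tsupport x : hw x != 0 -> tsupport v x.2.
Proof. by rewrite half_weight_eq0 => vx; exact: subset_closure. Qed.

(** Conjugating by the unitary that multiplies with the square root of the
    weight turns the weighted space into plain l^2 and the kernel [a] into this
    kernel, which extends continuously by 0 outside of the support of [v]. *)
Definition flat_kernel a : Z -> Del U K -> Z -> C :=
  fun x D y => (hw x)%:C * a x D y * (hw y)%:C.

Lemma flat_kernel_range a : finite_type v a -> exists2 Ka : set G, compact Ka &
  forall x D y, pts (\val D) x -> pts (\val D) y -> flat_kernel a x D y != 0 ->
    Ka (x^-1 * y)%g.1 /\ tsupport v y.2.
Proof.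
move=> [_ _ [Ka [cK _ aK]] _]; exists Ka => // x D y Dx Dy.
rewrite /flat_kernel !mulf_eq0 !negb_or => /andP[/andP[hx axy] hy].
have hx' : hw x != 0 by apply: contraNneq hx => ->.
have hy' : hw y != 0 by apply: contraNneq hy => ->.
have sx := half_weight_tsupport hx'; have sy := half_weight_tsupport hy'.
split=> //; apply: contrapT => nK; move/eqP: axy; apply.
exact: (aK x D y).
Qed.

Let hw_fst D (x y : Z) : (fun q : Z * Del U K * Z => hw q.1.1) @ nbhs (x, D, y) --> hw x.
Proof.
apply: (@continuous_comp _ _ _ (fun q : Z * Del U K * Z => q.1.1) hw (x, D, y)).
  by apply: (@continuous_comp _ _ _ fst fst (x, D, y)); exact: cvg_fst.
exact: half_weight_continuous.
Qed.

Let hw_snd D (x y : Z) : (fun q : Z * Del U K * Z => hw q.2) @ nbhs (x, D, y) --> hw y.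
Proof.
apply: (@continuous_comp _ _ _ snd hw (x, D, y)); first exact: cvg_snd.
exact: half_weight_continuous.
Qed.

(** Where the weight vanishes, boundedness of [a] and smallness of the weight
    give the limit 0; elsewhere [kdom] contains a neighbourhood of the point
    within [pair_dom]. *)
Lemma flat_kernel_continuous a : finite_type v a -> kernel_continuous (flat_kernel a).
Proof.
move=> [ca [M aM] _ _] D x y Dx Dy.
have hx := @hw_fst D x y; have hy := @hw_snd D x y.
have [xy0|xy0] := eqVneq (hw x * hw y) 0.
  have -> : flat_kernel a x D y = 0.
    rewrite /flat_kernel mulrAC -rmorphM /= xy0 mul0r //.
  apply/cvg_complexP => e e0.
  have M0 : 0 < `|M| + 1 by rewrite ltr_wpDl.
  have small : \forall q \near nbhs (x, D, y), hw q.1.1 * hw q.2 < e / (`|M| + 1).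
    have /cvgrPdist_lt h : (fun q : Z * Del U K * Z => hw q.1.1 * hw q.2) @ nbhs (x, D, y) --> (0 : R).
      by rewrite -xy0; exact: cvgM hx hy.
    apply: filterS (h _ (divr_gt0 e0 M0)) => q; rewrite sub0r normrN ger0_norm//.
    by rewrite mulr_ge0 ?half_weight_ge0.
  apply: filterS small => -[[x' D'] y'] /= sm [/= Dx' Dy']; rewrite sub0r normcN.
  have [z0|z0] := eqVneq (hw x' * hw y') 0.
    by rewrite /flat_kernel mulrAC -rmorphM /= z0 mul0r normc0.
  have [hx' hy'] : hw x' != 0 /\ hw y' != 0 by apply/andP; rewrite -negb_or -mulf_eq0.
  have ka : kdom v (x', D', y') by split=> //; exact: half_weight_tsupport.
  have := aM _ _ _ ka; rewrite lecE /= => /andP[_ le].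
  rewrite /flat_kernel mulrAC -rmorphM /= normcM [normc _%:C]/= expr0n addr0 sqrtr_sqr.
  rewrite ger0_norm ?mulr_ge0 ?half_weight_ge0//.
  have {}le : normc (a x' D' y') <= `|M| + 1.
    by apply: le_trans le _; apply: le_trans (ler_norm _) _; rewrite lerDl.
  apply: le_lt_trans (_ : hw x' * hw y' * (`|M| + 1) < e).
    by rewrite ler_wpM2l// mulr_ge0 ?half_weight_ge0.
  by rewrite -ltr_pdivlMr.
have [hx0 hy0] : hw x != 0 /\ hw y != 0 by apply/andP; rewrite -negb_or -mulf_eq0.
have ka : kdom v (x, D, y) by split=> //; exact: half_weight_tsupport.
have wx : (fun q : Z * Del U K * Z => (hw q.1.1)%:C : C) @
    within pair_dom (nbhs (x, D, y)) --> ((hw x)%:C : C).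
  by apply: cvg_real_complex; exact: cvg_within_filter.
have wy : (fun q : Z * Del U K * Z => (hw q.2)%:C : C) @
    within pair_dom (nbhs (x, D, y)) --> ((hw y)%:C : C).
  by apply: cvg_real_complex; exact: cvg_within_filter.
rewrite /flat_kernel; apply: cvgM wy; apply: cvgM wx _.
move/subspace_continuousP: ca => /(_ (x, D, y) ka) ca W nW.
have := ca W nW; rewrite /= !nbhs_simpl /= /within /= => nca.
have nx : \forall q \near nbhs (x, D, y), hw q.1.1 != 0.
  exact: (cvgr_neq0 _ hx).
have ny : \forall q \near nbhs (x, D, y), hw q.2 != 0.
  exact: (cvgr_neq0 _ hy).
apply: filterS3 nca nx ny => -[[x' D'] y'] /= h hx' hy' [/= Dx' Dy'].
by apply: h; split=> //; exact: half_weight_tsupport.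
Qed.

(** The entries of the [i]-th power of the operator of [a], multiplied on both
    sides by the square root of the weight (see [kernel_power_entry]). *)
Fixpoint kernel_power a i (x : Z) D (y : Z) : C :=
  if i is j.+1 then
    \sum_(z \in pts (\val D)) flat_kernel a x D z * kernel_power a j z D y
  else (x == y)%:R * (v x.2)%:C.

Lemma delone_Del D : delone U K (pts (\val D)).
Proof. exact: (set_valP D). Qed.

Let pair_filter D (x y : Z) (O : set Z) (B : set (Del U K)) (O' : set Z) :
  nbhs x O -> nbhs D B -> nbhs y O' ->
  \forall q \near within pair_dom (nbhs (x, D, y)),
    [/\ O q.1.1, B q.1.2, O' q.2 & pair_dom q].
Proof.
move=> nO nB nO'; exists ((O `*` B), O') => /=; first by split=> //; exists (O, B).
by move=> [[x' D'] y'] /= [[Ox By] O'y] Xq.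
Qed.

(** The filter of triples of points of a common Delone set: along it, a kernel
    that is continuous on pairs can be read off at [(x, D, z)] and at
    [(z, D, y)]. *)
Let triple_filter D (x y z : Z) := within
  [set q : (Z * Del U K * Z) * Z | pts (\val q.1.1.2) q.2]
  (filter_prod (within pair_dom (nbhs (x, D, y))) (nbhs z)).

Let kernel_pull_left (f : Z -> Del U K -> Z -> C) D (x y z : Z) :
  kernel_continuous f -> pts (\val D) x -> pts (\val D) z ->
  (fun q : (Z * Del U K * Z) * Z => f q.1.1.1 q.1.1.2 q.2) @ triple_filter D x y z --> f x D z.
Proof.
move=> cf Dx Dz W nW; have := cf D x z Dx Dz W nW.
rewrite /= !nbhs_simpl /= => -[[/= P Q] [/= [[/= O B] [/= nO nB] OB] nQ] PQ].
exists ([set q | [/\ O q.1.1, B q.1.2, setT q.2 & pair_dom q]], Q) => /=.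
  by split=> //; exact: pair_filter nO nB filterT.
move=> [[[x' D'] y'] z'] /= [[/= Ox By _ [/= Dx' Dy']] Qz] Dz'.
by apply: (PQ (x', D', z')) => //; split=> //=; exact: OB.
Qed.

Let kernel_pull_right (f : Z -> Del U K -> Z -> C) D (x y z : Z) :
  kernel_continuous f -> pts (\val D) z -> pts (\val D) y ->
  (fun q : (Z * Del U K * Z) * Z => f q.2 q.1.1.2 q.1.2) @ triple_filter D x y z --> f z D y.
Proof.
move=> cf Dz Dy W nW; have := cf D z y Dz Dy W nW.
rewrite /= !nbhs_simpl /= => -[[/= P Q] [/= [[/= O B] [/= nO nB] OB] nQ] PQ].
exists ([set q | [/\ setT q.1.1, B q.1.2, Q q.2 & pair_dom q]], O) => /=.
  by split=> //; exact: pair_filter filterT nB nQ.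
move=> [[[x' D'] y'] z'] /= [[/= _ By Qy [/= Dx' Dy']] Oz] Dz'.
by apply: (PQ (z', D', y')) => //; split=> //=; exact: OB.
Qed.

(** For [i = 0], two points of a Delone set in a common translate of [U] are
    equal, so the diagonal is relatively open; it is closed since [G * H] is
    Hausdorff. For larger powers, the points [z] that contribute near [x] stay in
    a compact set, and [cvg_local_sum] applies. *)
Lemma kernel_power_continuous a i : finite_type v a -> kernel_continuous (kernel_power a i).
Proof.
move=> fa; elim: i => [|i IH] D x y Dx Dy /=.
  have [<-|xy] := eqVneq x y.
    have vx : (fun q : Z * Del U K * Z => (v q.1.1.2)%:C : C) @
        within pair_dom (nbhs (x, D, x)) --> (1 * (v x.2)%:C : C).
      rewrite mul1r; apply: cvg_real_complex; apply: cvg_within_filter.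
      apply: (@continuous_comp _ _ _ (fun q : Z * Del U K * Z => q.1.1.2) v (x, D, x)).
        by apply: (@continuous_comp _ _ _ (fun q : Z * Del U K * Z => q.1.1) snd (x, D, x));
          [apply: (@continuous_comp _ _ _ fst fst (x, D, x)); exact: cvg_fst|exact: cvg_snd].
      by case: vwin.1 => cv _; exact: cv.
    apply: cvg_trans vx; apply: near_eq_cvg.
    have nU : nbhs x (lshift x U).
      by apply: open_nbhs_nbhs; split; [exact: lshift_open|exact: lshift_id].
    apply: filterS (pair_filter nU filterT nU) => -[[x' D'] y'] /= [Ux _ Uy [/= Dx' Dy']].
    have [_ /(_ x x' y') xy' _] := delone_Del D'.
    by rewrite (xy' _ _) ?eqxx ?mul1r//; split.
  rewrite mul0r; have hZ := Z_hausdorff lcG lcH.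
  move: hZ; rewrite open_hausdorff => /(_ _ _ xy)[[ O O'] [/= /set_mem Ox /set_mem Oy]].
  move=> [oO oO' /eqP OO'].
  have nO : nbhs x O by exact: open_nbhs_nbhs.
  have nO' : nbhs y O' by exact: open_nbhs_nbhs.
  have z0 : (fun _ : Z * Del U K * Z => 0 : C) @ within pair_dom (nbhs (x, D, y)) --> (0 : C).
    exact: cvg_cst.
  apply: cvg_trans z0; apply: near_eq_cvg.
  apply: filterS (pair_filter nO filterT nO') => -[[x' D'] y'] /= [Ox' _ Oy' _].
  have [xy'|_] := eqVneq x' y'; last by rewrite mul0r.
  by exfalso; rewrite -[False]/((set0 : set Z) x') -OO'; split; rewrite // xy'.
have [Ka cK aK] := flat_kernel_range fa; have [[_ cS] _] := vwin.
have [lG _ hG] := lcG.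
have [V nV [cV clV]] := lG x.1 I.
have nV' : nbhs x (fst @^-1` V).
  by apply: (@cvg_fst _ _ (nbhs x.1) (nbhs x.2)); move: nV; rewrite withinET.
pose S := [set g | exists2 h, V h & Ka (h^-1 * g)%g] `*` tsupport v.
have cC : compact S.
  apply: compact_setX => //.
  have -> : [set g | exists2 h, V h & Ka (h^-1 * g)%g] =
      (fun p : G * G => (p.1 * p.2)%g) @` (V `*` Ka).
    apply/seteqP; split=> [g [h Vh hg]|_ [[h g] [/= Vh Kg] <-]].
      by exists (h, (h^-1 * g)%g) => //=; rewrite mulVKg.
    by exists h => //; rewrite mulKg.
  apply: continuous_compact; last exact: compact_setX.
  exact/continuous_subspaceT/mulg_continuous.
apply: (cvg_local_sum lcG lcH openU U1 (D := fun q : Z * Del U K * Z => \val q.1.2)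
  (f := fun q z => flat_kernel a q.1.1 q.1.2 z * kernel_power a i z q.1.2 q.2) _ (delone_Del D) _ cC).
- by move=> q; exact: delone_Del.
- apply: cvg_within_filter.
  apply: (@continuous_comp _ _ _ (fun q : Z * Del U K * Z => q.1.2)
    (fun D : Del U K => \val D) (x, D, y)).
    by apply: (@continuous_comp _ _ _ fst snd (x, D, y)); [exact: cvg_fst|exact: cvg_snd].
  exact: val_continuous.
- apply: filterS (pair_filter nV' filterT filterT) => -[[x' D'] y'] /= [Vx _ _ [/= Dx' Dy']] z Dz nS.
  have [->|nz] := eqVneq (flat_kernel a x' D' z) 0; first by rewrite mul0r.
  have [Kz vz] := aK _ _ _ Dx' Dz nz.
  by exfalso; apply: nS; split=> //=; exists x'.1.
- move=> z Dz nS.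
  have [->|nz] := eqVneq (flat_kernel a x D z) 0; first by rewrite mul0r.
  have [Kz vz] := aK _ _ _ Dx Dz nz.
  exfalso; apply: nS; split=> //=; exists x.1 => //.
  exact: (nbhs_singleton nV').
- move=> z Dz; apply: cvgM.
  + exact: (@kernel_pull_left (flat_kernel a) D x y z (flat_kernel_continuous fa) Dx Dz).
  + exact: (@kernel_pull_right (kernel_power a i) D x y z IH Dz Dy).
Qed.

End kernel_powers.

(** * The local density of states *)

Lemma uniform_limit_continuous {R : realType} {X : topologicalType} (f : X -> R) :
  (forall e : R, 0 < e -> exists g : X -> R, continuous g /\ forall x, `|f x - g x| <= e) ->
  continuous f.
Proof.
move=> h x; apply/cvgrPdist_lt => e e0.
have e40 : 0 < e / 4 by rewrite divr_gt0.
have [g [cg fg]] := h _ e40.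
move/cvgrPdist_lt: (cg x) => /(_ _ e40); apply: filterS => y.
have := fg x; have := fg y; rewrite !ler_norml !ltr_norml.
by move=> /andP[? ?] /andP[? ?] /andP[? ?]; apply/andP; split; lra.
Qed.

Lemma pform_close {R : realType} {T : choiceType} (w : T -> R) (w_gt0 : forall x, 0 < w x)
    (A B : oper R T) (M e : R) : bounded_by w A M -> bounded_by w B M -> 1 <= M -> 0 <= e ->
  (forall u, l2 w u -> hnorm w (A u - B u) <= e * hnorm w u) ->
  forall (p : {poly R}) u, l2 w u -> `|pform w A u p - pform w B u p| <=
    (\sum_(i < size p) `|p`_i| * (i%:R * M ^+ i)) * e * hnorm w u ^+ 2.
Proof.
move=> bA bB M1 e0 close p u u2.
have rp2 C : bounded_by w C M -> l2 w (rpeval C p u).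
  move=> bC; have [N [_ _ h _]] := peval_bounded w_gt0 bC (map_poly (real_complex R) p).
  exact: h.
have d2 := l2B w_gt0 (rp2 _ bA) (rp2 _ bB).
have -> : pform w A u p - pform w B u p = complex.Re (inner w u (rpeval A p u - rpeval B p u)).
  have := innerDr w_gt0 u2 d2 (rp2 _ bB); rewrite subrK /pform => ->.
  by move: (inner _ _ _) (inner _ _ _) => [a b] [c d] /=; rewrite addrK.
apply: le_trans (Re_le_normc _) _; apply: le_trans (cauchy_schwarz w_gt0 u2 d2) _.
rewrite mulrC expr2 mulrA ler_wpM2r ?hnorm_ge0//.
exact: (rpeval_close w_gt0 bA bB M1 e0 close p u2).
Qed.

Section local_density.
Local Open Scope complex_scope.
Context {R : realType} {G H : topGroupType}.
Hypotheses (lcG : lcsc_hausdorff G) (lcH : lcsc_hausdorff H).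
Variables (U K : set (G * H)) (v : H -> R).
Hypotheses (openU : open U) (U1 : U 1%g) (vwin : window v).
Local Notation Z := (G * H)%type.
Local Notation C := (R[i] : numFieldType).
Local Notation lshift := Defs.lshift.
Local Notation pt D := (wpts v (pts (\val D))).
Local Notation wt D := (@weight R G H v (pts (\val D))).
Local Notation lam a D := (@lam R G H U K v a D).
Local Notation hw := (half_weight v).
Local Notation kernel := (Defs.kernel R U K).
Implicit Types (D : Del U K).

Let w0 D := @wt_gt0 R G H U K v vwin D.

Lemma kernel_power_entry (a : kernel) i D (x y : pt D) : tame v a ->
  (hw (\val x))%:C * iter i (lam a D) (point_mass y) x * (hw (\val y))%:C =
  kernel_power v a i (\val x) D (\val y).
Proof.
move=> [M [Ka [M0 cK KV aM aK]]]; elim: i x => [|i IH] x /=.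
  rewrite /point_mass val_eqE; have [->|_] := eqVneq x y; last by rewrite mulr0 !mul0r.
  by rewrite mulr1 mul1r -rmorphM /= (half_weight_sqr vwin).
have [N /(_ D)[nb [nbu _ nbP]]] := neighbour_lists K openU U1 vwin cK.
have out (x' z : pt D) : z \notin nb x' -> a (\val x') D (\val z) = 0.
  by move=> /negP zx; apply: aK => Kz; apply: zx; apply/nbP.
rewrite -(fsbig_widen [set` map \val (nb x)] (pts (\val D))); last 2 first.
- by move=> _ /mapP[z _ ->]; case: (wptsP z).
- move=> z [Dz /= zx]; have [hz|hz] := eqVneq (hw z) 0.
    by rewrite /flat_kernel hz mulr0 mul0r.
  have vz : v z.2 != 0 by rewrite -(half_weight_eq0 vwin).
  have Pz : pt D z by split.
  pose z' : pt D := exist _ z (mem_set Pz).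
  rewrite /flat_kernel (out x z') ?mulr0 ?mul0r//.
  by apply/negP => zn; apply: zx; apply/mapP; exists z'.
rewrite -fsbig_seq; last by rewrite map_inj_uniq //; exact: val_inj.
rewrite big_map lam_kernel_oper (kernel_operE _ nbu out) mulr_sumr mulr_suml.
apply: eq_bigr => z _; rewrite -IH /flat_kernel.
have -> : (wt D z)%:C = (hw (\val z))%:C * (hw (\val z))%:C.
  by rewrite -rmorphM /= (half_weight_sqr vwin).
move: (a _ _ _) (iter _ _ _ _) (hw _)%:C (hw _)%:C (hw _)%:C => p q r s t; ring.
Qed.

Variables (rho : G -> R) (rhoCc : Cc rho) (rho_ge0 : forall g, 0 <= rho g).

(** The support conditions on [rho] and [v] leave a number of terms bounded
    independently of the Delone set. *)
Lemma local_points : exists N, forall D, exists t : seq (pt D), (size t <= N)%N /\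
  forall h : Z -> C, (forall z, v z.2 = 0 -> h z = 0) ->
    complex.Re (\sum_(z \in pts (\val D)) (rho z.1)%:C * h z) =
    \sum_(x <- t) rho (\val x).1 * complex.Re (h (\val x)).
Proof.
have [[_ cS] _] := vwin; have [_ cR] := rhoCc.
have [N count] := delone_count K openU U1 (compact_setX cR cS).
exists N => D; have [t [ut tN tP]] := count _ 1%g (delone_Del D).
have inC z : lshift 1%g (tsupport rho `*` tsupport v) z = (tsupport rho z.1 /\ tsupport v z.2).
  by rewrite lshiftE /= !invg1 !mul1g.
pose s : seq (pt D) := pmap insub t.
exists s; split; first by rewrite size_pmap_sub; apply: leq_trans (count_size _ _) tN.
move=> h h0; rewrite -(fsbig_widen [set` map \val s] (pts (\val D))).
- rewrite -fsbig_seq; last by rewrite map_inj_uniq ?pmap_sub_uniq //; exact: val_inj.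
  rewrite big_map; elim: s => [|z r IH]; first by rewrite !big_nil.
  rewrite !big_cons -IH; move: (bigop _ _ _) (h (\val z)) => [x x'] [y y'] /=.
  by rewrite mul0r subr0.
- by move=> _ /mapP[z _ ->]; case: (wptsP z).
- move=> z [Dz /= zs].
  have [vz|vz] := eqVneq (v z.2) 0; first by rewrite h0// mulr0.
  have [rz|rz] := eqVneq (rho z.1) 0; first by rewrite rz mul0r.
  have Pz : pt D z by split.
  exfalso; apply: zs; apply/mapP; exists (exist _ z (mem_set Pz)) => //.
  rewrite mem_pmap_sub; apply/tP; split=> //; rewrite inC.
  by split; exact: subset_closure.
Qed.

Variables (a : completion U K v) (A : oper_family U K v).
Arguments A : clear implicits.
Hypotheses (sa : completion_selfadj a) (aA : forall D, is_lam a (A D)).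

Definition local_entry (phi : R -> R) D (z : Z) : C :=
  inner (wt D) (delta z) (funcalc (wt D) phi (A D) (delta z)).

(** The integrand of [dos_functional]. *)
Definition local_dos (phi : R -> R) D : R :=
  complex.Re (\sum_(z \in pts (\val D)) (rho z.1)%:C * local_entry phi D z).

Let bound := family_bounded openU U1 vwin aA.
Let selfadj D := family_selfadj openU U1 vwin aA sa (D := D).

Let deltaE D (x : pt D) : delta (\val x) = point_mass x.
Proof. by apply/funext => y; rewrite /delta /point_mass val_eqE. Qed.

Let local_entry0 phi D z : v z.2 = 0 -> local_entry phi D z = 0.
Proof.
move=> vz; rewrite /local_entry.
have d0 : @delta R G H v (pts (\val D)) z = fun=> 0.
  apply/funext => y; rewrite /delta; case: eqP => // yz.
  by have [_] := wptsP y; rewrite yz vz eqxx.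
rewrite d0 /inner /csum.
have z0 : rsum (fun _ : pt D => (0 : R)) = 0.
  rewrite rsum_nneg//; last by rewrite esum1.
  by rewrite esum1.
rewrite (_ : (fun x => complex.Re _) = fun=> 0) ?z0; last first.
  by apply/funext => x; case: (funcalc _ _ _ _ _) => p q /=; ring.
rewrite (_ : (fun x => complex.Im _) = fun=> 0) ?z0//.
by apply/funext => x; case: (funcalc _ _ _ _ _) => p q /=; ring.
Qed.

Let entry_qform phi D (x : pt D) :
  complex.Re (local_entry phi D (\val x)) = qform (wt D) (A D) (point_mass x) phi.
Proof. by rewrite /local_entry deltaE. Qed.

(** The same list [t] serves for all integrands, so that [local_dos] and
    [poly_dos] can be compared term by term. *)
Lemma local_dos_qform : exists N, forall D, exists t : seq (pt D), (size t <= N)%N /\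
  (forall phi, local_dos phi D =
    \sum_(x <- t) rho (\val x).1 * qform (wt D) (A D) (point_mass x) phi) /\
  forall h : Z -> C, (forall z, v z.2 = 0 -> h z = 0) ->
    complex.Re (\sum_(z \in pts (\val D)) (rho z.1)%:C * h z) =
    \sum_(x <- t) rho (\val x).1 * complex.Re (h (\val x)).
Proof.
have [N tN] := local_points; exists N => D; have [t [ts tE]] := tN D.
exists t; do 2!split=> //; move=> phi.
rewrite /local_dos (tE _ (@local_entry0 phi D)); apply: eq_bigr => x _.
by rewrite entry_qform.
Qed.

Lemma local_dosD (phi psi : R -> R) D : continuous phi -> continuous psi ->
  local_dos (fun t => phi t + psi t) D = local_dos phi D + local_dos psi D.
Proof.
move=> cphi cpsi; have [M [_ [_ /(_ D) bA _]]] := bound.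
have [_ /(_ D)[t [_ [tE _]]]] := local_dos_qform.
rewrite !tE -big_split; apply: eq_bigr => x _.
rewrite (qformD (@w0 D) bA (@selfadj D) (l2_point_mass (@w0 D) x) cphi cpsi).
exact: mulrDr.
Qed.

Lemma local_dosZ (c : R) (phi : R -> R) D : continuous phi ->
  local_dos (fun t => c * phi t) D = c * local_dos phi D.
Proof.
move=> cphi; have [M [_ [_ /(_ D) bA _]]] := bound.
have [_ /(_ D)[t [_ [tE _]]]] := local_dos_qform.
rewrite !tE mulr_sumr; apply: eq_bigr => x _.
rewrite (qformZ (@w0 D) bA (@selfadj D) (l2_point_mass (@w0 D) x) c cphi).
exact: mulrCA.
Qed.

Lemma local_dos_ge0 : exists2 M : R, 0 < M & forall (phi : R -> R) D, continuous phi ->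
  (forall t, `|t| <= M -> 0 <= phi t) -> 0 <= local_dos phi D.
Proof.
have [M [_ [M1 bA _]]] := bound; exists M; first exact: lt_le_trans M1.
move=> phi D cphi phi0; have [_ /(_ D)[t [_ [tE _]]]] := local_dos_qform.
rewrite tE; apply: sumr_ge0 => x _; apply: mulr_ge0 => //.
exact: (qform_ge0 (@w0 D) (bA D) (@selfadj D) (l2_point_mass (@w0 D) x)).
Qed.

Definition poly_entry (p : {poly R}) n D (z : Z) : C :=
  \sum_(i < size p) (p`_i)%:C * kernel_power v (a n) i z D z.

(** The analogue of [local_dos] for the operator of the kernel [a n] in place of
    [A] and the polynomial [p] in place of [phi]. *)
Definition poly_dos (p : {poly R}) n D : R :=
  complex.Re (\sum_(z \in pts (\val D)) (rho z.1)%:C * poly_entry p n D z).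

Let kernel_power0 n i D (z y : Z) : v z.2 = 0 -> kernel_power v (a n) i z D y = 0.
Proof.
move=> vz; case: i => [|i] /=; first by rewrite vz mulr0.
apply: fsbig1 => x _; rewrite /flat_kernel (_ : hw z = 0) ?mul0r//.
by apply/eqP; rewrite (half_weight_eq0 vwin) vz.
Qed.

Let poly_entry0 p n D z : v z.2 = 0 -> poly_entry p n D z = 0.
Proof.
by move=> vz; rewrite /poly_entry big1// => i _; rewrite kernel_power0 ?mulr0.
Qed.

Let poly_entry_pform p n D (x : pt D) :
  complex.Re (poly_entry p n D (\val x)) = pform (wt D) (lam (a n) D) (point_mass x) p.
Proof.
rewrite /pform -poly_operE inner_point_mass /poly_oper; congr complex.Re.
rewrite fct_sumE mulr_suml; apply: eq_bigr => i _.
rewrite -(kernel_power_entry _ _ _ (kseq_tame a n)).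
have -> : (wt D x)%:C = (hw (\val x))%:C * (hw (\val x))%:C.
  by rewrite -rmorphM /= (half_weight_sqr vwin).
rewrite [X in _ = X * _](_ : _ = (p`_i)%:C * iter i (lam (a n) D) (point_mass x) x) //.
move: (iter _ _ _ _) (hw _)%:C (p`_i)%:C => q r s; ring.
Qed.

Lemma poly_dos_continuous p n : continuous (poly_dos p n).
Proof.
move=> D.
have key : (fun D' : Del U K => \sum_(z \in pts (\val D')) (rho z.1)%:C * poly_entry p n D' z : C)
    @ nbhs D --> (\sum_(z \in pts (\val D)) (rho z.1)%:C * poly_entry p n D z : C); last first.
  exact: (@cvg_Re R _ (nbhs D) (nbhs_filter D) _ _ key).
have [[_ cS] _] := vwin; have [_ cR] := rhoCc.
apply: (@cvg_local_sum G H lcG lcH U K openU U1 C (Del U K) (nbhs D) (nbhs_filter D)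
  (fun D : Del U K => \val D) (\val D) _ (fun D z => (rho z.1)%:C * poly_entry p n D z)
  _ _ (delone_Del D) _ (compact_setX cR cS)).
- exact: delone_Del.
- exact: val_continuous.
- apply: filterE => D' z _ nS.
  have [vz|vz] := eqVneq (v z.2) 0; first by rewrite poly_entry0// mulr0.
  have [->|rz] := eqVneq (rho z.1) 0; first by rewrite mul0r.
  by exfalso; apply: nS; split; exact: subset_closure.
- move=> z _ nS.
  have [vz|vz] := eqVneq (v z.2) 0; first by rewrite poly_entry0// mulr0.
  have [->|rz] := eqVneq (rho z.1) 0; first by rewrite mul0r.
  by exfalso; apply: nS; split; exact: subset_closure.
- move=> z Dz; apply: cvgM.
    apply: cvg_real_complex; apply: cvg_within_filter.
    apply: (@continuous_comp _ _ _ (fun q : Del U K * Z => q.2.1) rho (D, z)).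
      by apply: (@continuous_comp _ _ _ snd fst (D, z)); [exact: cvg_snd|exact: cvg_fst].
    by case: rhoCc => cr _; exact: cr.
  apply: cvg_seq_sum => i; apply: cvgM; first exact: cvg_cst.
  move=> W nW.
  have := kernel_power_continuous lcG lcH openU U1 vwin (i := i) (kseq_finite_type a n) Dz Dz nW.
  rewrite /= !nbhs_simpl /= => -[[/= P Q] [/= [[/= O B] [/= nO nB] OB] nQ] PQ].
  exists (B, O `&` Q) => /=; first by split=> //; exact: filterI.
  move=> [D' z'] /= [By [Oz Qz]] Dz'.
  by apply: (PQ (z', D', z')) => //; split=> //=; exact: OB.
Qed.

(** The approximation of [phi(A_D)] by [p(A_D)], and of [p(A_D)] by [p] at the
    operator of a kernel of finite type, are both uniform in the Delone set, and
    so is the number of terms; the functions [poly_dos] are continuous. *)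
Lemma local_dos_continuous (phi : R -> R) : continuous phi -> continuous (local_dos phi).
Proof.
move=> cphi; apply: uniform_limit_continuous => e e0.
have [M [N0 [M1 bA bl]]] := bound.
have M0 : 0 < M by exact: lt_le_trans M1.
have [B B0 rB] := Cc_bounded rhoCc; have [V V0 wV] := weight_bounded U K vwin.
have [N tN] := local_dos_qform.
(* At most [N] terms, each the product of a value of [rho], at most [B], and of
   two approximation errors of a form at a vector of squared norm at most [V]. *)
pose k := N%:R * (B * (V + V)) + 1.
have k0 : 0 < k by rewrite /k ltr_wpDl// !mulr_ge0// addr_ge0.
pose e1 := e / k; have e10 : 0 < e1 by exact: divr_gt0.
have [p pe] := weierstrass M0 cphi e10.
(* A Lipschitz constant of [p] on operators of norm at most [M]. *)
pose c := \sum_(i < size p) `|p`_i| * (i%:R * M ^+ i).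
have c0 : 0 <= c by apply: sumr_ge0 => i _; rewrite !mulr_ge0// exprn_ge0// ltW.
pose e2 := e1 / (c + 1).
have e20 : 0 < e2 by rewrite divr_gt0// ltr_wpDl.
have [N1 close] := lam_uniform_cvg openU U1 vwin aA e20.
pose n := maxn N0 N1; exists (poly_dos p n); split; first exact: poly_dos_continuous.
move=> D; have [t [ts [tE hE]]] := tN D.
rewrite tE /poly_dos (hE _ (@poly_entry0 p n D)) -sumrB.
have term (x : pt D) : `|rho (\val x).1 * qform (wt D) (A D) (point_mass x) phi -
    rho (\val x).1 * complex.Re (poly_entry p n D (\val x))| <= B * (V + V) * e1.
  rewrite poly_entry_pform -mulrBr normrM -mulrA; apply: ler_pM => //.
  have d2 := l2_point_mass (@w0 D) x; have dn := hnorm_point_mass (@w0 D) x.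
  rewrite -(subrKA (pform (wt D) (A D) (point_mass x) p)).
  apply: le_trans (ler_normD _ _) _; rewrite mulrDl; apply: lerD.
    have := qform_approx (@w0 D) (bA D) (@selfadj D) d2 cphi (ltW e10) pe.
    rewrite dn => h; apply: le_trans h _; rewrite mulrC ler_wpM2r// ltW //.
  have cl u : l2 (wt D) u -> hnorm (wt D) (A D u - lam (a n) D u) <= e2 * hnorm (wt D) u.
    move=> u2; rewrite -(hnormN (@w0 D)) ?opprB; first exact: close (leq_maxr _ _) _.
    by apply: (l2B (@w0 D)); [case: (bA D) => _ _ h _; exact: h|exact: lam_l2].
  have := pform_close (@w0 D) (bA D) (bl n D (leq_maxl _ _)) M1 (ltW e20) cl p d2.
  rewrite dn -/c => h; apply: le_trans h _; rewrite mulrC; apply: ler_pM => //.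
  + exact: ltW.
  + by rewrite mulr_ge0// ltW.
  rewrite /e2 mulrA ler_pdivrMr ?ltr_wpDl// mulrC ler_wpM2l//; first exact: ltW.
  by rewrite lerDl.
have sum_le (r : seq (pt D)) (f : pt D -> R) (b : R) : (forall x, `|f x| <= b) ->
    `|\sum_(x <- r) f x| <= (size r)%:R * b.
  move=> fb; elim: r => [|x r IH]; first by rewrite big_nil normr0 mul0r.
  rewrite big_cons -natr1 mulrDl mul1r addrC; apply: le_trans (ler_normD _ _) _.
  exact: lerD.
apply: le_trans (sum_le _ _ _ term) _.
apply: le_trans (_ : N%:R * (B * (V + V) * e1) <= _).
  apply: ler_wpM2r; last by rewrite ler_nat.
  exact: mulr_ge0 (mulr_ge0 B0 (addr_ge0 V0 V0)) (ltW e10).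
rewrite (_ : _ * _ = N%:R * (B * (V + V)) * e / k); last by rewrite /e1 !mulrA.
rewrite ler_pdivrMr// mulrC ler_wpM2l//; first exact: ltW.
by rewrite /k lerDl.
Qed.

End local_density.

(** * Means over hulls *)

(** The pullback along [j] allows means for measures on different spaces to be
    compared on the functions of a single space [Y]. *)
Section means.
Context {R : realType} {X : ptopologicalType} {Y : topologicalType}.
Variables (j : X -> Y) (mu : probability (borel X) R).
Hypothesis jcont : continuous j.
Hypothesis bounded : forall f : Y -> R, continuous f -> exists B : R, forall x, `|f (j x)| <= B.
Implicit Types f g : Y -> R.

Definition mean f : R := \int[mu]_x f (j x).

Let muT : mu [set: borel X] = 1%:E. Proof. exact: probability_setT. Qed.

Let int f : continuous f -> mu.-integrable setT (EFin \o (f \o j)).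
Proof.
move=> cf; apply: measurable_bounded_integrable => //.
- by have := ltry (1 : R); rewrite -muT.
- apply: (@continuous_borel_measurable R X (f \o j)) => x.
  by apply: continuous_comp; [exact: jcont|exact: cf].
- have [B fB] := bounded cf; exists B; split; first exact: num_real.
  by move=> M BM x _; apply: le_trans (fB x) (ltW BM).
Qed.

Lemma mean_integral f : continuous f -> (\int[mu]_x (f (j x))%:E = (mean f)%:E)%E.
Proof. by move=> cf; rewrite /mean /Rintegral fineK//; exact: integrable_fin_num (int cf). Qed.

Lemma meanD f g : continuous f -> continuous g ->
  mean (fun y => f y + g y) = mean f + mean g.
Proof. by move=> cf cg; rewrite /mean RintegralD//; exact: int. Qed.

Lemma meanZ (c : R) f : continuous f -> mean (fun y => c * f y) = c * mean f.
Proof. by move=> cf; rewrite /mean RintegralZl//; exact: int. Qed.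

Lemma mean_cst (c : R) : mean (fun=> c) = c.
Proof.
rewrite /mean Rintegral_cst//.
by rewrite -[RHS]mulr1 -[in RHS](_ : fine (mu [set: borel X]) = 1)// muT.
Qed.

Lemma le_mean f g : continuous f -> continuous g ->
  (forall x, f (j x) <= g (j x)) -> mean f <= mean g.
Proof.
move=> cf cg fg; apply: le_Rintegral => //; [exact: int|exact: int].
Qed.

Lemma mean_bounded f (B : R) : continuous f -> (forall x, `|f (j x)| <= B) -> `|mean f| <= B.
Proof.
move=> cf fB; rewrite ler_norml -{1}(mean_cst (- B)) -{2}(mean_cst B).
have fB' x : - B <= f (j x) <= B by rewrite -ler_norml.
apply/andP; split.
  apply: (@le_mean (fun=> - B) f) => // [|x]; first exact: cst_continuous.
  by case/andP: (fB' x).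
apply: (@le_mean f (fun=> B)) => // [|x]; first exact: cst_continuous.
by case/andP: (fB' x).
Qed.

Lemma mean_invariant (T : X -> X) f : continuous T -> continuous f ->
  (forall A : set (borel X), measurable A -> mu (T @^-1` A) = mu A) ->
  \int[mu]_x f (j (T x)) = mean f.
Proof.
move=> cT cf inv; rewrite /mean /Rintegral; congr fine.
have mT : measurable_fun [set: borel X] (T : borel X -> borel X).
  apply: (@measurability _ _ (borel X) (borel X) setT T (@open X) erefl).
  move=> _ [ O oO <-]; rewrite setTI; apply: borel_open.
  by move/continuousP: cT; exact.
have icf := int cf.
have mf : measurable_fun [set: borel X] (EFin \o (f \o j)) by case/integrableP: icf.
have cfT : continuous (fun x => f (j (T x))).
  move=> x; apply: (@continuous_comp _ _ _ T (f \o j)); first exact: cT.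
  by apply: continuous_comp; [exact: jcont|exact: cf].
have ifT : mu.-integrable setT ((EFin \o (f \o j)) \o T).
  apply: measurable_bounded_integrable => //.
  - by have := ltry (1 : R); rewrite -muT.
  - exact: (@continuous_borel_measurable R X _ cfT).
  - have [B fB] := bounded cf; exists B; split; first exact: num_real.
    by move=> M BM x _; apply: le_trans (fB _) (ltW BM).
have /= <- := integral_pushforward mT mf (ifT : mu.-integrable (T @^-1` setT) _) measurableT.
by apply: eq_measure_integral => A mA _; exact: inv.
Qed.
End means.

Section regular_separation.
Context {R : realType}.

Lemma completely_regular_separation {T : topologicalType} (O : set T) x :
  completely_regular_space T -> open O -> O x ->
  exists f : T -> R, [/\ continuous f, forall y, 0 <= f y <= 1, f x = 1 &
    forall z, ~ O z -> f z = 0].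
Proof.
move=> crT oO Ox; have nOx : ~ (~` O) x by [].
have /((@uniform_separatorP _ R _ _).1) [f [cf f01 f0 f1]] := crT x (~` O) (open_closedC oO) nOx.
exists (fun y => 1 - f y); split.
- rewrite (_ : (fun y => _) = fun y => (fun=> 1) y + -1 * f y); last first.
    by apply/funext => y; rewrite mulN1r.
  by apply: continuous_add; [exact: cst_continuous|exact: continuous_scale].
- move=> y; have : [set` `[0, 1]] (f y) by apply: f01; exists y.
  by rewrite /= in_itv /= => /andP[a b]; rewrite subr_ge0 b lerBlDr lerDl a.
- have -> : f x = 0 by apply: f0; exists x.
  by rewrite subr0.
- move=> z Oz; have -> : f z = 1 by apply: f1; exists z.
  by rewrite subrr.
Qed.
End regular_separation.

Section riesz_invariance.
Context {R : realType} {X : ptopologicalType} {Y : topologicalType}.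
Variables (j : X -> Y) (Lam : (Y -> R) -> R).

Let outer_le (T T' : X -> X) (S : Y -> Y) (A : set X) : continuous T' -> continuous S ->
  cancel T T' -> cancel T' T -> (forall x, j (T x) = S (j x)) ->
  (forall f : Y -> R, continuous f -> Lam (f \o S) = Lam f) ->
  (riesz_outer j Lam (T @` A) <= riesz_outer j Lam A)%E.
Proof.
move=> cT' cS TK T'K jT inv; apply: le_ereal_inf_tmp => _ [ O [oO AO] <-].
have oTO : open (T' @^-1` O) by move/continuousP: cT'; exact.
apply: le_trans (_ : riesz_inner j Lam (T' @^-1` O) <= _)%E.
  apply: ereal_inf_lbound; exists (T' @^-1` O) => //; split=> //.
  by move=> _ [x Ax <-]; rewrite /= TK; exact: AO.
apply: ge_ereal_sup => _ [f [cf f01 f0] <-]; rewrite -inv//.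
apply: ereal_sup_ubound; exists (f \o S) => //; split.
- by move=> y; apply: continuous_comp; [exact: cS|exact: cf].
- by move=> x; rewrite /= -jT.
- by move=> x nOx; rewrite /= -jT f0// /= TK.
Qed.

(** Composition with [S] maps the test functions below an open set onto those
    below its preimage, so invariance of the functional is inherited by the
    outer measure. *)
Lemma riesz_outer_invariant (T T' : X -> X) (S S' : Y -> Y) (A : set X) :
  continuous T -> continuous T' -> continuous S -> continuous S' ->
  cancel T T' -> cancel T' T ->
  (forall x, j (T x) = S (j x)) -> (forall x, j (T' x) = S' (j x)) ->
  (forall f : Y -> R, continuous f -> Lam (f \o S) = Lam f) ->
  (forall f : Y -> R, continuous f -> Lam (f \o S') = Lam f) ->
  riesz_outer j Lam (T @` A) = riesz_outer j Lam A.
Proof.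
move=> cT cT' cS cS' TK T'K jT jT' inv inv'.
apply/eqP; rewrite eq_le; apply/andP; split; first exact: (outer_le _ cT' cS).
rewrite -{1}(_ : T' @` (T @` A) = A); first exact: (outer_le _ cT cS').
apply/seteqP; split=> [_ [_ [x Ax <-] <-]|x Ax]; first by rewrite TK.
by exists (T x) => //; exists x.
Qed.
End riesz_invariance.

Section ultrafilter_limits.
Context {R : realType}.

Lemma ultra_cvg_real {T : Type} (F : set_system T) {FU : UltraFilter F} (u : T -> R) (B : R) :
  (forall t, `|u t| <= B) -> exists l : R, u @ F --> l.
Proof.
move=> uB.
have FB : (u @ F) [set` `[- B, B]].
  by rewrite /= nbhs_simpl /=; apply: filterE => t /=; rewrite in_itv /= -ler_norml.
have [l [_ lF]] := @segment_compact R (- B) B (u @ F) _ FB.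
exists l => W nW; have [//|FW] := in_ultra_setVsetC (u @^-1` W) FU.
exfalso; have [r [/= nWr Wr]] : (~` W) `&` W !=set0 by apply: lF.
exact: nWr.
Qed.

(** If a neighbourhood [W] of [l] failed to contain the sequence eventually, some
    ultrafilter would contain the indices of the terms outside [W]. *)
Lemma cvg_ultra (u : nat -> R) (l : R) :
  (forall F : set_system nat, UltraFilter F -> \oo `<=` F -> u @ F --> l) ->
  u @ \oo --> l.
Proof.
move=> h; apply: contrapT => ncv.
have [W [nW nu]] : exists W, nbhs l W /\ ~ \oo (u @^-1` W).
  apply: contrapT => hW; apply: ncv => W nW; apply: contrapT => nu.
  by apply: hW; exists W; split.
pose F0 := within (~` (u @^-1` W)) \oo.
have PF0 : ProperFilter F0.
  apply: Build_ProperFilter_ex => B; rewrite /F0 /within /= => hB.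
  apply: contrapT => nB; apply: nu; apply: filterS hB => n hn.
  by apply: contrapT => nW'; apply: nB; exists n; exact: hn.
have [F [FU F0F]] := ultraFilterLemma PF0.
have ooF : \oo `<=` F.
  by move=> B ooB; apply: F0F; rewrite /F0 /within /=; apply: filterS ooB.
have FW : F (u @^-1` W) by exact: h FU ooF _ nW.
have FnW : F (~` (u @^-1` W)).
  by apply: F0F; rewrite /F0 /within /=; apply: filterE.
by have := filter_ex (filterI FW FnW) => -[n []].
Qed.
End ultrafilter_limits.

Section hull_dynamics.
Context {R : realType} {G H : topGroupType}.
Hypotheses (lcG : lcsc_hausdorff G) (lcH : lcsc_hausdorff H).
Variables (U K : set (G * H)).
Hypotheses (openU : open U) (U1 : U 1%g) (compactK : compact K).
Local Notation lshift := Defs.lshift.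
Local Notation Del := (Del U K).
Implicit Types (Om : invariant_closed U K) (f : Del -> R).

Lemma Del_bounded f : continuous f -> exists B : R, forall D, `|f D| <= B.
Proof.
move=> cf.
have cDel := Del_compact lcG lcH openU compactK.
have cfD : compact (f @` setT).
  by apply: continuous_compact => //; exact: continuous_subspaceT.
have [B [_ /(_ (`|B| + 1)) hB]] := compact_bounded cfD.
exists (`|B| + 1) => D; apply: hB; last by exists D.
by rewrite (le_lt_trans (ler_norm _))// ltrDl.
Qed.

(** The projection with a type that fixes the hull, for use as the map [j] of
    [mean]. *)
Definition hull_val Om (D : hull Om) : Del := \val D.

Lemma hull_val_continuous Om : continuous (@hull_val Om).
Proof. exact: val_continuous. Qed.

Definition hull_mean Om (mu : probability (borel (hull Om)) R) f : R :=
  @mean R (hull Om) Del (@hull_val Om) mu f.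

Lemma hull_bounded Om f : continuous f -> exists B : R, forall D : hull Om, `|f (hull_val D)| <= B.
Proof. by move=> cf; have [B fB] := Del_bounded cf; exists B => D; exact: fB. Qed.

Lemma Del_act1 (p q : G * H) (D : Del) : (p * q = 1)%g -> Del_act p (Del_act q D) = D.
Proof.
move=> pq; apply: val_inj; apply: closedset_inj.
rewrite [LHS](lshiftM p q (pts (\val D))) pq lshiftE.
by apply/seteqP; split=> x /=; rewrite invg1 mul1g.
Qed.

Lemma hull_act_continuous Om (g : G) : continuous (@hull_act G H U K Om g).
Proof.
move=> D; have FD : Filter (hull_act g @ nbhs D) := fmap_filter _ (nbhs_filter D).
apply: (@cvg_val _ _ _ FD).
apply: (@continuous_comp _ _ _ (@hull_val Om) (Del_act (g, 1%g))).
  exact: hull_val_continuous.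
exact: Del_act_continuous.
Qed.

Lemma hull_actK Om (g : G) : cancel (@hull_act G H U K Om g) (hull_act (g^-1)%g).
Proof.
move=> D; apply: val_inj; apply: Del_act1.
by congr (_, _); rewrite ?mulVg ?mulg1.
Qed.

Lemma hull_actVK Om (g : G) : cancel (@hull_act G H U K Om (g^-1)%g) (hull_act g).
Proof. by move=> D; rewrite -{1}(invgK g) hull_actK. Qed.

Lemma hull_mean_invariant Om (mu : probability (borel (hull Om)) R) (g : G) f :
  invariant_measure mu -> continuous f ->
  hull_mean mu (f \o Del_act (g, 1%g)) = hull_mean mu f.
Proof.
move=> inv cf.
have inv' (A : set (borel (hull Om))) : measurable A -> mu (hull_act g @^-1` A) = mu A.
  move=> mA; rewrite -(inv (g^-1)%g A mA); congr (mu _).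
  apply/seteqP; split=> [D AD|_ [D AD <-]] /=; last by rewrite hull_actVK.
  by exists (hull_act g D) => //; rewrite hull_actK.
exact: (@mean_invariant R (hull Om) Del (@hull_val Om) mu (@hull_val_continuous Om)
  (@hull_bounded Om) (hull_act g) f (@hull_act_continuous Om g) cf inv').
Qed.

Lemma Del_separation (O : set Del) D : open O -> O D ->
  exists f : Del -> R, [/\ continuous f, forall y, 0 <= f y <= 1, f D = 1 &
    forall z, ~ O z -> f z = 0].
Proof.
have hDel := Del_hausdorff lcG lcH (U := U) (K := K).
have cDel := Del_compact lcG lcH openU compactK.
apply: completely_regular_separation.
exact: (@normal_completely_regular R _ (compact_normal hDel cDel) (hausdorff_accessible hDel)).
Qed.

Lemma hull_separation Om (O : set (hull Om)) x : open O -> O x ->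
  exists f : Del -> R, [/\ continuous f, forall y, 0 <= f y <= 1, f (hull_val x) = 1 &
    forall z, ~ O z -> f (hull_val z) = 0].
Proof.
move=> [ O' oO' <-] Ox; have [f [cf f01 f1 f0]] := Del_separation oO' Ox.
by exists f; split=> // z nOz; exact: f0.
Qed.

End hull_dynamics.

(** * The density of states as a measure *)

Lemma pushforward_measure_ex {d d'} {T1 : measurableType d} {T2 : measurableType d'}
    {R : realType} (nu : {measure set T1 -> \bar R}) (f : T1 -> T2) :
  measurable_fun setT f ->
  exists eta : {measure set T2 -> \bar R}, (forall A, eta A = nu (f @^-1` A)) /\
    forall g : T2 -> \bar R, measurable_fun setT g -> nu.-integrable setT (g \o f) ->
      (\int[eta]_y g y = \int[nu]_x g (f x))%E.
Proof.
move=> mf.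
pose eta : {measure set T2 -> \bar R} :=
  measure_function_pushforward__canonical__measure_function_Measure nu mf.
exists eta; split=> // g mg ig.
have /= <- := integral_pushforward mf mg (ig : nu.-integrable (f @^-1` setT) _) measurableT.
exact: eq_measure_integral.
Qed.

Section probability_of_measure.
Context {d} {T : measurableType d} {R : realType}.
Variables (nu : {measure set T -> \bar R}) (nuT : nu setT = 1%E).

(** The total mass is carried as an argument so that the function [nu] can
    itself receive the structure of a probability measure. *)
Definition unit_mass of (nu setT = 1%E) : set T -> \bar R := nu.

Let prob := unit_mass nuT.

Let prob0 : prob set0 = 0%E. Proof. exact: measure0. Qed.

Let prob_ge0 A : (0 <= prob A)%E. Proof. exact: measure_ge0. Qed.

Let prob_sigma_additive : semi_sigma_additive prob.
Proof. exact: measure_semi_sigma_additive. Qed.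

HB.instance Definition _ := isMeasure.Build _ _ _ prob prob0 prob_ge0 prob_sigma_additive.

HB.instance Definition _ := Measure_isProbability.Build _ _ _ prob nuT.

Lemma probability_ex : exists P : probability T R, forall A, P A = nu A.
Proof. by exists prob. Qed.

End probability_of_measure.

Section density_of_states.
Context {R : realType} {G H : topGroupType}.
Hypotheses (lcG : lcsc_hausdorff G) (lcH : lcsc_hausdorff H).
Variables (U K : set (G * H)) (v : H -> R) (rho : G -> R).
Hypotheses (openU : open U) (U1 : U 1%g) (compactK : compact K).
Hypotheses (vwin : window v) (rhoCc : Cc rho) (rho_ge0 : forall g, 0 <= rho g).
Variables (a : completion U K v) (A : oper_family U K v).
Arguments A : clear implicits.
Hypotheses (sa : completion_selfadj a) (aA : forall D, is_lam a (A D)).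
Local Notation ldos := (local_dos rho A).

Let ldos_cont (phi : R -> R) : continuous phi -> continuous (ldos phi).
Proof. exact: (local_dos_continuous lcG lcH openU U1 vwin rhoCc sa aA). Qed.

Section one_hull.
Variables (Om : invariant_closed U K) (mu : probability (borel (hull Om)) R).

Let hb (f : Del U K -> R) : continuous f ->
  exists B : R, forall D : hull Om, `|f (hull_val D)| <= B.
Proof. by move=> cf; exact: (hull_bounded lcG lcH openU compactK Om cf). Qed.
Let hc := @hull_val_continuous G H U K Om.

Lemma dos_functionalE (phi : R -> R) : continuous phi ->
  dos_functional rho A mu phi = (hull_mean mu (ldos phi))%:E.
Proof.
move=> cphi; rewrite /hull_mean -(mean_integral mu hc hb (ldos_cont cphi)).
by [].
Qed.

(** The functional [Lam] is positive on functions that are nonnegative on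
    [[- M, M]], where [M] bounds the norm of all operators of the family. *)
Lemma is_dos_exists : exists eta : {measure set (measurableTypeR R) -> \bar R},
  is_dos rho A mu eta.
Proof.
have [M M0 ldos_ge0] := local_dos_ge0 openU U1 vwin rhoCc rho_ge0 sa aA.
pose Lam phi := hull_mean mu (ldos phi).
have cK : compact [set` `[- M, M]] := @segment_compact R (- M) M.
have LamD (f g : R -> R) : continuous f -> continuous g ->
    Lam (fun y => f y + g y) = Lam f + Lam g.
  move=> cf cg; rewrite /Lam /hull_mean -(meanD mu hc hb)//; [|exact: ldos_cont|exact: ldos_cont].
  congr (mean _ _ _); apply/funext => D.
  exact: (local_dosD openU U1 vwin rhoCc sa aA).
have LamZ (c : R) (f : R -> R) : continuous f -> Lam (fun y => c * f y) = c * Lam f.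
  move=> cf; rewrite /Lam /hull_mean -(meanZ mu hc hb)//; last exact: ldos_cont.
  congr (mean _ _ _); apply/funext => D.
  exact: (local_dosZ openU U1 vwin rhoCc sa aA).
have Lam_ge0 (f : R -> R) : continuous f -> (forall x, [set` `[- M, M]] x -> 0 <= f (id x)) -> 0 <= Lam f.
  move=> cf f0; rewrite -(mean_cst (@hull_val _ _ _ _ Om) mu 0).
  apply: (le_mean mu hc hb) => // [||D]; [exact: cst_continuous|exact: ldos_cont|].
  by apply: ldos_ge0 => // t tM; apply: f0; rewrite /= in_itv /= -ler_norml.
have sep (O : set R) x : open O -> O x -> exists f : R -> R,
    [/\ continuous f, forall y, 0 <= f y <= 1, f (id x) = 1 & forall z, ~ O z -> f (id z) = 0].
  by move=> oO Ox; apply: completely_regular_separation => //; exact: uniform_completely_regular.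
have idc : continuous (@id R) by move=> x; exact: cvg_id.
pose nu := riesz_measure idc cK sep LamD LamZ Lam_ge0.
have nuT : nu setT = (Lam (fun=> 1))%:E by exact: riesz_measureT.
have mid : measurable_fun [set: borel R] (id : borel R -> measurableTypeR R).
  exact: (continuous_borel_measurable idc).
have [eta [etaE eta_int]] := pushforward_measure_ex nu mid.
exists eta; split=> [C cC|phi [cphi sphi]].
  apply: le_lt_trans (_ : eta setT < +oo)%E; last by rewrite etaE preimage_setT nuT ltry.
  have mC : measurable (C : set (measurableTypeR R)) by exact: compact_measurable.
  by apply: le_measure; [exact: mem_set|exact: mem_set measurableT|exact: subsetT].
have [B [B0 phiB]] : exists B, 0 <= B /\ forall t, `|phi t| <= B.
  by have [B ? ?] := Cc_bounded (conj cphi sphi : Cc phi); exists B.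
have mphi : measurable_fun [set: measurableTypeR R] (EFin \o phi).
  by apply/measurable_EFinP; exact: continuous_measurable_fun.
have iphi : nu.-integrable setT ((EFin \o phi) \o id).
  apply: measurable_bounded_integrable => //.
  - by have := ltry (Lam (fun=> 1)); rewrite -nuT.
  - exact: (@continuous_borel_measurable R R _ cphi).
  - exists B; split; first exact: num_real.
    by move=> M' BM x _; apply: le_trans (phiB x) (ltW BM).
transitivity (Lam phi)%:E; last exact/esym/dos_functionalE.
rewrite -(riesz_integral idc cK sep LamD LamZ Lam_ge0 cphi); last by exists B => x; exact: phiB.
exact: (eta_int _ mphi iphi).
Qed.

Lemma dos_integral (phi : R -> R) : Cc phi ->
  (\int[dos rho A mu]_t (phi t)%:E)%E = (hull_mean mu (ldos phi))%:E.
Proof.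
move=> phiCc; rewrite -dos_functionalE; last by case: phiCc.
have := xgetPex (mzero : {classic {measure set (measurableTypeR R) -> \bar R}}) is_dos_exists.
by move=> [_]; exact.
Qed.
End one_hull.
End density_of_states.

(** * Unique ergodicity and convergence of means *)

Section unique_ergodicity.
Context {R : realType} {G H : topGroupType}.
Hypotheses (lcG : lcsc_hausdorff G) (lcH : lcsc_hausdorff H).
Variables (U K : set (G * H)).
Hypotheses (openU : open U) (U1 : U 1%g) (compactK : compact K).
Local Notation Del := (Del U K).
Implicit Types (Om : invariant_closed U K) (f g : Del -> R).

Let hc Om := @hull_val_continuous G H U K Om.

Let hb Om f : continuous f -> exists B : R, forall D : hull Om, `|f (hull_val D)| <= B.
Proof. by move=> cf; exact: (hull_bounded lcG lcH openU compactK Om cf). Qed.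

(** The measure representing [Lam] on the hull is an invariant probability
    measure, hence equal to [mu]. *)
Lemma uniquely_ergodic_mean Om (mu : probability (borel (hull Om)) R)
    (Lam : (Del -> R) -> R) : uniquely_ergodic mu ->
  (forall f g, continuous f -> continuous g -> Lam (fun D => f D + g D) = Lam f + Lam g) ->
  (forall (c : R) f, continuous f -> Lam (fun D => c * f D) = c * Lam f) ->
  (forall f, continuous f -> (forall D : hull Om, 0 <= f (hull_val D)) -> 0 <= Lam f) ->
  Lam (fun=> 1) = 1 ->
  (forall (g : G) f, continuous f -> Lam (f \o Del_act (g, 1%g)) = Lam f) ->
  forall f, continuous f -> Lam f = hull_mean mu f.
Proof.
move=> [invmu ue] LamD LamZ Lam_ge0 Lam1 Lam_inv f cf.
have cOm : compact [set: hull Om] by exact: (hull_compact lcG lcH openU compactK).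
have Lge0 f' : continuous f' -> (forall D : hull Om, [set: hull Om] D -> 0 <= f' (hull_val D)) ->
    0 <= Lam f'.
  by move=> cf' f'0; apply: Lam_ge0 => // D; exact: f'0.
have sep := @hull_separation R G H lcG lcH U K openU compactK Om.
pose nu := riesz_measure (@hc Om) cOm sep LamD LamZ Lge0.
have nuT : nu setT = 1%:E by rewrite -Lam1; exact: riesz_measureT.
have [P PE] := probability_ex nuT.
have invP : invariant_measure P.
  move=> g A mA; rewrite !PE.
  exact: (@riesz_outer_invariant R (hull Om) Del (@hull_val _ _ _ _ Om) Lam
    (hull_act g) (hull_act (g^-1)%g) (Del_act (g, 1%g)) (Del_act ((g^-1)%g, 1%g)) A
    (@hull_act_continuous _ _ _ _ Om g) (@hull_act_continuous _ _ _ _ Om (g^-1)%g)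
    (@Del_act_continuous _ _ _ _ _) (@Del_act_continuous _ _ _ _ _)
    (@hull_actK _ _ _ _ Om g) (@hull_actVK _ _ _ _ Om g)
    (fun D => erefl) (fun D => erefl) (@Lam_inv g) (@Lam_inv (g^-1)%g)).
apply: EFin_inj; rewrite -(mean_integral mu (@hc Om) (@hb Om) cf).
rewrite -(riesz_integral (@hc Om) cOm sep LamD LamZ Lge0 cf (hb Om cf)).
by apply: eq_measure_integral => A mA _; exact: etrans (esym (PE A)) (ue P invP A mA).
Qed.

Section limits_of_means.
Variables (Om : invariant_closed U K) (Om_ : nat -> invariant_closed U K).
Variable mu_ : forall l, probability (borel (hull (Om_ l))) R.

(** The set where [f <= - e] is compact and misses the limit hull, so it
    eventually misses the hulls that approach it. This is the only place where
    their convergence enters. *)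
Lemma hull_mean_eventually_ge (F : set_system nat) {FF : Filter F} f (e : R) :
  Om_ @ F --> Om -> continuous f -> (forall D : hull Om, 0 <= f (hull_val D)) -> 0 < e ->
  \forall l \near F, - e <= hull_mean (mu_ l) f.
Proof.
move=> cvgOm cf f0 e0; pose C := [set D : Del | f D <= - e].
have cC : compact C.
  apply: (subclosed_compact _ (Del_compact lcG lcH openU compactK)) => //.
  apply: (@preimage_closed _ _ f [set t | t <= - e]); first by move=> D _; exact: cf.
  exact: closed_le.
have COm : C `&` pts (\val Om) = set0.
  rewrite -subset0 => D [CD /mem_set OmD].
  have := f0 (exist _ D OmD : hull Om); rewrite leNgt => /negP; apply.
  by apply: le_lt_trans CD _; rewrite oppr_lt0.
have vOm : (fun l => \val (Om_ l)) @ F --> \val Om.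
  exact: (cvg_comp _ _ cvgOm (@val_continuous _ _ Om)).
apply: (filterS _ (fell_cvg_miss vOm cC COm)) => l Cl.
rewrite -[leLHS](mean_cst (@hull_val _ _ _ _ (Om_ l)) (mu_ l)).
apply: (le_mean (mu_ l) (@hc _) (@hb _)) => // [|D]; first exact: cst_continuous.
rewrite leNgt; apply/negP => /ltW fD.
by have : (C `&` pts (\val (Om_ l))) (hull_val D);
  [split=> //; exact: set_valP D|rewrite Cl].
Qed.

Hypothesis invmu_ : forall l, invariant_measure (mu_ l).
Hypothesis cvgOm : Om_ @ \oo --> Om.

(** Along an ultrafilter the means of every continuous function converge, and
    their limits form a functional that is positive on the limit hull by
    [hull_mean_eventually_ge]. *)
Lemma hull_mean_cvg (mu : probability (borel (hull Om)) R) f : uniquely_ergodic mu ->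
  continuous f -> (fun l => hull_mean (mu_ l) f) @ \oo --> hull_mean mu f.
Proof.
move=> ueOm cf; apply: cvg_ultra => F FU ooF.
have FOm : Om_ @ F --> Om by move=> V nV; apply: ooF; exact: cvgOm.
have lim_ex g : exists l : R, continuous g -> (fun l => hull_mean (mu_ l) g) @ F --> l.
  have [cg|ncg] := pselect (continuous g); last by exists 0.
  have [B gB] := Del_bounded lcG lcH openU compactK cg.
  have [|l gl] := @ultra_cvg_real R nat F _ (fun l => hull_mean (mu_ l) g) B; last by exists l.
  by move=> l; apply: (mean_bounded (mu_ l) (@hc _) (@hb _) cg) => D; exact: gB.
have [Lam LamP] := choice lim_ex.
have unique g l : continuous g -> (fun l => hull_mean (mu_ l) g) @ F --> l -> Lam g = l.
  by move=> cg gl; apply: (cvg_unique _ (LamP g cg) gl); exact: Rhausdorff.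
rewrite -(@uniquely_ergodic_mean Om mu Lam)//; first exact: LamP.
- move=> g h cg ch; apply: unique; first exact: continuous_add.
  rewrite (_ : (fun l => _) = (fun l => hull_mean (mu_ l) g) \+ (fun l => hull_mean (mu_ l) h)).
    exact: (cvgD (LamP g cg) (LamP h ch)).
  by apply/funext => l; exact: (meanD (mu_ l) (@hc _) (@hb _)).
- move=> c g cg; apply: unique; first exact: continuous_scale.
  rewrite (_ : (fun l => _) = (fun l => c * hull_mean (mu_ l) g)).
    exact: (cvgM (cvg_cst c) (LamP g cg)).
  by apply/funext => l; exact: (meanZ (mu_ l) (@hc _) (@hb _)).
- move=> g cg g0; apply/ler_addgt0Pr => e e0; rewrite addrC -lerBlDl sub0r.
  exact: (cvgr_to_ge (LamP g cg) (hull_mean_eventually_ge FOm cg g0 e0)).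
- apply: unique; first exact: cst_continuous.
  rewrite (_ : (fun l => _) = fun=> 1); first exact: cvg_cst.
  by apply/funext => l; exact: mean_cst.
- move=> g h ch; have ca : continuous (h \o Del_act (g, 1%g)).
    by move=> D; apply: continuous_comp; [exact: Del_act_continuous|exact: ch].
  apply: unique => //; rewrite (_ : (fun l => _) = fun l => hull_mean (mu_ l) h).
    exact: LamP.
  by apply/funext => l; exact: (hull_mean_invariant lcG lcH openU compactK g (@invmu_ l) ch).
Qed.
End limits_of_means.
End unique_ergodicity.

(** * Convergence of the densities of states *)

Theorem theorem3 (R : realType) (G H : topGroupType)
    (lcscG : lcsc_hausdorff G) (lcscH : lcsc_hausdorff H)
    (unimodG : unimodular R G)
    (mG : {measure set (borel G) -> \bar R}) (haarG : left_haar mG)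
    (rho : G -> R) (rhoCc : Cc rho) (rho_ge0 : forall g, 0 <= rho g)
    (rho1 : (\int[mG]_g (rho g)%:E = 1)%E)
    (U K : set (G * H)) (openU : open U) (U1 : U 1%g) (compactK : compact K)
    (v : H -> R) (vwin : window v)
    (Om : invariant_closed U K) (mu : probability (borel (hull Om)) R)
    (ueOm : uniquely_ergodic mu)
    (Om_ : nat -> invariant_closed U K)
    (mu_ : forall l, probability (borel (hull (Om_ l))) R)
    (invmu_ : forall l, invariant_measure (mu_ l))
    (cvgOm : Om_ @ \oo --> Om)
    (A : oper_family U K v) (saA : selfadj_random_operator A) :
  weak_star_cvg (fun l => dos rho A (mu_ l)) (dos rho A mu).
Proof.
have [a [sa aA]] := saA; move=> phi phiCc.
have dosE := dos_integral lcscG lcscH openU U1 compactK vwin rhoCc rho_ge0 sa aA.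
rewrite dosE//; under eq_fun do rewrite dosE//.
apply: cvg_EFin; first exact: nearW.
have [cphi _] := phiCc.
apply: (hull_mean_cvg lcscG lcscH openU compactK (fun l => @invmu_ l) cvgOm ueOm).
exact: (local_dos_continuous lcscG lcscH openU U1 vwin rhoCc sa aA cphi).
Qed.
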